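(* Let $\psi=\psi_R+i\psi_I$ be an analytic wavelet satisfying Assumption W, and let $X$ be a stationary real Gaussian process whose spectral density $f_X$ satisfies Assumption S (both assumptions are stated in the context), represented as $X(t)=\mu_X+\int_{\mathbb R}e^{it\lambda}\sqrt{f_X(\lambda)}\,W(d\lambda)$. Let $j\in\mathbb Z$ and assume $\sigma_j>0$, where $\sigma_j^2=\int_{\mathbb R}|\widehat{\psi_R}(2^j\lambda)|^2f_X(\lambda)\,d\lambda$. For $\ell\in 2\mathbb N=\{2,4,6,\dots\}$ put $$c_\ell=(-2)^{\ell/2}\,\frac{(\ell/2)!}{\ell!}\,c_{A,\ell/2},\qquad c_{A,k}=\int_0^\infty A(\sqrt{2u})\,L_k(u)\,e^{-u}\,du,$$ $$Q^{(\ell)}_{t,j}(\lambda_1,\dots,\lambda_\ell)=c_\ell\left[\sigma_j^{-\ell}\prod_{k=1}^{\ell}e^{it\lambda_k}\,\widehat{\psi_R}(2^j\lambda_k)\sqrt{f_X(\lambda_k)}\right]1_{\{N(\lambda_{1:\ell})=\ell/2\}},$$ where $L_k$ is the Laguerre polynomial of degree $k$ and $N(\lambda_{1:\ell})$ is the number of indices $k\in\{1,\dots,\ell\}$ with $\lambda_k<0$. Then, for every $t\in\mathbb R$, the random variable $U^A[j]X(t)=A(|X\star\psi_j(t)|)$ has the following expansion into Wiener-Itô integrals (the series converging in $L^2(\Omega)$). (a) If $A(r)=r^\nu$ with $\nu\in(0,\infty)$, then $$U^A[j]X(t)=\mathbb E\big[U^A[j]X(t)\big]+\sigma_j^\nu\sum_{\ell\in2\mathbb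 N}\int'_{\mathbb R^\ell}Q^{(\ell)}_{t,j}(\lambda_1,\dots,\lambda_\ell)\,W(d\lambda_1)\cdots W(d\lambda_\ell),\qquad \mathbb E\big[U^A[j]X(t)\big]=\sigma_j^\nu c_{A,0}.$$ (b) If $A(r)=\ln r$, then $$U^A[j]X(t)=\mathbb E\big[U^A[j]X(t)\big]+\sum_{\ell\in2\mathbb N}\int'_{\mathbb R^\ell}Q^{(\ell)}_{t,j}(\lambda_1,\dots,\lambda_\ell)\,W(d\lambda_1)\cdots W(d\lambda_\ell),\qquad \mathbb E\big[U^A[j]X(t)\big]=c_{A,0}+\ln\sigma_j .$$
   Context: Fourier transform: $\widehat g(\lambda)=\int_{\mathbb R}e^{-it\lambda}g(t)\,dt$. Analytic wavelet: $\psi=\psi_R+i\psi_I\in L^1(\mathbb R)\cap L^2(\mathbb R)$ with $\psi_R,\psi_I$ real-valued and forming a Hilbert pair, $\psi_I(t)=\frac1\pi\,\mathrm{p.v.}\int_{\mathbb R}\frac{\psi_R(\tau)}{t-\tau}d\tau$, equivalently $\widehat{\psi_I}(\lambda)=-i\,\mathrm{sgn}(\lambda)\widehat{\psi_R}(\lambda)$. For $j\in\mathbb Z$, $\psi_j(t)=2^{-j}\psi(2^{-j}t)$ and $X\star\psi_j(t)=\int_{\mathbb R}X(s)\psi_j(t-s)\,ds$. Assumption W: $\widehat{\psi_R}\in L^1(\mathbb R)\cap L^2(\mathbb R)$ and $\widehat{\psi_R}(\lambda)=C_{\psi_R}(\lambda)|\lambda|^\alpha$ for some $\alpha>0$ and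 some bounded continuous $C_{\psi_R}:\mathbb R\to\mathbb C$ with $C_{\psi_R}(0)\neq0$. Assumption S: $X$ is a mean-square continuous stationary real Gaussian process with constant mean $\mu_X$ and covariance function $R_X(t)=\int_{\mathbb R}e^{i\lambda t}f_X(\lambda)\,d\lambda$, where $f_X\in L^1(\mathbb R)$ is nonnegative, even, and of one of the forms (a) $f_X(\lambda)=C_X(\lambda)$ (called the case $\beta=1$), or (b) $f_X(\lambda)=C_X(\lambda)|\lambda|^{\beta-1}$ with $\beta\in(0,1)$ and $C_X(0)>0$; in both cases $C_X:\mathbb R\to[0,\infty)$ is bounded and continuous. Random measure: $W$ is a complex-valued Gaussian random measure on $\mathbb R$ with $W(\Delta)=\overline{W(-\Delta)}$, $\mathbb E[W(\Delta)]=0$ and $\mathbb E[W(\Delta_1)\overline{W(\Delta_2)}]=\mathrm{Leb}(\Delta_1\cap\Delta_2)$ for Borel sets. Wiener-Itô integrals: let $\overline H=\{f\in L^2(\mathbb R;\mathbb C): f(-\lambda)=\overline{f(\lambda)}\}$, a real Hilbert space with inner product $\langle f,g\rangle=\int f\overline g\,d\lambda$. For $f\in\overline H^{\otimes m}$ (i.e. $f\in L^2(\mathbb R^m;\mathbb C)$ with $f(-\lambda_1,\dots,-\lambda_m)=\overline{f(\lambda_1,\dots,\lambda_m)}$), $I_m(f)=\int'_{\mathbb R^m}f(\lambda_1,\dots,\lambda_m)W(d\lambda_1)\cdots W(d\lambda_m)$ is the $m$-fold Wiener-Itô integral, where $\int'$ means that the hyperplanes $\lambda_k=\pm\lambda_{k'}$,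 $k\neq k'$, are excluded. It is the continuous linear map determined by $I_m(f)=I_m(\mathrm{Sym} f)$, $\mathbb E[I_m(f)^2]=m!\,\|\mathrm{Sym} f\|_{L^2}^2$, and $I_m(g^{\otimes m})=H_m\big(\int g\,dW\big)$ for $g\in\overline H$ with $\|g\|=1$, where $H_m(x)=(-1)^me^{x^2/2}\frac{d^m}{dx^m}e^{-x^2/2}$. Laguerre polynomials: $L_k(u)=\frac{e^u}{k!}\frac{d^k}{du^k}(e^{-u}u^k)$. *)

(* Defs.v *)
From HB Require Import structures.
From mathcomp Require Import all_boot all_order all_algebra.
From mathcomp Require Import all_classical all_reals all_analysis.
From mathcomp Require Import perm complex.

Set Implicit Arguments.
Unset Strict Implicit.
Unset Printing Implicit Defensive.

Import Order.TTheory GRing.Theory Num.Theory.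
Import numFieldNormedType.Exports.
Import Normc.

Local Open Scope classical_set_scope.
Local Open Scope ring_scope.
Local Open Scope complex_scope.

Section ComplexIntegral.
Context d (T : measurableType d) (R : realType).
Variable mu : {measure set T -> \bar R}.
Implicit Types f g : T -> R[i].

Definition cmeasurable f :=
  measurable_fun setT (fun x => complex.Re (f x)) /\
  measurable_fun setT (fun x => complex.Im (f x)).

Definition cLp (p : R) f :=
  (fun x => complex.Re (f x)) \in Lfun mu p%:E /\
  (fun x => complex.Im (f x)) \in Lfun mu p%:E.

Definition cint f : R[i] :=
  Rintegral mu setT (fun x => complex.Re (f x)) +i*
  Rintegral mu setT (fun x => complex.Im (f x)).

Definition sqdist f g : \bar R :=
  (\int[mu]_x ((normc (f x - g x)) ^+ 2)%:E)%E.

End ComplexIntegral.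

Section Wavelets.
Context (R : realType).
Implicit Types (psiR psiI : R -> R) (psi : R -> R[i]).

Local Notation leb := (@lebesgue_measure R).

Definition expi (x : R) : R[i] := cos x +i* sin x.

Definition fourier (g : R -> R[i]) (lam : R) : R[i] :=
  cint leb (fun t => expi (- (t * lam)) * g t).

Definition fourierR (g : R -> R) : R -> R[i] := fourier (fun t => (g t)%:C).

(* For psiR, psiI in L^1 and L^2 the last clause is equivalent to
   psiI(t) = 1/pi p.v. \int psiR(tau)/(t - tau) dtau for almost every t. *)
Definition analytic_wavelet psiR psiI :=
  [/\ psiR \in Lfun leb 1%:E /\ psiR \in Lfun leb 2%:E,
      psiI \in Lfun leb 1%:E /\ psiI \in Lfun leb 2%:E
    & forall lam, fourierR psiI lam =
        (0 -i* Num.sg lam) * fourierR psiR lam].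

Definition bounded_continuousC (C : R -> R[i]) :=
  [/\ continuous (fun x => complex.Re (C x)),
      continuous (fun x => complex.Im (C x))
    & exists M : R, forall x, normc (C x) <= M].

Definition assumptionW psiR :=
  [/\ cLp leb 1 (fourierR psiR), cLp leb 2 (fourierR psiR)
    & exists (C : R -> R[i]) (alpha : R),
      [/\ 0 < alpha, bounded_continuousC C, C 0 != 0
        & forall lam, fourierR psiR lam = C lam * (`|lam| `^ alpha)%:C]].

Definition dilate psi (j : int) (t : R) : R[i] :=
  ((2 : R) ^ (- j))%:C * psi ((2 : R) ^ (- j) * t).

(* The value of fX at 0 is irrelevant, and |lam|^(beta-1) is infinite there:
   the second form is required at lam != 0 only. *)
Definition spectral_density (fX : R -> R) :=
  [/\ fX \in Lfun leb 1%:E, forall lam, 0 <= fX lam,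
      forall lam, fX (- lam) = fX lam
    & exists C : R -> R,
      [/\ continuous C, exists M : R, forall x, C x <= M, forall x, 0 <= C x
        & (forall lam, fX lam = C lam) \/
          (exists beta : R, [/\ 0 < beta < 1, 0 < C 0
            & forall lam, lam != 0 ->
                fX lam = C lam * `|lam| `^ (beta - 1)])]].

Definition sigma_ psiR (fX : R -> R) (j : int) : R :=
  Num.sqrt (Rintegral leb setT
    (fun lam => (normc (fourierR psiR ((2 : R) ^ j * lam))) ^+ 2 * fX lam)).

Definition hermite (m : nat) (x : R) : R :=
  (-1) ^+ m * expR (x ^+ 2 / 2) *
  (derive1n m (fun y : R => expR (- (y ^+ 2 / 2)) : R^o)) x.

Definition laguerre (k : nat) (u : R) : R :=
  expR u / k`!%:R * (derive1n k (fun v : R => expR (- v) * v ^+ k : R^o)) u.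

Definition cA (A : R -> R) (k : nat) : R :=
  Rintegral leb `[0, +oo[%classic
    (fun u => A (Num.sqrt (2 * u)) * laguerre k u * expR (- u)).

Definition c_ (A : R -> R) (l : nat) : R :=
  (-2) ^+ l./2 * (l./2)`!%:R / l`!%:R * cA A l./2.

Definition Q_ (A : R -> R) psiR (fX : R -> R) (t : R) (j : int) (l : nat)
    (lam : l.-tuple R) : R[i] :=
  (c_ A l)%:C *
  (((sigma_ psiR fX j) ^- l)%:C *
   \prod_(k < l) (expi (t * tnth lam k)
                  * fourierR psiR ((2 : R) ^ j * tnth lam k)
                  * (Num.sqrt (fX (tnth lam k)))%:C)) *
  (count (fun x : R => x < 0) lam == l./2)%:R.

End Wavelets.

Section Stochastic.
Context d (T : measurableType d) (R : realType) (P : probability T R).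

Local Notation leb := (@lebesgue_measure R).

(* Degenerate Gaussian laws are allowed. *)
Definition gaussian_rv (Y : T -> R) :=
  measurable_fun setT Y /\
  exists m s : R,
    (0 < s /\ forall B, measurable B -> P (Y @^-1` B) = normal_prob m s B) \/
    (\forall w \ae P, Y w = m).

(* Joint measurability in (s, w) is what makes the path integrals
   \int X(s) psi_j(t - s) ds meaningful; the covariance clause contains
   stationarity. *)
Definition assumptionS (X : R -> {RV P >-> R}) (muX : R) (fX : R -> R) :=
  [/\ spectral_density fX,
      measurable_fun [set: measurableTypeR R * T] (fun p => X p.1 p.2),
      forall (n : nat) (a t : 'I_n -> R),
        gaussian_rv (fun w => \sum_(k < n) a k * X (t k) w),
      forall t, 'E_P[X t]%E = muX%:E
    & (forall s t, (fine (covariance P (X (s + t)) (X s)))%:C =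
         cint leb (fun lam => expi (lam * t) * (fX lam)%:C)) /\
      (forall t, (fun s : R => 'E_P[fun w => ((X s w - X t w) ^+ 2)%R]%E)
         @ t --> 0%E)].

Definition gauss_dom (D : set R) :=
  measurable (D : set (measurableTypeR R)) /\ (leb D < +oo)%E.

(* W is used on Borel sets of finite Lebesgue measure only. Additivity (finite
   almost surely, countable in mean square) follows from the covariance, since
   it forces E|W(A u B) - W(A) - W(B)|^2 = 0 for disjoint A and B. *)
Definition gaussian_random_measure (W : set R -> T -> R[i]) :=
  [/\ forall D, gauss_dom D -> cLp P 2 (W D),
      forall D, gauss_dom D ->
        \forall w \ae P, W D w = conjc (W (-%R @` D) w),
      forall D, gauss_dom D -> cint P (W D) = 0,
      forall D1 D2, gauss_dom D1 -> gauss_dom D2 ->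
        cint P (fun w => W D1 w * conjc (W D2 w)) = (fine (leb (D1 `&` D2)))%:C
    & forall (n : nat) (a b : 'I_n -> R) (D : 'I_n -> set R),
        (forall k, gauss_dom (D k)) ->
        gaussian_rv (fun w => \sum_(k < n)
          (a k * complex.Re (W (D k) w) + b k * complex.Im (W (D k) w)))].

(* Z = \int f dW: mean-square limit of the integrals of simple functions. *)
Definition is_stoch_int (W : set R -> T -> R[i]) (f : R -> R[i])
    (Z : T -> R[i]) :=
  [/\ cLp leb 2 f, cLp P 2 Z
    & forall e : R, 0 < e ->
      exists (n : nat) (c : 'I_n -> R[i]) (D : 'I_n -> set R),
      [/\ forall k, gauss_dom (D k),
          (sqdist leb f (fun x => (\sum_(k < n) c k * (\1_(D k) x : R)%:C)%R)
             < e%:E)%E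
        & (sqdist P Z (fun w => (\sum_(k < n) c k * W (D k) w)%R) < e%:E)%E]].

(* Lebesgue integral over R^m of a nonnegative measurable function, as an
   iterated integral (Tonelli). *)
Fixpoint integralRn (m : nat) : (m.-tuple R -> \bar R) -> \bar R :=
  match m with
  | 0 => fun F => F [tuple]
  | m'.+1 => fun F =>
      (\int[leb]_x integralRn (fun v : m'.-tuple R => F [tuple of x :: v]))%E
  end.

(* The m-th tensor power of the real Hilbert space of Hermitian functions. *)
Definition Hbar (m : nat) (f : m.-tuple R -> R[i]) :=
  [/\ cmeasurable (f : m.-tuple (measurableTypeR R) -> R[i]),
      (integralRn (fun v => ((normc (f v)) ^+ 2)%:E) < +oo)%E
    & forall v, f (map_tuple -%R v) = conjc (f v)].

Definition Hbar1 (g : R -> R[i]) :=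
  [/\ cLp leb 2 g, (\int[leb]_x ((normc (g x)) ^+ 2)%:E = 1)%E
    & forall x, g (- x) = conjc (g x)].

Definition symmetrize (m : nat) (f : m.-tuple R -> R[i]) (v : m.-tuple R)
    : R[i] :=
  (m`!%:R)^-1 * \sum_(s : 'S_m) f [tuple tnth v (s i) | i < m].

Definition tensor_power (m : nat) (g : R -> R[i]) (v : m.-tuple R) : R[i] :=
  \prod_(k < m) g (tnth v k).

(* Y = I_m(f), the m-fold Wiener-Ito integral, as a relation, Y being determined
   up to null sets. I_m is the composition of symmetrization with the continuous
   linear extension of g^{(x) m} |-> H_m(\int g dW), ||g|| = 1; real combinations
   of these tensor powers are dense in the symmetric part of Hbar m, and
   E[(sum_k a_k H_m(\int g_k dW))^2] = m! ||sum_k a_k g_k^{(x) m}||^2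
   makes the extension well defined. *)
Definition is_wiener_ito (W : set R -> T -> R[i]) (m : nat)
    (f : m.-tuple R -> R[i]) (Y : T -> R) :=
  [/\ Hbar f, Y \in Lfun P 2%:E
    & forall e : R, 0 < e ->
      exists (n : nat) (a : 'I_n -> R) (g : 'I_n -> R -> R[i])
             (xi : 'I_n -> T -> R),
      [/\ forall k, Hbar1 (g k),
          forall k, is_stoch_int W (g k) (fun w => (xi k w)%:C),
          (integralRn (fun v => ((normc (symmetrize f v -
             \sum_(k < n) (a k)%:C * tensor_power (g k) v)) ^+ 2)%:E)
             < e%:E)%E
        & ('E_P[fun w => ((Y w - \sum_(k < n) a k * hermite m (xi k w)) ^+ 2)%R]
             < e%:E)%E]].

(* t w |-> |X * psi_j (t)|, computed along the path of w. *)
Definition wavelet_modulus (X : R -> {RV P >-> R}) (psi : R -> R[i]) (j : int)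
    (t : R) (w : T) : R :=
  normc (cint leb (fun s => (X s w)%:C * dilate psi j (t - s))).

(* U = e + s * \sum_(l = 2, 4, 6, ...) I_l(q l) in L^2, with E[U] = e. *)
Definition chaos_expansion (W : set R -> T -> R[i]) (U : T -> R) (e s : R)
    (q : forall l : nat, l.-tuple R -> R[i]) :=
  [/\ U \in Lfun P 2%:E, 'E_P[U]%E = e%:E
    & exists I : nat -> T -> R,
      (forall l : nat, (0 < l)%N -> ~~ odd l -> is_wiener_ito W (@q l) (I l)) /\
      (fun n : nat => 'E_P[fun w =>
         ((U w - (e + s * \sum_(2 <= l < n | ~~ odd l) I l w)) ^+ 2)%R]%E)
        @ \oo --> 0%E].

End Stochastic.

(* Main.v *)
(* Put h(l) = exp(i t l) fourierR psiR (2^j l) sqrt(fX l).  Up to the factor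
   sigma, the real and imaginary parts of X * psi_j (t) are the Gaussian
   integrals x of h / sigma and y of -i sgn(l) h / sigma.  They are independent
   and standard normal, so u = (x^2 + y^2) / 2 has the exponential law, for
   which the Laguerre polynomials are orthonormal and complete, and
   A(sigma sqrt(2 u)) expands in L^2 along the polynomials L_k(u).

   It remains to see that c_{A,k} L_k(u) is the 2k-fold Wiener-Ito integral of
   Q^(2k).  The variable cos(theta) x - sin(theta) y is the integral of
   exp(i theta sgn l) h(l) / sigma, so H_2k of it is the integral of the 2k-th
   tensor power of that function.  Averaging over 2k+1 equally spaced angles
   kills the tuples whose numbers of positive and negative frequencies differ,
   which leaves a multiple of Q^(2k), and turns H_2k into a multiple of L_k(u). *)

Require Import Defs.
From mathcomp Require Import all_boot all_order all_algebra.
From mathcomp Require Import all_classical all_reals all_analysis.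
From mathcomp Require Import measurable_realfun perm complex.
From mathcomp Require Import ring lra zify.
Import Order.TTheory GRing.Theory Num.Theory.
Import numFieldNormedType.Exports.
Local Open Scope classical_set_scope.
Local Open Scope ring_scope.
Local Open Scope complex_scope.

Set Implicit Arguments.
Unset Strict Implicit.
Unset Printing Implicit Defensive.

(** * Real integrals *)

(** The law of [u] is reached without joint densities or a notion of independence. All that is used
    of the pair is the characteristic function of r x + s y. Since exp(-n x^2/2) is a Gaussian
    average of cosines, this yields the expectation of exp(-n u) for natural n, that is, the moments
    of exp(-u) in [0, 1], and these determine the law (Hausdorff). Bernstein polynomials serve that
    uniqueness and also the completeness of the Laguerre polynomials: exp(-n v) has geometric
    coefficients, so Parseval's identity is explicit for it; polynomials in exp(-v) reach the
    continuous functions of exp(-v), and a truncation reaches the monotone functions A(sqrt(2 v)).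

    The process is given by paths, the stochastic integral by a relation. They are matched by
    testing against [W D]: a random variable with the right inner products and the right norm is the
    stochastic integral. The mean [muX] drops out because alpha > 0 forces the wavelet to have
    integral zero.

    Powers and logarithm are treated together through A(sigma r) = e0 + s A(r), with e0 = 0 and s =
    sigma^nu, or e0 = ln sigma and s = 1. *)

Section RealIntegrals.
Context d (T : measurableType d) (R : realType).
Variable mu : {measure set T -> \bar R}.
Implicit Types (f g : T -> R).

Definition L1 f := mu.-integrable setT (EFin \o f).

Definition L2 f := measurable_fun setT f /\ L1 (fun x => f x ^+ 2).

Definition Int f : R := Rintegral mu setT f.

Lemma L1_measurable f : L1 f -> measurable_fun setT f.
Proof. by move=> /measurable_int/measurable_EFinP. Qed.

Lemma L1_integral f : L1 f -> (\int[mu]_x (f x)%:E = (Int f)%:E)%E.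
Proof. by move=> f1; rewrite /Int /Rintegral fineK// integrable_fin_num. Qed.

Lemma IntE f e : (\int[mu]_x (f x)%:E = e%:E)%E -> Int f = e.
Proof. by rewrite /Int /Rintegral => ->. Qed.

Lemma L1D f g : L1 f -> L1 g -> L1 (fun x => f x + g x).
Proof. by move=> f1 g1; have := integrableD measurableT f1 g1. Qed.

Lemma L1B f g : L1 f -> L1 g -> L1 (fun x => f x - g x).
Proof. by move=> f1 g1; have := integrableB measurableT f1 g1. Qed.

Lemma L1Z k f : L1 f -> L1 (fun x => k * f x).
Proof. by move=> f1; have := integrableZl measurableT k f1. Qed.

Lemma L1Zr k f : L1 f -> L1 (fun x => f x * k).
Proof. by move=> f1; under eq_fun do rewrite mulrC; exact: L1Z. Qed.

Lemma L1N f : L1 f -> L1 (fun x => - f x).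
Proof. by move=> f1; rewrite (eq_fun (fun x => esym (mulN1r (f x)))); exact: L1Z. Qed.

Lemma L1_0 : L1 (fun=> 0).
Proof. exact: integrable0. Qed.

Lemma L1_sum I (s : seq I) (p : pred I) (F : I -> T -> R) :
  (forall i, L1 (F i)) -> L1 (fun x => \sum_(i <- s | p i) F i x).
Proof.
move=> F1; elim: s => [|i s IH].
  by under eq_fun do rewrite big_nil; exact: L1_0.
by case pi: (p i); under eq_fun do rewrite big_cons pi; [exact: L1D|].
Qed.

Lemma L1_le f g : measurable_fun setT f -> L1 g ->
  (forall x, `|f x| <= g x) -> L1 f.
Proof.
move=> mf g1 fg; apply: (le_integrable measurableT _ _ g1).
  exact/measurable_EFinP.
by move=> x _; rewrite /= lee_fin (le_trans (fg x))// ler_norm.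
Qed.

Lemma L1_norm f : L1 f -> L1 (fun x => `|f x|).
Proof. by move=> f1; have := integrable_norm f1. Qed.

Lemma IntD f g : L1 f -> L1 g -> Int (fun x => f x + g x) = Int f + Int g.
Proof. by move=> f1 g1; rewrite /Int RintegralD. Qed.

Lemma IntB f g : L1 f -> L1 g -> Int (fun x => f x - g x) = Int f - Int g.
Proof. by move=> f1 g1; rewrite /Int RintegralB. Qed.

Lemma IntZ k f : L1 f -> Int (fun x => k * f x) = k * Int f.
Proof. by move=> f1; rewrite /Int RintegralZl. Qed.

Lemma IntZr k f : L1 f -> Int (fun x => f x * k) = Int f * k.
Proof. by move=> f1; rewrite /Int RintegralZr. Qed.

Lemma IntN f : L1 f -> Int (fun x => - f x) = - Int f.
Proof. by move=> f1; rewrite (eq_fun (fun x => esym (mulN1r (f x)))) IntZ// mulN1r. Qed.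

Lemma Int0 : Int (fun=> 0) = 0.
Proof. by rewrite /Int /Rintegral integral0. Qed.

Lemma Int_sum I (s : seq I) (p : pred I) (F : I -> T -> R) :
  (forall i, L1 (F i)) ->
  Int (fun x => \sum_(i <- s | p i) F i x) = \sum_(i <- s | p i) Int (F i).
Proof.
move=> F1; elim: s => [|i s IH].
  by under eq_fun do rewrite big_nil; rewrite big_nil Int0.
case pi: (p i); under eq_fun do rewrite big_cons pi; rewrite big_cons pi//.
by rewrite IntD ?IH//; exact: L1_sum.
Qed.

Lemma Int_ge0 f : (forall x, 0 <= f x) -> 0 <= Int f.
Proof. by move=> f0; apply: Rintegral_ge0. Qed.

Lemma le_Int f g : L1 f -> L1 g -> (forall x, f x <= g x) -> Int f <= Int g.
Proof. by move=> f1 g1 fg; apply: le_Rintegral. Qed.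

Lemma le_norm_Int f : L1 f -> `|Int f| <= Int (fun x => `|f x|).
Proof. by move=> f1; apply: le_normr_Rintegral. Qed.

Lemma le_norm_IntB f g h : L1 f -> L1 g -> L1 h ->
  (forall x, `|f x - g x| <= h x) -> `|Int f - Int g| <= Int h.
Proof.
move=> f1 g1 h1 H; rewrite -IntB//.
apply: (le_trans (le_norm_Int (L1B f1 g1))).
by apply: le_Int => //; apply/L1_norm/L1B.
Qed.

Lemma ae_imp (p q : T -> Prop) : (forall x, p x -> q x) ->
  (\forall x \ae mu, p x) -> \forall x \ae mu, q x.
Proof. by move=> pq; apply: filterS. Qed.

Lemma ae_eq_Int f g : measurable_fun setT f -> measurable_fun setT g ->
  (\forall x \ae mu, f x = g x) -> Int f = Int g.
Proof.
move=> mf mg fg; rewrite /Int /Rintegral; congr fine.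
apply: ae_eq_integral => //; [exact/measurable_EFinP..|].
by apply: filterS fg => x fgx _ /=; rewrite fgx.
Qed.

Lemma ae_eq_L1 f g : measurable_fun setT f -> measurable_fun setT g ->
  (\forall x \ae mu, f x = g x) -> L1 f -> L1 g.
Proof.
move=> mf mg fg f1; apply/integrableP; split; first exact/measurable_EFinP.
move/integrableP : f1 => [_]; congr (_ < _)%E.
apply: ae_eq_integral => //.
- by apply: measurableT_comp => //; exact/measurable_EFinP.
- by apply: measurableT_comp => //; exact/measurable_EFinP.
by apply: filterS fg => x fgx _ /=; rewrite fgx.
Qed.

Lemma L1_ge0 f : measurable_fun setT f -> (forall x, 0 <= f x) ->
  (\int[mu]_x (f x)%:E < +oo)%E -> L1 f.
Proof.
move=> mf f0 foo; apply/integrableP; split; first exact/measurable_EFinP.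
by under eq_integral do rewrite /= ger0_norm//.
Qed.

Lemma cvg_Int_dominated_ae (F : nat -> T -> R) f g :
  (forall n, measurable_fun setT (F n)) -> measurable_fun setT f -> L1 g ->
  (\forall x \ae mu, forall n, `|F n x| <= g x) ->
  (\forall x \ae mu, F n x @[n --> \oo] --> f x) ->
  L1 f /\ Int (F n) @[n --> \oo] --> Int f.
Proof.
move=> mF mf g1 Fg Ff.
have [] := @dominated_convergence _ _ _ mu setT measurableT
  (fun n => EFin \o F n) (EFin \o f) (EFin \o g).
- by move=> n; exact/measurable_EFinP.
- exact/measurable_EFinP.
- by apply: filterS Ff => x Fx _; apply: cvg_EFin; [exact: nearW|exact: Fx].
- exact: g1.
- by apply: filterS Fg => x Fx n _ /=; rewrite lee_fin.
move=> f1 _ H; split => //.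
apply: fine_cvg; rewrite -[Int f](_ : fine (\int[mu]_x (f x)%:E)%E = _)//.
by rewrite fineK ?integrable_fin_num//; exact: H.
Qed.

Lemma cvg_Int_dominated (F : nat -> T -> R) f g :
  (forall n, measurable_fun setT (F n)) -> measurable_fun setT f -> L1 g ->
  (forall n x, `|F n x| <= g x) -> (forall x, F n x @[n --> \oo] --> f x) ->
  L1 f /\ Int (F n) @[n --> \oo] --> Int f.
Proof.
move=> mF mf g1 Fg Ff; apply: (cvg_Int_dominated_ae mF mf g1); apply: aeW.
  by move=> x n; exact: Fg.
by move=> x; exact: Ff.
Qed.

Lemma L2_measurable f : L2 f -> measurable_fun setT f.
Proof. by case. Qed.

Lemma L2_sqr f : L2 f -> L1 (fun x => f x ^+ 2).
Proof. by case. Qed.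

Lemma L2M f g : L2 f -> L2 g -> L1 (fun x => f x * g x).
Proof.
move=> [mf f2] [mg g2].
apply: (@L1_le _ (fun x => f x ^+ 2 + g x ^+ 2)).
- exact: measurable_funM.
- exact: L1D.
move=> x; rewrite ler_norml.
have := sqr_ge0 (f x + g x); have := sqr_ge0 (f x - g x).
have := sqr_ge0 (f x); have := sqr_ge0 (g x).
by move=> ? ? ? ?; apply/andP; split; nra.
Qed.

Lemma L2D f g : L2 f -> L2 g -> L2 (fun x => f x + g x).
Proof.
move=> f2 g2; split.
  by apply: measurable_funD; exact: L2_measurable.
under eq_fun do rewrite sqrrD.
by apply: L1D (L2_sqr g2); apply: L1D (L2_sqr f2) _;
  under eq_fun do rewrite mulr2n; apply: L1D; exact: L2M.
Qed.

Lemma L2Z k f : L2 f -> L2 (fun x => k * f x).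
Proof.
move=> [mf f2]; split; first exact: measurable_funM.
by under eq_fun do rewrite exprMn; exact: L1Z.
Qed.

Lemma L2Zr k f : L2 f -> L2 (fun x => f x * k).
Proof. by move=> f2; under eq_fun do rewrite mulrC; exact: L2Z. Qed.

Lemma L2N f : L2 f -> L2 (fun x => - f x).
Proof. by move=> f2; rewrite (eq_fun (fun x => esym (mulN1r (f x)))); exact: L2Z. Qed.

Lemma L2B f g : L2 f -> L2 g -> L2 (fun x => f x - g x).
Proof. by move=> f2 g2; apply: L2D => //; exact: L2N. Qed.

Lemma L2_0 : L2 (fun=> 0).
Proof. by split => //; under eq_fun do rewrite expr0n; exact: L1_0. Qed.

Lemma L2_sum I (s : seq I) (p : pred I) (F : I -> T -> R) :
  (forall i, L2 (F i)) -> L2 (fun x => \sum_(i <- s | p i) F i x).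
Proof.
move=> F1; elim: s => [|i s IH].
  by under eq_fun do rewrite big_nil; exact: L2_0.
by case pi: (p i); under eq_fun do rewrite big_cons pi; [exact: L2D|].
Qed.

Lemma L2_le f g : measurable_fun setT f -> L2 g ->
  (forall x, `|f x| <= `|g x|) -> L2 f.
Proof.
move=> mf g1 fg; split => //; apply: (L1_le _ (L2_sqr g1)).
  exact: measurable_funX.
by move=> x; rewrite normrX -(real_normK (num_real (g x))) lerXn2r ?nnegrE.
Qed.

Lemma L2P f : f \in Lfun mu 2%:E <-> L2 f.
Proof.
split=> [f2|[mf f2]].
  split; last exact: Lfun2_integrable_sqr.
  by move: f2; rewrite inE => /andP[/[!inE]].
rewrite inE; apply/andP; split; rewrite inE//=.
rewrite /finite_norm unlock /Lnorm poweR_lty//.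
have := integrable_lty measurableT f2; congr (_ < _)%E.
apply: eq_integral => x _ /=.
by rewrite -[2%R]/(2%:R) powR_mulrn// real_normK ?num_real.
Qed.

Lemma L1P f : f \in Lfun mu 1 <-> L1 f.
Proof. exact: Lfun1_integrable. Qed.

(** The polynomial a + 2 t b + t^2 c is the integral of (f + t g)^2, hence nonnegative; at its
    minimiser t = -b/c it equals (a c - b^2)/c. *)
Lemma CauchySchwarz f g : L2 f -> L2 g ->
  Int (fun x => f x * g x) ^+ 2 <=
  Int (fun x => f x ^+ 2) * Int (fun x => g x ^+ 2).
Proof.
move=> f2 g2.
set a := Int (fun x => f x ^+ 2); set b := Int (fun x => f x * g x).
set c := Int (fun x => g x ^+ 2).
have a0 : 0 <= a by apply: Int_ge0 => x; exact: sqr_ge0.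
have c0 : 0 <= c by apply: Int_ge0 => x; exact: sqr_ge0.
have H t : 0 <= a + 2 * t * b + t ^+ 2 * c.
  have -> : a + 2 * t * b + t ^+ 2 * c =
      Int (fun x => (f x + t * g x) ^+ 2).
    have -> : (fun x => (f x + t * g x) ^+ 2) =
       (fun x => (f x ^+ 2 + 2 * t * (f x * g x)) + t ^+ 2 * g x ^+ 2).
      by apply/funext => x; ring.
    have h1 := L2_sqr f2; have h2 := L2_sqr g2; have h3 := L2M f2 g2.
    by rewrite !(IntD,IntZ) //; (repeat first [exact: L1Z|apply: L1D|exact: h1]).
  by apply: Int_ge0 => x; exact: sqr_ge0.
have [c00|cn0] := eqVneq c 0.
  have [->|b0] := eqVneq b 0; first by rewrite expr0n/= mulr_ge0.
  (* For c = 0 the polynomial is affine in t, and this t would give it the value -1. *)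
  have := H (- (a + 1) / (2 * b)); rewrite c00.
  have -> : a + 2 * (- (a + 1) / (2 * b)) * b + (- (a + 1) / (2 * b)) ^+ 2 * 0
    = -1 by field; rewrite b0.
  by rewrite lerNr oppr0 ler10.
have cp : 0 < c by rewrite lt_def cn0.
have := H (- b / c).
have -> : a + 2 * (- b / c) * b + (- b / c) ^+ 2 * c = (a * c - b ^+ 2) / c.
  by field.
by rewrite pmulr_lge0 ?invr_gt0// subr_ge0.
Qed.

End RealIntegrals.

(** * Hermite and Laguerre polynomials *)

Section HermiteLaguerre.
Variable R : realType.

Lemma regular_scaleE (a b : R) : a *: (b : R^o) = a * b.
Proof. by []. Qed.

(** The derivative of p(y) exp(-y^2/2) is (p'(y) - y p(y)) exp(-y^2/2); factoring out the sign
    (-1)^m leaves this recursion. *)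
Fixpoint hermite_poly (m : nat) : {poly R} :=
  if m is m'.+1 then 'X * hermite_poly m' - (hermite_poly m')^`() else 1.

Lemma hermite_polyS m :
  hermite_poly m.+1 = 'X * hermite_poly m - (hermite_poly m)^`().
Proof. by []. Qed.

Lemma is_derive_gauss (y : R) :
  is_derive y (1 : R) (fun z : R => expR (- (z ^+ 2 / 2)) : R) (- y * expR (- (y ^+ 2 / 2))).
Proof.
apply: is_derive_eq; rewrite /GRing.scale/=.
by field.
Qed.

Lemma derive1n_gauss m :
  derive1n m (fun y : R => expR (- (y ^+ 2 / 2)) : R^o) =
  fun y => (-1) ^+ m * (hermite_poly m).[y] * expR (- (y ^+ 2 / 2)).
Proof.
elim: m => [|m IH]; first by apply/funext => y; rewrite derive1n0 expr0 hornerC !mul1r.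
rewrite derive1nS IH; apply/funext => y; rewrite derive1E.
have H := is_derive_gauss y.
have Hp := is_derive_poly (hermite_poly m) y.
apply: derive_val.
apply: is_derive_eq.
rewrite hermite_polyS !hornerE !regular_scaleE (exprS (-1) m).
ring.
Qed.

Lemma hermiteE m x : hermite m x = (hermite_poly m).[x] :> R.
Proof.
rewrite /hermite derive1n_gauss.
have := expRxMexpNx_1 (x ^+ 2 / 2); set a := expR _; set b := expR (- _) => ab.
transitivity ((a * b) * ((-1) ^+ m * (-1) ^+ m) * (hermite_poly m).[x]); first by ring.
by rewrite ab -exprMn mulrNN !mul1r expr1n mul1r.
Qed.

Lemma hermite_poly_gt m j : (m < j)%N -> (hermite_poly m)`_j = 0.
Proof.
elim: m j => [|m IH] [//|j] mj; first by rewrite coefC.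
rewrite /= coefB coefXM coef_deriv /= !IH ?mul0rn ?subrr// ltnW// ltnW//.
Qed.

(** Closed coefficients are wanted because the average over rotations acts on each monomial
    separately. In the recursion, coefficient j receives coefficients j - 1 and j + 1 of the
    previous polynomial, so the two parities never mix. *)
Lemma hermite_poly_coef m :
  (forall j i, (j + i.*2 = m)%N -> (hermite_poly m)`_j =
     (-1) ^+ i * m`!%:R / (i`!%:R * j`!%:R * 2 ^+ i)) /\
  (forall j i, (j + i.*2.+1 = m)%N -> (hermite_poly m)`_j = 0).
Proof.
have factN0 (r : nat) : r`!%:R != 0 :> R by rewrite pnatr_eq0 -lt0n fact_gt0.
have n0 (n : nat) : n.+1%:R != 0 :> R by rewrite pnatr_eq0.
elim: m => [|m [IH1 IH2]]; split => j i.
- case: j => [|j]; case: i => [|i] // _.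
  by rewrite coefC /= expr0 !mul1r invr1.
- by rewrite addnS.
- move=> ji; rewrite /= coefB coefXM coef_deriv.
  case: j ji => [|j] ji /=.
    case: i ji => [//|i] ji.
    have mi : m = (1 + i.*2)%N by move: ji; rewrite doubleS; lia.
    rewrite (IH1 1%N i) //; rewrite mi add1n [i.+1`!]factS [i.*2.+2`!]factS.
    have := factN0 i; have := factN0 i.*2.+1.
    rewrite !natrM !exprS -!natr1 -muln2 natrM => h1 h2.
    field.
    rewrite h2 expf_neq0 ?pnatr_eq0//= natr1 pnatr_eq0//.
  have ji' : (j + i.*2 = m)%N by move: ji; rewrite addSn; lia.
  rewrite (IH1 _ _ ji'); case: i ji ji' => [|i] ji ji'.
    rewrite hermite_poly_gt; last by lia.
    move: ji'; rewrite double0 addn0 => ->.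
    by rewrite mul0rn subr0 !expr0 fact0 !mul1r !mulr1 !divff.
  rewrite (IH1 j.+2 i); last by rewrite doubleS in ji'; lia.
  rewrite -mulr_natr !factS.
  (* This decomposition of m + 1 merges the contributions of ['X * H] and of the derivative into one
     factorial quotient. *)
  have mE : (m.+1)%:R = (j.+1)%:R + 2 * (i.+1)%:R :> R.
    by rewrite -natrM -natrD; congr (_%:R); move: ji'; rewrite -mul2n; lia.
  rewrite !natrM mE !exprS.
  have := factN0 i; have := factN0 j; have := factN0 m => h1 h2 h3.
  field.
  rewrite expf_neq0 ?pnatr_eq0 //=.
  have h (r s : nat) : (0 < r)%N -> r%:R + s%:R != 0 :> R.
    by move=> r0; rewrite -natrD pnatr_eq0; lia.
  rewrite -!lt0n !fact_gt0 /=.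
  by apply/and3P; split; [exact: (h 1%N)|exact: (h 1%N)|exact: (h 2%N)].
- move=> ji; rewrite /= coefB coefXM coef_deriv.
  case: j ji => [|j] ji /=.
    case: i ji => [|i] ji.
      rewrite hermite_poly_gt; last by move: ji; lia.
      by rewrite mul0rn subr0.
    rewrite (IH2 1%N i); last by move: ji; rewrite doubleS; lia.
    by rewrite mul0rn subr0.
  rewrite (IH2 j i); last by move: ji; lia.
  case: i ji => [|i] ji.
    rewrite hermite_poly_gt; last by move: ji; lia.
    by rewrite mul0rn subr0.
  rewrite (IH2 j.+2 i); last by move: ji; rewrite doubleS; lia.
  by rewrite mul0rn subr0.
Qed.

Lemma size_hermite_poly m : (size (hermite_poly m) <= m.+1)%N.
Proof. by apply/leq_sizeP => j mj; rewrite hermite_poly_gt. Qed.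

Lemma sum_even_odd (V : zmodType) (F : nat -> V) k :
  \sum_(j < k.*2.+1) F j = \sum_(i < k.+1) F i.*2 + \sum_(i < k) F i.*2.+1.
Proof.
elim: k => [|k IH]; first by rewrite !big_ord_recr !big_ord0 /= addr0.
rewrite doubleS 2!big_ord_recr IH /= [in RHS]big_ord_recr /= [X in _ + X = _]/=.
rewrite [X in _ = _ + X]big_ord_recr /= doubleS.
by rewrite -!addrA; congr (_ + _); rewrite addrA addrC.
Qed.

Lemma hermite_doubleE k (x : R) : hermite k.*2 x =
  \sum_(i < k.+1) (-1) ^+ (k - i) * k.*2`!%:R /
     ((k - i)`!%:R * i.*2`!%:R * 2 ^+ (k - i)) * x ^+ i.*2.
Proof.
rewrite hermiteE (horner_coef_wide _ (size_hermite_poly _)).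
rewrite (sum_even_odd (fun j => (hermite_poly k.*2)`_j * x ^+ j)).
rewrite [X in _ + X]big1 ?addr0.
  apply: eq_bigr => i _; congr (_ * _).
  apply: (hermite_poly_coef _).1; rewrite -doubleD; congr double.
  by rewrite subnKC// -ltnS.
move=> i _; rewrite ((hermite_poly_coef _).2 _ (k - i.+1)%N) ?mul0r//.
have := ltn_ord i; lia.
Qed.

(** The effect on p of differentiating exp(-v) p(v). *)
Definition laguerre_step (p : {poly R}) : {poly R} := p^`() - p.

Lemma derive1n_laguerre k n :
  derive1n n (fun v : R => expR (- v) * v ^+ k : R^o) =
  fun y => expR (- y) * (iter n laguerre_step 'X^k).[y].
Proof.
elim: n => [|n IH]; first by apply/funext => y; rewrite derive1n0 /= hornerXn.
rewrite derive1nS IH; apply/funext => y; rewrite derive1E.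
have Hp := is_derive_poly (iter n laguerre_step 'X^k) y.
apply: derive_val; apply: is_derive_eq.
rewrite iterS /laguerre_step !hornerE !regular_scaleE; ring.
Qed.

(** Leibniz's rule for the n-th power of D - 1 applied to X^k: the coefficient of X^j comes from the
    single term with i = k - j derivatives. *)
Lemma laguerre_step_coef k n :
  (forall j, (k < j)%N -> (iter n laguerre_step 'X^k)`_j = 0) /\
  (forall j i, (j + i = k)%N -> (iter n laguerre_step 'X^k)`_j =
     (-1) ^+ (n + i) * 'C(n, i)%:R * k`!%:R / j`!%:R).
Proof.
have factN0 (r : nat) : r`!%:R != 0 :> R by rewrite pnatr_eq0 -lt0n fact_gt0.
elim: n => [|n [IH1 IH2]]; split => j.
- by move=> kj; rewrite /= coefXn gtn_eqF.
- case=> [|i] ji.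
    by rewrite addn0 in ji; rewrite /= coefXn ji eqxx expr0 !mul1r divff.
  by rewrite /= coefXn -ji ltn_eqF ?bin0n ?mulr0 ?mul0r// addnS ltnS leq_addr.
- move=> kj; rewrite /= coefB coef_deriv !IH1 ?mul0rn ?subr0// ltnW//.
- case=> [|i] ji; rewrite /= coefB coef_deriv.
    rewrite IH1; last by rewrite -ji addn0.
    rewrite (IH2 _ 0%N)// !bin0 mul0rn sub0r !addn0 exprS; ring.
  rewrite (IH2 j.+1 i); last by rewrite -ji addnS.
  rewrite (IH2 j i.+1) // binS natrD factS natrM.
  rewrite !addSn !addnS !exprS -mulr_natr.
  have := factN0 j => h; field.
  by rewrite h addrC natr1 pnatr_eq0.
Qed.

Lemma laguerreE k (u : R) :
  laguerre k u = \sum_(j < k.+1) (-1) ^+ j * 'C(k, j)%:R / j`!%:R * u ^+ j.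
Proof.
have factN0 (r : nat) : r`!%:R != 0 :> R by rewrite pnatr_eq0 -lt0n fact_gt0.
rewrite /laguerre derive1n_laguerre.
have := expRxMexpNx_1 u; set a := expR _; set b := expR (- _) => ab.
set p := iter _ _ _.
transitivity ((a * b) / k`!%:R * p.[u]); first by ring.
have sp : (size p <= k.+1)%N.
  by apply/leq_sizeP => j mj; rewrite (laguerre_step_coef _ _).1.
rewrite ab mul1r (horner_coef_wide _ sp) mulr_sumr; apply: eq_bigr => j _.
rewrite ((laguerre_step_coef _ _).2 j (k - j)%N); last by rewrite subnKC// -ltnS.
rewrite bin_sub; last by rewrite -ltnS.
have -> : (-1) ^+ (k + (k - j)) = (-1) ^+ j :> R.
  rewrite -signr_odd -[RHS]signr_odd; congr (_ ^+ _); have := ltn_ord j; lia.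
have h1 := factN0 k; have h2 := factN0 j; field.
by rewrite h1 h2.
Qed.

Lemma expiD (a b : R) : expi (a + b) = expi a * expi b.
Proof. by rewrite /expi cosD sinD; simpc; congr (_ +i* _); ring. Qed.

Lemma expi0 : expi 0 = 1 :> R[i].
Proof. by rewrite /expi cos0 sin0. Qed.

Lemma expiX (a : R) n : expi (a *+ n) = expi a ^+ n.
Proof.
elim: n => [|n IH]; first by rewrite mulr0n expr0 expi0.
by rewrite mulrS expiD IH exprS.
Qed.

(** By the half-angle formula cos b = 1 forces sin(b/2) = 0, while b/2 lies strictly between 0 and
    pi. *)
Lemma expi_neq1 (a : R) : 0 < `|a| < 2 * pi -> expi a != 1.
Proof.
move=> /andP[a0 a2]; apply/eqP => -[ca _].
have : cos `|a| = 1 by have [|] := ger0P a => _ //; rewrite cosN.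
move: a0 a2; set b : R := `|a| => a0 a2.
have -> : b = (b / 2) *+ 2 by rewrite -mulr_natr divfK// pnatr_eq0.
rewrite cos_mulr2n.
have : 0 < sin (b / 2).
  by apply: sin_gt0_pi; apply/andP; split; [rewrite divr_gt0|lra].
have := cos2Dsin2 (b / 2); rewrite -mulr_natr => h1 h2 h3; nra.
Qed.

(** A geometric sum over the powers of w = exp(2 pi i s/M), with w^M = 1. The bound on s guarantees
    that w = 1 only for s = 0. *)
Lemma sum_expi (M : nat) (s : int) : (`|s| < M)%N ->
  \sum_(q < M) expi (2 * pi * q%:R / M%:R * s%:~R) =
  (if s == 0 then M%:R else 0) :> R[i].
Proof.
move=> sM; have M0 : (0 < M)%N by apply: leq_ltn_trans sM.
have MR : 0 < M%:R :> R by rewrite ltr0n.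
set w := expi (2 * pi / M%:R * s%:~R) : R[i].
transitivity (\sum_(q < M) w ^+ q).
  apply: eq_bigr => q _; rewrite /w -expiX; congr expi; rewrite -mulr_natr; ring.
have [s00|s0] := eqVneq s 0.
  have -> : w = 1 by rewrite /w s00 mulr0 expi0.
  by under eq_bigr do rewrite expr1n; rewrite sumr_const card_ord.
have wM : w ^+ M = 1.
  rewrite /w -expiX -[X in expi X]mulr_natr.
  have -> : 2 * pi / M%:R * s%:~R * M%:R = 2 * pi * s%:~R :> R.
    by field; rewrite gt_eqF.
  have e1 (n : nat) : expi (2 * pi * n%:R) = 1 :> R[i].
    rewrite mulr_natr expiX mulr_natl /expi cos2pi sin2pi.
    by rewrite -[X in X ^+ _]/(1 : R[i]) expr1n.
  case: s {sM s0 w} => n; first exact: e1.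
  have := expiD (2 * pi * (Negz n)%:~R) (2 * pi * n.+1%:R).
  rewrite e1 mulr1 => <-; rewrite NegzE mulrNz -mulrDr addNr mulr0 expi0//.
have w1 : w != 1.
  have pi0 := pi_gt0 R.
  have sR : `|s%:~R| = `|s|%:R :> R by rewrite -intr_norm -abszE.
  have c0 : 0 < 2 * pi / M%:R :> R by rewrite divr_gt0 ?mulr_gt0.
  apply: expi_neq1; rewrite normrM (gtr0_norm c0) sR.
  rewrite mulr_gt0 ?ltr0n ?absz_gt0//=.
  by rewrite mulrAC ltr_pdivrMr// ltr_pM2l ?mulr_gt0// ltr_nat.
apply: (mulfI (_ : w - 1 != 0)); first by rewrite subr_eq0.
by rewrite mulr0 -subrX1 wM subrr.
Qed.

Lemma exprMn_mulrn_AC (K : comNzRingType) (a z b y h : K) (m i c n : nat) :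
  (a * z) ^+ m * (b * y) ^+ i *+ c * h ^+ n =
  z ^+ m * y ^+ i *+ c * h ^+ n * (a ^+ m * b ^+ i).
Proof.
rewrite !exprMn -!mulrnAl -[in LHS]mulr_natr -[in RHS]mulr_natr.
by ring.
Qed.

(** With z = x + i y, the base of the power is (e^(i theta) z + e^(-i theta) conj z)/2. The binomial
    expansion produces the frequencies n - 2i, all smaller than M in absolute value, so only i = n/2
    survives the sum, which requires n even. *)
Lemma sum_rotation (M n : nat) (x y : R) : (n < M)%N ->
  \sum_(q < M) (cos (2 * pi * q%:R / M%:R) * x
                - sin (2 * pi * q%:R / M%:R) * y) ^+ n =
  if odd n then 0 else M%:R * 'C(n, n./2)%:R / 2 ^+ n * (x ^+ 2 + y ^+ 2) ^+ n./2.
Proof.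
move=> nM; pose th (q : nat) : R := 2 * pi * q%:R / M%:R.
pose z : R[i] := x +i* y.
have [zc zcE] : exists zc : R[i], zc = conjc z by exists (conjc z).
have two0 : (2 : R[i]) != 0 by rewrite pnatr_eq0.
have half : ((2^-1 : R)%:C : R[i]) = 2^-1.
  by rewrite fmorphV/= rmorph_nat.
have E q : ((cos (th q) * x - sin (th q) * y)%:C : R[i]) =
    (expi (th q) * z + expi (- th q) * zc) * 2^-1.
  rewrite -half zcE /expi /z cosN sinN; simpc.
  by congr (_ +i* _); field.
apply: (@complexI R); rewrite rmorph_sum /=.
transitivity (\sum_(q < M) \sum_(i < n.+1)
    (z ^+ (n - i) * zc ^+ i *+ 'C(n, i) * 2^-1 ^+ n) *
    expi (th q * (n%:Z - (i.*2)%:Z)%:~R)).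
  apply: eq_bigr => q _; rewrite rmorphXn /= -/(th q) E exprMn exprDn mulr_suml.
  apply: eq_bigr => i _.
  have <- : expi (th q) ^+ (n - i) * expi (- th q) ^+ i =
      expi (th q * (n%:Z - (i.*2)%:Z)%:~R).
    rewrite -!expiX -expiD; congr expi.
    rewrite -[in LHS]mulr_natr -[X in _ + X]mulr_natr rmorphB/=.
    rewrite -[X in _ = _ * (X - _)]/(n%:R) -[X in _ = _ * (_ - X)]/((i.*2)%:R).
    by rewrite -muln2 natrM natrB -1?ltnS//; ring.
  exact: exprMn_mulrn_AC.
rewrite exchange_big /=.
rewrite (eq_bigr (fun i : 'I_n.+1 => (z ^+ (n - i) * zc ^+ i *+ 'C(n, i) *
  2^-1 ^+ n) * (if n%:Z - (i.*2)%:Z == 0 then M%:R else 0))); last first.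
  by move=> i _; rewrite -mulr_sumr sum_expi//; have := ltn_ord i; lia.
have [on|en] := boolP (odd n).
  rewrite big1 // => i _; case: eqP => [/eqP|]; rewrite ?mulr0// subr_eq0 => /eqP[ni].
  by have := odd_double i; rewrite -ni on.
have nk : n = n./2.*2 by rewrite even_halfK.
have hk : (n./2 < n.+1)%N by lia.
rewrite (bigD1 (Ordinal hk)) //= big1 ?addr0; last first.
  move=> i ni; case: eqP => [/eqP|]; rewrite ?mulr0// subr_eq0 => /eqP[nn].
  by move: ni; rewrite -val_eqE /= -[X in X == _]doubleK -nn eqxx.
rewrite -nk subrr eqxx.
have -> : (n - n./2 = n./2)%N by lia.
rewrite -exprMn.
have -> : z * zc = ((x ^+ 2 + y ^+ 2)%:C : R[i]).
  by rewrite zcE /z; simpc; congr (_ +i* _); ring.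
rewrite -mulr_natr -half -!rmorphXn /= -!(rmorph_nat (@real_complex R)) /= -!rmorphM/=.
congr (_%:C); rewrite exprVn -[(M * _)%R]/(M * 'C(n, n./2))%N natrM natrX; ring.
Qed.

(* Averaging over rotations keeps only the rotation-invariant part of H_2k(x). *)
Lemma sum_hermite_rotation (k : nat) (x y : R) (M := k.*2.+1) :
  M%:R^-1 * (\sum_(q < M) hermite k.*2
      (cos (2 * pi * q%:R / M%:R) * x - sin (2 * pi * q%:R / M%:R) * y)) =
  k.*2`!%:R / ((- 2) ^+ k * k`!%:R) * laguerre k ((x ^+ 2 + y ^+ 2) / 2).
Proof.
under eq_bigr do rewrite hermite_doubleE.
rewrite exchange_big /= laguerreE !mulr_sumr; apply: eq_bigr => i _.
have ik : (i <= k)%N by rewrite -ltnS.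
rewrite -mulr_sumr sum_rotation; last by rewrite /M ltnS leq_double.
rewrite odd_double doubleK.
have factN0 (r : nat) : r`!%:R != 0 :> R by rewrite pnatr_eq0 -lt0n fact_gt0.
have E1 : 'C(i.*2, i)%:R = i.*2`!%:R / (i`!%:R * i`!%:R) :> R.
  rewrite -(@bin_fact i.*2 i); last by rewrite -addnn leq_addr.
  by rewrite -addnn addnK !natrM mulfK// mulf_neq0.
have E2 : 'C(k, i)%:R = k`!%:R / (i`!%:R * (k - i)`!%:R) :> R.
  by rewrite -(@bin_fact k i)// !natrM mulfK// mulf_neq0.
have M0 : M%:R != 0 :> R by rewrite pnatr_eq0.
have E3 : (- 2) ^+ k = (- 1) ^+ (k - i) * (- 1) ^+ i * 2 ^+ (k - i) * 2 ^+ i :> R.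
  by rewrite -exprD subnK// -mulrA -exprD subnK// -mulN1r exprMn.
have E4 : (-1) ^+ (k - i) * (-1) ^+ (k - i) = 1 :> R.
  by rewrite -exprMn mulrNN mulr1 expr1n.
have E5 : (-1) ^+ (k - i) != 0 :> R by rewrite signr_eq0.
have E6 : (-1) ^+ i != 0 :> R by rewrite signr_eq0.
have E7 : (2 : R) ^+ (k - i) != 0 by rewrite expf_neq0// pnatr_eq0.
have E8 : (2 : R) ^+ i != 0 by rewrite expf_neq0// pnatr_eq0.
rewrite E1 E2 E3 -(addnn i) (exprD 2 i i) exprMn exprVn.
have E9 : ((-1) ^+ (k - i))^-1 = (-1) ^+ (k - i) :> R.
  by apply: (mulfI E5); rewrite mulfV// E4.
have h1 := factN0 (i + i)%N; have h2 := factN0 i; have h3 := factN0 k.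
have h4 := factN0 (k - i)%N; have h5 := factN0 k.*2.
rewrite -[in LHS]E9; field.
by rewrite E5 E6 E7 E8 M0 h1 h2 h3 h4.
Qed.

End HermiteLaguerre.

(** * Normal densities *)

Section Density.
Import HBNNSimple.
Context d (T : measurableType d) (R : realType).
Variables (mu nu : {measure set T -> \bar R}) (h : T -> R).
Hypotheses (mh : measurable_fun setT h) (h0 : forall x, 0 <= h x).
Hypothesis nuE : forall A, measurable A -> nu A = (\int[mu]_(x in A) (h x)%:E)%E.

Let integral_density_nnsfun (g : {nnsfun T >-> R}) :
  (\int[nu]_x (g x)%:E = \int[mu]_x ((g x)%:E * (h x)%:E))%E.
Proof.
transitivity (\int[nu]_x
   (\sum_(y \in range g) (y * \1_(g @^-1` [set y]) x)%:E))%E.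
  by apply: eq_integral => t _; rewrite /= fimfunE -fsumEFin.
have indicg r : measurable_fun setT (fun x => (r * \1_(g @^-1` [set r]) x)%:E).
  by apply/measurable_EFinP; exact: measurable_funM.
rewrite ge0_integral_fsum//; last by move=> y x _; exact: nnfun_muleindic_ge0.
transitivity (\int[mu]_x (\sum_(y \in range g)
    (y * \1_(g @^-1` [set y]) x)%:E * (h x)%:E))%E; last first.
  apply: eq_integral => x _; rewrite -ge0_mule_fsuml => [|y].
    by rewrite fsumEFin // -(fimfunE _ x).
  exact: nnfun_muleindic_ge0.
rewrite ge0_integral_fsum//; last 2 first.
  - by move=> y; apply: emeasurable_funM => //; exact/measurable_EFinP.
  - by move=> y x _; apply: mule_ge0; [rewrite EFinM nnfun_muleindic_ge0|rewrite lee_fin].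
apply: eq_fsbigr => r rg.
have r0 : 0 <= r by move: rg; rewrite inE => -[t _ <-].
under eq_integral do rewrite EFinM.
under [RHS]eq_integral do rewrite EFinM -muleA.
rewrite !ge0_integralZl_EFin//; last first.
  - by apply/measurable_EFinP.
  - by apply: emeasurable_funM; exact/measurable_EFinP.
  - by move=> x _; rewrite mule_ge0 ?lee_fin.
congr (_ * _)%E; rewrite integral_indic// setIT nuE//.
rewrite [LHS]integral_mkcond; apply: eq_integral => x _.
by rewrite epatch_indic muleC.
Qed.

Lemma ge0_integral_density (f : T -> R) : measurable_fun setT f ->
  (forall x, 0 <= f x) -> (\int[nu]_x (f x)%:E = \int[mu]_x (f x * h x)%:E)%E.
Proof.
move=> mf f0.
have mEf : measurable_fun setT (EFin \o f) by exact/measurable_EFinP.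
pose g := nnsfun_approx measurableT mEf.
have gf x : (g n x)%:E @[n --> \oo] --> (f x)%:E.
  apply: (@cvg_nnsfun_approx _ _ _ _ measurableT _ mEf) => //.
  by move=> t _; rewrite /= lee_fin.
have gnd x : {homo (fun n => (g n x)%:E) : a b / (a <= b)%N >-> (a <= b)%E}.
  by move=> a b ab; rewrite lee_fin; exact/lefP/nd_nnsfun_approx.
transitivity (limn (fun n => \int[nu]_x (g n x)%:E))%E.
  rewrite -monotone_convergence//.
  - by apply: eq_integral => x _; apply/esym/cvg_lim => //; exact: gf.
  - by move=> n; exact/measurable_EFinP.
  - by move=> n x _; rewrite lee_fin.
under eq_fun do rewrite integral_density_nnsfun.
rewrite -monotone_convergence//.
- apply: eq_integral => x _; apply/cvg_lim => //; rewrite EFinM.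
  by apply: cvgeZr => //; exact: gf.
- by move=> n; apply: emeasurable_funM; exact/measurable_EFinP.
- by move=> n x _; rewrite mule_ge0 ?lee_fin.
- by move=> x _ a b ab; rewrite lee_wpmul2r ?lee_fin// -lee_fin; exact: gnd.
Qed.

Lemma L1_density (f : T -> R) : measurable_fun setT f ->
  L1 mu (fun x => f x * h x) -> L1 nu f.
Proof.
move=> mf f1; apply/integrableP; split; first exact/measurable_EFinP.
rewrite (ge0_integral_density (f := fun x => `|f x|)) //; last first.
  exact: measurableT_comp.
have := integrable_lty measurableT (L1_norm f1).
by congr (_ < _)%E; apply: eq_integral => x _ /=; rewrite normrM (ger0_norm (h0 x)).
Qed.

Lemma L1_densityV (f : T -> R) : L1 nu f -> L1 mu (fun x => f x * h x).
Proof.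
move=> f1; have mf := L1_measurable f1.
apply/integrableP; split; first by apply/measurable_EFinP; exact: measurable_funM.
have := integrable_lty measurableT (L1_norm f1).
rewrite /= (ge0_integral_density (f := fun x => `|f x|)) //; last first.
  exact: measurableT_comp.
by congr (_ < _)%E; apply: eq_integral => x _ /=; rewrite normrM (ger0_norm (h0 x)).
Qed.

Lemma Int_density (f : T -> R) : L1 nu f -> Int nu f = Int mu (fun x => f x * h x).
Proof.
move=> n1; have mf := L1_measurable n1; have f1 := L1_densityV n1.
(* A difference of two nonnegative functions, to which the nonnegative case applies. *)
have fE : f = (fun x => (`|f x| + f x) - `|f x|) by apply/funext => x; rewrite addrAC subrr add0r.
have ge0E (g : T -> R) : measurable_fun setT g -> (forall x, 0 <= g x) ->
    Int nu g = Int mu (fun x => g x * h x).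
  by move=> mg g0; rewrite /Int /Rintegral ge0_integral_density.
have m1 : measurable_fun setT (fun x => `|f x|) by exact: measurableT_comp.
rewrite fE IntB; [|apply: L1D => //; exact: L1_norm|exact: L1_norm].
rewrite !ge0E //; last 2 first.
- exact: measurable_funD.
- by move=> x; have := lerNnormlW (lexx `|f x|); lra.
rewrite -IntB.
- by congr Int; apply/funext => x; rewrite mulrBl.
- rewrite (_ : (fun _ => _) = (fun x => `|f x * h x| + f x * h x)); last first.
    by apply/funext => x; rewrite normrM (ger0_norm (h0 x)) mulrDl.
  by apply: L1D => //; exact: L1_norm.
- rewrite (_ : (fun _ => _) = (fun x => `|f x * h x|)); last first.
    by apply/funext => x; rewrite normrM (ger0_norm (h0 x)).
  exact: L1_norm.
Qed.

End Density.

Section RealLine.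
Context (R : realType).
Local Notation leb := (@lebesgue_measure R).

Lemma cont_mul (f g : R -> R) :
  continuous f -> continuous g -> continuous (fun x : R => f x * g x).
Proof. by move=> cf cg x; apply: (@continuousM R R f g x); [exact: cf|exact: cg]. Qed.

Lemma cont_add (f g : R -> R) :
  continuous f -> continuous g -> continuous (fun x : R => f x + g x).
Proof. by move=> cf cg x; apply: (@continuousD R R R f g x); [exact: cf|exact: cg]. Qed.

Lemma cont_sub (f g : R -> R) :
  continuous f -> continuous g -> continuous (fun x : R => f x - g x).
Proof. by move=> cf cg x; apply: (@continuousB R R R f g x); [exact: cf|exact: cg]. Qed.

Lemma cont_id : continuous (fun x : R => x).
Proof. by move=> x; exact: cvg_id. Qed.

Lemma cont_cst (c : R) : continuous (fun _ : R => c).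
Proof. by move=> x; exact: cvg_cst. Qed.

Lemma cont_comp (f g : R -> R) :
  continuous f -> continuous g -> continuous (fun x : R => g (f x)).
Proof. by move=> cf cg x; apply: continuous_comp; [exact: cf|exact: cg]. Qed.

(** Over the growing intervals the integral of f is F(b n) - F(a n); dominated convergence with
    bound |f| removes the truncation. *)
Lemma FTC_line (F f : R -> R) (a b : nat -> R) :
  (forall x, is_derive x (1 : R) F (f x)) -> continuous f -> L1 leb f ->
  (forall n, a n < b n) -> (forall x, \forall n \near \oo, a n <= x <= b n) ->
  F (a n) @[n --> \oo] --> 0 -> F (b n) @[n --> \oo] --> 0 ->
  Int leb f = 0.
Proof.
move=> dF cf f1 ab abx Fa Fb.
pose fn n := f \_ `[a n, b n].
have E n : Int leb (fn n) = F (b n) - F (a n).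
  rewrite /Int /fn -Rintegral_mkcond /Rintegral (@continuous_FTC2 _ f F)//.
  - exact: continuous_subspaceT.
  - split.
    + by move=> x _; exact: ex_derive.
    + apply: cvg_at_right_filter; apply/differentiable_continuous/derivable1_diffP.
      exact: ex_derive.
    + apply: cvg_at_left_filter; apply/differentiable_continuous/derivable1_diffP.
      exact: ex_derive.
  - by move=> x _; rewrite derive1E; exact: derive_val.
have mf := L1_measurable f1.
have mfn n : measurable_fun setT (fn n).
  apply: (measurable_restrictT f (measurable_itv `[a n, b n])).1.
  exact: measurable_funTS.
have [||_ H] := @cvg_Int_dominated _ _ _ leb fn f (fun x : R => `|f x|) mfn mf (L1_norm f1).
- move=> n x.
  by rewrite /fn patchE; case: ifP => // _; rewrite normr0.
- move=> x; apply: cvg_near_cst; apply: filterS (abx x) => n nx.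
  by rewrite /fn patchE mem_set//= in_itv.
apply: (@cvg_unique _ _ (Int leb (fn n) @[n --> \oo])) => //.
rewrite /= (_ : (fun n => Int leb (fn n)) = (fun n => F (b n) - F (a n))).
  by rewrite -[0]subr0; apply: cvgB.
exact/funext.
Qed.

Section NormalDensity.
Variables (m s : R).
Hypothesis s0 : 0 < s.
Let p := normal_pdf m s.

Let sn0 : s != 0. Proof. by rewrite gt_eqF. Qed.

Lemma normal_pdf_expR x :
  p x = normal_peak s * expR (- (x - m) ^+ 2 / (s ^+ 2 *+ 2)).
Proof. by rewrite /p normal_pdfE. Qed.

Lemma L1_normal_pdf : L1 leb p.
Proof. exact: integrable_normal_pdf. Qed.

Lemma Int_normal_pdf : Int leb p = 1.
Proof. by apply: IntE; exact: integral_normal_pdf. Qed.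

Let w := normal_pdf m (Num.sqrt 2 * s).
Let r := normal_peak s / normal_peak (Num.sqrt 2 * s).

(** With z = (x - m)^2/(4 s^2), the exponential in [p] is exp(-z) exp(-z). One factor absorbs the
    square, since z exp(-z) < 1; the other is the exponential of the density [w] of doubled
    variance. *)
Let sqr_normal_pdf_le x : (x - m) ^+ 2 * p x <= 4 * s ^+ 2 * r * w x.
Proof.
have s2 : Num.sqrt 2 * s != 0 by rewrite mulf_neq0// gt_eqF// sqrtr_gt0.
have wE : w x = normal_peak (Num.sqrt 2 * s) *
    expR (- (x - m) ^+ 2 / ((Num.sqrt 2 * s) ^+ 2 *+ 2)).
  by rewrite /w normal_pdfE.
have -> : 4 * s ^+ 2 * r * w x = normal_peak s *
    (4 * s ^+ 2 * expR (- (x - m) ^+ 2 / ((Num.sqrt 2 * s) ^+ 2 *+ 2))).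
  rewrite wE /r; field.
  by rewrite gt_eqF// normal_peak_gt0.
rewrite normal_pdf_expR mulrCA ler_pM2l ?normal_peak_gt0//.
rewrite exprMn sqr_sqrtr//.
set y := (x - m) ^+ 2.
have ss : 0 < s ^+ 2 by rewrite exprn_gt0.
pose z := y / (4 * s ^+ 2).
have z0 : 0 <= z by rewrite divr_ge0// ?sqr_ge0// mulr_ge0// ltW.
have -> : - y / (s ^+ 2 *+ 2) = - z + - z by rewrite /z; field.
have -> : - y / (2 * s ^+ 2 *+ 2) = - z by rewrite /z; field.
have -> : y = 4 * s ^+ 2 * z by rewrite /z; field.
rewrite expRD; have -> : 4 * s ^+ 2 * z * (expR (- z) * expR (- z)) =
  (4 * s ^+ 2 * expR (- z)) * (z * expR (- z)) by ring.
rewrite ler_piMr ?mulr_ge0 ?expR_ge0 ?ltW//.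
rewrite expRN ltr_pdivrMr ?expR_gt0// mul1r.
by have := expR_ge1Dx z; lra.
Qed.


Lemma L1_normal_pdf_sqr : L1 leb (fun x : R => (x - m) ^+ 2 * p x).
Proof.
apply: (@L1_le _ _ _ leb _ (fun x : R => 4 * s ^+ 2 * r * w x)).
- apply: measurable_funM; last exact: measurable_normal_pdf.
  by apply: measurable_funX; exact: measurable_funB.
- by apply: L1Z; exact: integrable_normal_pdf.
- move=> x; have p0 : 0 <= p x by exact: normal_pdf_ge0.
  by rewrite normrM (ger0_norm p0) (ger0_norm (sqr_ge0 _)) sqr_normal_pdf_le.
Qed.

Lemma L1_normal_pdf_id : L1 leb (fun x : R => (x - m) * p x).
Proof.
apply: (@L1_le _ _ _ leb _ (fun x : R => p x + (x - m) ^+ 2 * p x)).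
- apply: measurable_funM; last exact: measurable_normal_pdf.
  exact: measurable_funB.
- by apply: L1D; [exact: L1_normal_pdf|exact: L1_normal_pdf_sqr].
- move=> x; have p0 : 0 <= p x by exact: normal_pdf_ge0.
  have H : `|x - m| <= 1 + (x - m) ^+ 2.
    by rewrite -(real_normK (num_real (x - m))); nra.
  by rewrite normrM (ger0_norm p0); nra.
Qed.

Lemma is_derive_normal_pdf x : is_derive x (1 : R) p (- (x - m) / s ^+ 2 * p x).
Proof.
rewrite (_ : p = fun x => normal_peak s * expR (- (x - m) ^+ 2 / (s ^+ 2 *+ 2))).
  apply: is_derive_eq; rewrite !regular_scaleE.
  by field.
by apply/funext => y; exact: normal_pdf_expR.
Qed.

(** All Gaussian integrations by parts go through this form. The bound on F, combined with the
    quadratic decay of the density, gives |F x| <= C/|x - m|, so F vanishes at both ends. *)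
Lemma Int_derive_normal (F f : R -> R) K : (forall x, is_derive x (1 : R) F (f x)) ->
  continuous f -> L1 leb f ->
  (forall x, 1 <= `|x - m| -> `|F x| <= K * (`|x - m| * p x)) ->
  Int leb f = 0.
Proof.
move=> dF cf f1 FK.
pose C := `|K| * (4 * s ^+ 2 * r * normal_peak (Num.sqrt 2 * s)).
have B x : 1 <= `|x - m| -> `|F x| <= C / `|x - m|.
  move=> x1; have x0 : 0 < `|x - m| by apply: lt_le_trans x1.
  apply: (le_trans (FK _ x1)); rewrite ler_pdivlMr// -mulrA.
  have p0 : 0 <= p x by exact: normal_pdf_ge0.
  have h : `|x - m| * p x * `|x - m| = (x - m) ^+ 2 * p x.
    by rewrite -[in RHS]real_normK ?num_real//; ring.
  apply: (le_trans (ler_norm _)); rewrite h normrM /C.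
  apply: ler_wpM2l => //.
  rewrite [leLHS](ger0_norm (mulr_ge0 (sqr_ge0 _) p0)).
  apply: (le_trans (sqr_normal_pdf_le x)).
  apply: ler_wpM2l.
    by rewrite /r !mulr_ge0 ?sqr_ge0 ?invr_ge0 ?normal_peak_ge0// ltW.
  have s2 : Num.sqrt 2 * s != 0 by rewrite mulf_neq0// gt_eqF// sqrtr_gt0.
  exact: normal_pdf_ub.
(* The sign e = 1 or e = -1 selects the end of the line. *)
have lim (e : R) : e ^+ 2 = 1 -> F (m + e * n.+1%:R) @[n --> \oo] --> 0.
  move=> e1; have en : `|e| = 1 by apply/eqP; rewrite -sqr_norm_eq1 ?e1.
  apply: (@squeeze_cvgr _ _ _ _ (fun n => - (C / n.+1%:R)) (fun n => C / n.+1%:R)).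
  - apply: nearW => n; rewrite -ler_norml.
    have E : `|m + e * n.+1%:R - m| = n.+1%:R.
      by rewrite addrAC subrr add0r normrM en mul1r ger0_norm.
    by rewrite -[X in _ <= C / X]E; apply: B; rewrite E ler1n.
  - rewrite -oppr0; apply: cvgN; rewrite -(mulr0 C).
    by apply: cvgM; [exact: cvg_cst|exact: cvg_harmonic].
  - rewrite -(mulr0 C).
    by apply: cvgM; [exact: cvg_cst|exact: cvg_harmonic].
apply: (@FTC_line F f (fun n => m + (-1) * n.+1%:R) (fun n => m + 1 * n.+1%:R)) => //.
- by move=> n; rewrite ltrD2l mul1r mulN1r (@lt_trans _ _ 0)// ltrNl oppr0.
- move=> x; near=> n.
  have : `|x - m| <= n%:R by near: n; exact: nbhs_infty_ger.
  by rewrite ler_norml -natr1 => /andP[]; lra.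
- by apply: lim; rewrite sqrrN expr1n.
- by apply: lim; rewrite expr1n.
Unshelve. all: by end_near. Qed.

Lemma Int_normal_pdf_id : Int leb (fun x : R => (x - m) * p x) = 0.
Proof.
refine (@Int_derive_normal (fun x : R => - s ^+ 2 * p x)
  (fun x : R => (x - m) * p x) (s ^+ 2) _ _ _ _).
- move=> x; have H := is_derive_normal_pdf x.
  by apply: is_derive_eq; rewrite !regular_scaleE; field.
- apply: cont_mul; last exact: continuous_normal_pdf.
  by apply: cont_sub; [exact: cont_id|exact: cont_cst].
- exact: L1_normal_pdf_id.
- move=> x x1; have p0 : 0 <= p x by exact: normal_pdf_ge0.
  rewrite normrM normrN (ger0_norm p0) (ger0_norm (sqr_ge0 _)).
  by apply: ler_wpM2l; rewrite ?sqr_ge0//; nra.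
Qed.

(** The function -s^2 (x - m) p(x) has derivative (x - m)^2 p(x) - s^2 p(x). *)
Lemma Int_normal_pdf_sqr : Int leb (fun x : R => (x - m) ^+ 2 * p x) = s ^+ 2.
Proof.
have : Int leb (fun x : R => (x - m) ^+ 2 * p x - s ^+ 2 * p x) = 0.
  refine (@Int_derive_normal (fun x : R => - s ^+ 2 * ((x - m) * p x))
    (fun x : R => (x - m) ^+ 2 * p x - s ^+ 2 * p x) (s ^+ 2) _ _ _ _).
  - move=> x; have H := is_derive_normal_pdf x.
    by apply: is_derive_eq; rewrite !regular_scaleE; field.
  - have cx : continuous (fun x : R => x - m).
      by apply: cont_sub; [exact: cont_id|exact: cont_cst].
    have cp : continuous p by exact: continuous_normal_pdf.
    by apply: cont_sub; apply: cont_mul => //; [exact: cont_mul|exact: cont_cst].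
  - apply: L1B; first exact: L1_normal_pdf_sqr.
    by apply: L1Z; exact: L1_normal_pdf.
  - move=> x x1; have p0 : 0 <= p x by exact: normal_pdf_ge0.
    by rewrite normrM normrN (ger0_norm (sqr_ge0 _)) normrM (ger0_norm p0).
rewrite IntB; [|exact: L1_normal_pdf_sqr|by apply: L1Z; exact: L1_normal_pdf].
rewrite IntZ; last exact: L1_normal_pdf.
by rewrite Int_normal_pdf mulr1 => /eqP; rewrite subr_eq0 => /eqP.
Qed.

Lemma measurable_sin : measurable_fun setT (@sin R).
Proof. exact: (continuous_measurable_fun (@continuous_sin R)). Qed.

Lemma measurable_cos : measurable_fun setT (@cos R).
Proof. exact: (continuous_measurable_fun (@continuous_cos R)). Qed.

Lemma normr_cos_le1 (x : R) : `|cos x| <= 1.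
Proof. by rewrite ler_norml cos_geN1 cos_le1. Qed.

Lemma normr_sin_le1 (x : R) : `|sin x| <= 1.
Proof. by rewrite ler_norml sin_geN1 sin_le1. Qed.

Let lin_measurable (t : R) : measurable_fun setT (fun x : R => t * (x - m)).
Proof. by apply: measurable_funM => //; exact: measurable_funB. Qed.

Lemma L1_normal_cos t : L1 leb (fun x : R => cos (t * (x - m)) * p x).
Proof.
apply: (L1_le _ L1_normal_pdf).
- apply: measurable_funM; last exact: measurable_normal_pdf.
  by apply: measurableT_comp; [exact: measurable_cos|exact: lin_measurable].
- move=> x; have p0 : 0 <= p x by exact: normal_pdf_ge0.
  by rewrite normrM (ger0_norm p0) ler_piMl// normr_cos_le1.
Qed.

Lemma L1_normal_sin t : L1 leb (fun x : R => sin (t * (x - m)) * ((x - m) * p x)).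
Proof.
apply: (L1_le _ (L1_norm L1_normal_pdf_id)).
- apply: measurable_funM; last exact: (L1_measurable L1_normal_pdf_id).
  by apply: measurableT_comp; [exact: measurable_sin|exact: lin_measurable].
- by move=> x; rewrite normrM ler_piMl// normr_sin_le1.
Qed.

(** Integration by parts with the primitive -s^2 sin(t (x - m)) p(x). The left side is minus the
    derivative in t of the cosine integral on the right, so this is a differential equation for the
    characteristic function. *)
Lemma Int_normal_sin t :
  Int leb (fun x : R => sin (t * (x - m)) * ((x - m) * p x)) =
  s ^+ 2 * t * Int leb (fun x : R => cos (t * (x - m)) * p x).
Proof.
have : Int leb (fun x : R => sin (t * (x - m)) * ((x - m) * p x)
          - s ^+ 2 * t * (cos (t * (x - m)) * p x)) = 0.
  refine (@Int_derive_normal (fun x : R => - s ^+ 2 * (sin (t * (x - m)) * p x))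
    (fun x : R => sin (t * (x - m)) * ((x - m) * p x)
          - s ^+ 2 * t * (cos (t * (x - m)) * p x)) (s ^+ 2) _ _ _ _).
  - move=> x; have H := is_derive_normal_pdf x.
    by apply: is_derive_eq; rewrite !regular_scaleE; field.
  - have cl : continuous (fun x : R => t * (x - m)).
      apply: cont_mul; first exact: cont_cst.
      by apply: cont_sub; [exact: cont_id|exact: cont_cst].
    have cx : continuous (fun x : R => x - m).
      by apply: cont_sub; [exact: cont_id|exact: cont_cst].
    have cs : continuous (fun x : R => sin (t * (x - m))).
      by apply: (cont_comp cl); exact: continuous_sin.
    have cc : continuous (fun x : R => cos (t * (x - m))).
      by apply: (cont_comp cl); exact: continuous_cos.
    have cp : continuous p by exact: continuous_normal_pdf.
    by apply: cont_sub; do ![apply: cont_mul => //]; exact: cont_cst.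
  - apply: L1B; first exact: L1_normal_sin.
    by apply: L1Z; exact: L1_normal_cos.
  - move=> x x1; have p0 : 0 <= p x by exact: normal_pdf_ge0.
    rewrite normrM normrN (ger0_norm (sqr_ge0 _)) normrM (ger0_norm p0).
    apply: ler_wpM2l; first exact: sqr_ge0.
    by apply: ler_wpM2r => //; apply: le_trans x1; exact: normr_sin_le1.
rewrite IntB; [|exact: L1_normal_sin|by apply: L1Z; exact: L1_normal_cos].
rewrite IntZ; last exact: L1_normal_cos.
by move=> /eqP; rewrite subr_eq0 => /eqP.
Qed.

(** The integral G satisfies G'(t) = -s^2 t G(t) and G(0) = 1, so G(t) exp(s^2 t^2/2) is constant.
    Differentiation under the integral is dominated by |(y - m) p(y)|. *)
Lemma Int_normal_cos t :
  Int leb (fun x : R => cos (t * (x - m)) * p x) = expR (- (s ^+ 2 * t ^+ 2 / 2)).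
Proof.
pose G t := Int leb (fun x : R => cos (t * (x - m)) * p x).
have dcos t' x : is_derive t' (1 : R) (fun u => cos (u * (x - m)) * p x)
    (- (sin (t' * (x - m)) * ((x - m) * p x))).
  by apply: is_derive_eq; rewrite !regular_scaleE; ring.
have dG u : is_derive u (1 : R) G (- (s ^+ 2 * u * G u)).
  have ab : (`]u - 1, u + 1[%classic : set R) u by rewrite /= in_itv/=; lra.
  have i1 x : (`]u - 1, u + 1[%classic : set R) x -> leb.-integrable setT
      (EFin \o (fun y => cos (x * (y - m)) * p y)).
    by move=> _; exact: L1_normal_cos.
  have i2 x (y : R) : (`]u - 1, u + 1[%classic : set R) x -> setT y ->
    derivable (fun x : R => cos (x * (y - m)) * p y) x (1 : R).
    by move=> _ _; apply: ex_derive.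
  have i3 x y : (`]u - 1, u + 1[%classic : set R) x -> setT y ->
     `|partial1of2 (fun x y : R => cos (x * (y - m)) * p y) x y| <= `|(y - m) * p y|.
    move=> _ _; rewrite partial1of2E /= derive_val normrN normrM.
    by rewrite ler_piMl// normr_sin_le1.
  have dG := @derivable_under_integral _ _ _ leb _ _ measurableT u (u - 1) (u + 1)
    ab i1 i2 (fun y : R => `|(y - m) * p y|) (fun=> normr_ge0 _) (L1_norm L1_normal_pdf_id) i3.
  have EG := @differentiation_under_integral _ _ _ leb _ _ measurableT u (u - 1) (u + 1)
    ab i1 i2 (fun y : R => `|(y - m) * p y|) (fun=> normr_ge0 _) (L1_norm L1_normal_pdf_id) i3.
  apply: DeriveDef; first exact: dG.
  rewrite derive1E in EG; rewrite [LHS]EG.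
  transitivity (Int leb (fun x : R => - (sin (u * (x - m)) * ((x - m) * p x)))).
    by congr Int; apply/funext => y; rewrite partial1of2E derive_val.
  by rewrite IntN ?Int_normal_sin//; exact: L1_normal_sin.
have E : forall u, is_derive u (1 : R) (fun u => G u * expR (s ^+ 2 * u ^+ 2 / 2)) 0.
  move=> u; have dGu := dG u; apply: is_derive_eq; rewrite !regular_scaleE.
  by field.
have := is_derive_0_is_cst t 0 E.
have -> : G 0 = 1.
  rewrite /G -[RHS]Int_normal_pdf; congr Int; apply/funext => x.
  by rewrite mul0r cos0 mul1r.
rewrite expr0n/= mulr0 mul0r expR0 mulr1 -/(G t) expRN => GE.
by apply: (mulIf (_ : expR (s ^+ 2 * t ^+ 2 / 2) != 0));
  rewrite ?GE ?mulVf// gt_eqF// expR_gt0.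
Qed.

End NormalDensity.

End RealLine.

(** * Orthonormal expansions *)

Section Orthonormal.
Context d (T : measurableType d) (R : realType).
Variable mu : {measure set T -> \bar R}.
Variable e : nat -> T -> R.
Hypothesis e2 : forall k, L2 mu (e k).
Hypothesis e_on : forall j k, Int mu (fun x => e j x * e k x) = (j == k)%:R.

Definition fcoef (f : T -> R) (k : nat) : R := Int mu (fun x => f x * e k x).

Definition fpsum (a : nat -> R) (n : nat) (x : T) : R := \sum_(k < n) a k * e k x.

Lemma L2_fpsum a n : L2 mu (fpsum a n).
Proof. by apply: L2_sum => k; exact: L2Z. Qed.

(** Pythagoras with arbitrary coefficients [a]: it contains both the formula for the error of the
    Fourier partial sum and the fact that no other coefficients do better. *)
Lemma Int_sqr_fpsum (f : T -> R) a n : L2 mu f ->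
  Int mu (fun x => (f x - fpsum a n x) ^+ 2) = Int mu (fun x => f x ^+ 2)
    - \sum_(k < n) fcoef f k ^+ 2 + \sum_(k < n) (a k - fcoef f k) ^+ 2.
Proof.
move=> f2; elim: n => [|n IH].
  rewrite !big_ord0 subr0 addr0; congr Int; apply/funext => x.
  by rewrite /fpsum big_ord0 subr0.
pose g x := f x - fpsum a n x.
have g2 : L2 mu g by apply: L2B => //; exact: L2_fpsum.
have ge : Int mu (fun x => g x * e n x) = fcoef f n.
  transitivity (Int mu (fun x => f x * e n x - \sum_(k < n) a k * (e k x * e n x))).
    congr Int; apply/funext => x; rewrite /g mulrBl /fpsum mulr_suml.
    by congr (_ - _); apply: eq_bigr => k _; rewrite mulrA.
  have h k : L1 mu (fun x => a k * (e k x * e n x)) by apply: L1Z; exact: L2M.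
  rewrite IntB; [|exact: L2M|exact: L1_sum].
  rewrite Int_sum// big1 ?subr0// => k _.
  by rewrite IntZ ?e_on ?(ltn_eqF (ltn_ord k)) ?mulr0//; exact: L2M.
rewrite !big_ord_recr /=.
transitivity (Int mu (fun x => g x ^+ 2 - 2 * a n * (g x * e n x) + a n ^+ 2 * (e n x * e n x))).
  congr Int; apply/funext => x; rewrite /fpsum big_ord_recr /= -/(fpsum a n x) /g; ring.
have h1 : L1 mu (fun x => g x * e n x) by exact: L2M.
have h2 : L1 mu (fun x => e n x * e n x) by exact: L2M.
have h3 := L2_sqr g2.
rewrite IntD; [|apply: L1B => //; exact: L1Z|exact: L1Z].
rewrite IntB; [|by []|exact: L1Z].
have gE : Int mu (fun x => g x ^+ 2) = _ := IH.
rewrite (IntZ (2 * a n) h1) (IntZ (a n ^+ 2) h2) e_on eqxx ge gE mulr1; ring.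
Qed.

Definition ferr (f : T -> R) (n : nat) : R :=
  Int mu (fun x => (f x - fpsum (fcoef f) n x) ^+ 2).

Lemma ferr_ge0 f n : 0 <= ferr f n.
Proof. by apply: Int_ge0 => x; exact: sqr_ge0. Qed.

Lemma ferrE f n : L2 mu f ->
  ferr f n = Int mu (fun x => f x ^+ 2) - \sum_(k < n) fcoef f k ^+ 2.
Proof.
move=> f2; rewrite /ferr Int_sqr_fpsum// [X in _ + X]big1 ?addr0// => k _.
by rewrite subrr expr0n.
Qed.

Lemma ferr_le f a n : L2 mu f ->
  ferr f n <= Int mu (fun x => (f x - fpsum a n x) ^+ 2).
Proof.
by move=> f2; rewrite ferrE// Int_sqr_fpsum// lerDl sumr_ge0// => k _; exact: sqr_ge0.
Qed.

(** Such functions form a closed linear subspace of L2. Completeness is expressed by membership in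
    it, established for growing classes of functions. *)
Definition fcvg f := L2 mu f /\ ferr f n @[n --> \oo] --> 0.

Lemma Int_sqrD_le (f g : T -> R) : L2 mu f -> L2 mu g ->
  Int mu (fun x => (f x + g x) ^+ 2) <=
  2 * Int mu (fun x => f x ^+ 2) + 2 * Int mu (fun x => g x ^+ 2).
Proof.
move=> f2 g2; have h1 := L2_sqr f2; have h2 := L2_sqr g2.
rewrite -!IntZ// -IntD; [|exact: L1Z|exact: L1Z].
apply: le_Int; first exact: (L2_sqr (L2D f2 g2)).
  by apply: L1D; exact: L1Z.
by move=> x; have := sqr_ge0 (f x - g x); nra.
Qed.

Lemma cvg0_le (u v : nat -> R) : (forall n, 0 <= u n) -> (forall n, u n <= v n) ->
  v n @[n --> \oo] --> 0 -> u n @[n --> \oo] --> 0.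
Proof.
move=> u0 uv v0; apply: (squeeze_cvgr _ (cvg_cst 0) v0).
by apply: nearW => n; rewrite u0 uv.
Qed.

Lemma cvg0Z (k : R) (u : nat -> R) :
  u n @[n --> \oo] --> 0 -> k * u n @[n --> \oo] --> 0.
Proof. by move=> u0; rewrite -(mulr0 k); apply: cvgM; [exact: cvg_cst|exact: u0]. Qed.

Lemma cvg0D (u v : nat -> R) :
  u n @[n --> \oo] --> 0 -> v n @[n --> \oo] --> 0 -> u n + v n @[n --> \oo] --> 0.
Proof. by move=> u0 v0; rewrite -[0](addr0 0); apply: cvgD; [exact: u0|exact: v0]. Qed.

Lemma fcvg_le (f g h : T -> R) : L2 mu h -> fcvg f -> fcvg g ->
  (forall n, ferr h n <= 2 * ferr f n + 2 * ferr g n) -> fcvg h.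
Proof.
move=> h2 [f2 fc] [g2 gc] H; split; first exact: h2.
apply: (cvg0_le (ferr_ge0 h) H).
by apply: cvg0D; apply: cvg0Z; [exact: fc|exact: gc].
Qed.

Lemma fcvgD f g : fcvg f -> fcvg g -> fcvg (fun x => f x + g x).
Proof.
move=> fc gc; have [f2 _] := fc; have [g2 _] := gc.
apply: (fcvg_le _ fc gc) => [|n]; first exact: L2D.
have -> : ferr (fun x => f x + g x) n = Int mu (fun x =>
    ((f x - fpsum (fcoef f) n x) + (g x - fpsum (fcoef g) n x)) ^+ 2).
  rewrite /ferr; congr Int; apply/funext => x; congr (_ ^+ 2).
  rewrite addrACA -opprD; congr (_ - _); rewrite /fpsum -big_split /=.
  apply: eq_bigr => k _; rewrite -mulrDl; congr (_ * _).
  rewrite /fcoef -IntD; [|exact: L2M|exact: L2M].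
  by congr Int; apply/funext => y; rewrite mulrDl.
by apply: Int_sqrD_le; apply: L2B => //; exact: L2_fpsum.
Qed.

Lemma fcvgZ k f : fcvg f -> fcvg (fun x => k * f x).
Proof.
move=> [f2 fc]; split; first exact: L2Z.
have E n : ferr (fun x => k * f x) n = k ^+ 2 * ferr f n.
  rewrite !ferrE//; last exact: L2Z.
  rewrite mulrBr mulr_sumr -IntZ; last exact: L2_sqr.
  congr (_ - _); first by congr Int; apply/funext => x; rewrite exprMn.
  apply: eq_bigr => i _; rewrite -exprMn; congr (_ ^+ 2).
  rewrite /fcoef -IntZ; last exact: L2M.
  by congr Int; apply/funext => x; rewrite mulrA.
rewrite (_ : (fun n => _) = (fun n => k ^+ 2 * ferr f n)); last exact/funext.
by apply: cvg0Z; exact: fc.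
Qed.

Lemma fcvg_sum I (s : seq I) (F : I -> T -> R) : (forall i, fcvg (F i)) ->
  fcvg (fun x => \sum_(i <- s) F i x).
Proof.
move=> Fc; elim: s => [|i s IH].
  under eq_fun do rewrite big_nil; split; first exact: L2_0.
  have E n : ferr (fun=> 0) n = 0.
    apply/eqP; rewrite eq_le ferr_ge0 andbT ferrE; last exact: L2_0.
    under eq_fun do rewrite expr0n.
    by rewrite Int0 sub0r oppr_le0 sumr_ge0// => k _; exact: sqr_ge0.
  by rewrite (_ : (fun n => _) = (fun n => 0)); [exact: cvg_cst|exact/funext].
under eq_fun do rewrite big_cons.
by apply: fcvgD; [exact: Fc|exact: IH].
Qed.

(** The coefficients of g, used for f, give an error no smaller than that of f's own coefficients.
    The quarter of [eps] pays for the factor 2 in (a + b)^2 <= 2 a^2 + 2 b^2, used for two terms. *)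
Lemma fcvg_closed f : L2 mu f ->
  (forall eps, 0 < eps -> exists2 g, fcvg g & Int mu (fun x => (f x - g x) ^+ 2) < eps) ->
  fcvg f.
Proof.
move=> f2 H; split; first exact: f2.
apply/cvgrPdist_lt => eps eps0.
have [g [g2 gc] fg] := H (eps / 4) (divr_gt0 eps0 (ltr0n _ 4)).
have g4 : \forall n \near \oo, ferr g n < eps / 4.
  have /cvgrPdist_lt/(_ (eps / 4)) := gc.
  move=> /(_ (divr_gt0 eps0 (ltr0n _ 4))); apply: filterS => n.
  by rewrite sub0r normrN ger0_norm// ferr_ge0.
apply: filterS g4 => n gn; rewrite sub0r normrN ger0_norm ?ferr_ge0//.
apply: (le_lt_trans (ferr_le (fcoef g) n f2)).
have -> : Int mu (fun x => (f x - fpsum (fcoef g) n x) ^+ 2) =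
   Int mu (fun x => ((f x - g x) + (g x - fpsum (fcoef g) n x)) ^+ 2).
  by congr Int; apply/funext => x; rewrite addrA subrK.
apply: le_lt_trans.
  by apply: Int_sqrD_le; apply: L2B => //; exact: L2_fpsum.
by move: gn fg; rewrite /ferr; lra.
Qed.

End Orthonormal.

(** * Gamma integrals from explicit primitives *)

Section GammaIntegral.
Variable R : realType.
Local Notation leb := (@lebesgue_measure R).
Variable c : R.
Hypothesis c0 : 0 < c.

(** The primitive of v^n exp(-c v) that vanishes at infinity, by repeated integration by parts. *)
Fixpoint gamma_primitive (n : nat) (v : R) : R :=
  if n is n'.+1 then
    - (v ^+ n'.+1 * expR (- (c * v)) / c) + n'.+1%:R / c * gamma_primitive n' v
  else - (expR (- (c * v)) / c).

Lemma is_derive_gamma_primitive n (v : R) :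
  is_derive v (1 : R) (gamma_primitive n) (v ^+ n * expR (- (c * v))).
Proof.
have cn0 : c != 0 by rewrite gt_eqF.
elim: n => [|n IH] /=.
  by apply: is_derive_eq; rewrite !regular_scaleE expr0; field.
move: (gamma_primitive n) IH => G IH.
have H1 : is_derive v (1 : R) (fun w : R => w ^+ n.+1) (n.+1%:R * v ^+ n).
  have := is_derive_poly ('X^(n.+1)) v; rewrite derivXn /= hornerMn hornerXn mulr_natl.
  by congr is_derive; apply/funext => w; rewrite hornerXn.
have H2 : is_derive v (1 : R) (fun w : R => expR (- (c * w))) (- c * expR (- (c * v))).
  by apply: is_derive_eq; rewrite !regular_scaleE; ring.
have H3 := is_deriveM H1 H2.
have H4 := is_deriveZ c^-1 H3.
have H5 := is_deriveZ (n.+1%:R / c) IH.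
have H6 := is_deriveD (is_deriveN H4) H5.
rewrite (_ : (fun w => _) = - (c^-1 \*: ((fun w : R => w ^+ n.+1) *
  (fun w => expR (- (c * w))))) + (n.+1%:R / c) \*: G); last first.
  by apply/funext => w; rewrite !fctE /= !regular_scaleE; ring.
apply: is_derive_eq; rewrite !regular_scaleE exprS.
by field.
Qed.

Lemma gamma_primitive0 n : gamma_primitive n 0 = - (n`!%:R / c ^+ n.+1).
Proof.
have cn0 : c != 0 by rewrite gt_eqF.
elim: n => [|n IH] /=.
  by rewrite mulr0 oppr0 expR0 fact0 expr1.
rewrite IH mulr0 oppr0 expR0 exprS !mul0r oppr0 add0r factS natrM.
by rewrite [in RHS]exprS; field; rewrite cn0 expf_neq0.
Qed.

Lemma cvg_expR_poly n : (v ^+ n * expR (- (c * v))) @[v --> +oo] --> 0.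
Proof.
apply: (@squeeze_cvgr _ _ _ _ (fun=> 0) (fun v => (n.+1`!%:R / c ^+ n.+1) * v^-1)).
- near=> v; have v0 : 0 < v by near: v; exact: nbhs_pinfty_gt.
  apply/andP; split; first by rewrite mulr_ge0 ?expR_ge0// exprn_ge0// ltW.
  (* One term of the exponential series, of degree n + 1, already beats v^n by a factor v; it is the
     origin of the constant (n+1)!/c^(n+1). *)
  have := expR_ge1Dxn n (mulr_ge0 (ltW c0) (ltW v0)).
  rewrite expRN => H.
  rewrite ler_pdivrMr ?expR_gt0//.
  have k0 : 0 <= n.+1`!%:R / c ^+ n.+1 / v :> R.
    by rewrite !mulr_ge0 ?invr_ge0 ?exprn_ge0// ?ltW.
  apply: le_trans (ler_wpM2l k0 H); rewrite mulrDr mulr1 -[leLHS]add0r lerD//.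
  rewrite exprMn (exprS v) le_eqVlt; apply/orP; left; apply/eqP.
  field; rewrite !gt_eqF ?exprn_gt0//= ?ltr0n ?fact_gt0//.
- exact: cvg_cst.
- rewrite -(mulr0 (n.+1`!%:R / c ^+ n.+1)).
  apply: cvgM; first exact: cvg_cst.
  by apply/gtr0_cvgV0; [near=> v; near: v; exact: nbhs_pinfty_gt|].
Unshelve. all: by end_near. Qed.

Lemma cvg_gamma_primitive n : gamma_primitive n v @[v --> +oo] --> 0.
Proof.
elim: n => [|n IH] /=.
  have := cvg_expR_poly 0; under eq_fun do rewrite expr0 mul1r.
  move=> H; rewrite -oppr0; apply: cvgN; rewrite -(mul0r c^-1).
  by apply: cvgM => //; exact: cvg_cst.
rewrite -[0](addr0 0); apply: cvgD.
  rewrite -oppr0; apply: cvgN; rewrite -(mul0r c^-1).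
  by apply: cvgM; [exact: cvg_expR_poly|exact: cvg_cst].
by rewrite -(mulr0 (n.+1%:R / c)); apply: cvgM => //; exact: cvg_cst.
Qed.

Lemma integral_gamma n :
  (\int[leb]_(v in `[0%R, +oo[) (v ^+ n * expR (- (c * v)))%:E =
   (n`!%:R / c ^+ n.+1)%:E)%E.
Proof.
rewrite (@ge0_continuous_FTC2y _ _ (gamma_primitive n) 0 0).
- by rewrite gamma_primitive0 -EFinB sub0r opprK.
- by move=> x x0; rewrite mulr_ge0 ?expR_ge0// exprn_ge0.
- apply: continuous_subspaceT; apply: cont_mul; first exact: exprn_continuous.
  apply: (@cont_comp _ (fun v => - (c * v)) (@expR R)); last exact: continuous_expR.
  move=> x; apply: (@continuousN R R R (fun v => c * v) x).
  by apply: cont_mul; [exact: cont_cst|exact: cont_id].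
- exact: cvg_gamma_primitive.
- by move=> x _; have H := is_derive_gamma_primitive n x; exact: ex_derive.
- apply: cvg_at_right_filter; apply/differentiable_continuous/derivable1_diffP.
  by have H := is_derive_gamma_primitive n 0; exact: ex_derive.
- by move=> x _; rewrite derive1E; have H := is_derive_gamma_primitive n x; exact: derive_val.
Qed.

End GammaIntegral.

(** * Laplace transforms and the exponential law *)

Section Bernstein.
Variable R : realType.
Implicit Types (f g : nat -> R) (x : R).

(* The n-th Bernstein operator: the expectation of f at a binomial(n, x)
   variable, as a polynomial in x; conditioning on the first trial avoids
   binomial coefficients. *)
Fixpoint bernstein (n : nat) f : {poly R} :=
  if n is n'.+1 then
    'X * bernstein n' (f \o S) + (1 - 'X) * bernstein n' f
  else (f 0)%:P.

Lemma horner_bernsteinS n f x : (bernstein n.+1 f).[x] =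
  x * (bernstein n (f \o S)).[x] + (1 - x) * (bernstein n f).[x].
Proof. by rewrite /= !hornerE. Qed.

Lemma bernstein_cst n (c : R) x : (bernstein n (fun=> c)).[x] = c.
Proof.
elim: n => [|n IH]; first by rewrite /= hornerC.
by rewrite horner_bernsteinS [(fun=> c) \o S](_ : _ = (fun=> c))// IH; ring.
Qed.

Lemma le_bernstein n f g x : 0 <= x <= 1 -> (forall k, f k <= g k) ->
  (bernstein n f).[x] <= (bernstein n g).[x].
Proof.
move=> /andP[x0 x1]; elim: n f g => [|n IH] f g fg; first by rewrite /= !hornerC.
rewrite !horner_bernsteinS lerD// ler_wpM2l ?subr_ge0// IH// => k; exact: fg.
Qed.

Lemma bernstein_affine n f (a b : R) x :
  (bernstein n (fun k => a * f k + b)).[x] = a * (bernstein n f).[x] + b.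
Proof.
elim: n f => [|n IH] f; first by rewrite /= !hornerC.
by rewrite !horner_bernsteinS [_ \o S](_ : _ = (fun k => a * (f \o S) k + b))// !IH; ring.
Qed.

(** Variance plus squared bias of a binomial variable. The centre c stays arbitrary because
    conditioning on a success replaces it by c - 1. *)
Lemma bernstein_sqr n (c x : R) :
  (bernstein n (fun k => (k%:R - c) ^+ 2)).[x] = n%:R * x * (1 - x) + (n%:R * x - c) ^+ 2.
Proof.
elim: n c => [|n IH] c; first by rewrite /= hornerC; ring.
rewrite horner_bernsteinS.
have -> : (fun k : nat => (k%:R - c) ^+ 2) \o S = (fun k : nat => (k%:R - (c - 1)) ^+ 2).
  by apply/funext => k /=; congr (_ ^+ 2); rewrite -natr1; ring.
by rewrite !IH -natr1; ring.
Qed.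

Lemma normr_bernstein_le n f (M x : R) : 0 <= x <= 1 -> (forall k, `|f k| <= M) ->
  `|(bernstein n f).[x]| <= M.
Proof.
move=> x01 fM; rewrite ler_norml -{1}(bernstein_cst n (- M) x) -[X in _ && (_ <= X)](bernstein_cst n M x).
by apply/andP; split; apply: le_bernstein => // k; have := fM k; rewrite ler_norml => /andP[].
Qed.

(** Chebyshev's argument. Within [dl] of x the oscillation of [phi] is below e/2; farther away it is
    at most 2M <= K (k/N - x)^2. The operator is monotone and sends (k - N x)^2 to N x (1 - x), so
    the quadratic part is at most K/N. *)
Lemma cvg_bernstein (phi : R -> R) (M x : R) : (forall y, `|phi y| <= M) ->
  {for x, continuous phi} -> 0 <= x <= 1 ->
  (bernstein n.+1 (fun k => phi (k%:R / n.+1%:R))).[x] @[n --> \oo] --> phi x.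
Proof.
move=> phiM cphi x01; have /andP[x0 x1] := x01.
apply/cvgrPdist_le => e e0.
have e2 : 0 < e / 2 by rewrite divr_gt0.
move/cvgrPdist_lt : cphi => /(_ _ e2)/nbhs_ballP[dl /= dl0 H].
have M0 : 0 <= M by apply: le_trans (phiM 0).
pose K := 2 * M / dl ^+ 2.
have K0 : 0 <= K by apply: divr_ge0; [exact: mulr_ge0|exact/exprn_ge0/ltW].
near=> n.
have np : 0 < n.+1%:R :> R by rewrite ltr0n.
pose N := n.+1; have N0 : N%:R != 0 :> R by rewrite gt_eqF.
pose a := K / N%:R ^+ 2.
have a0 : 0 <= a by rewrite divr_ge0// exprn_ge0.
have B k : `|phi (k%:R / N%:R) - phi x| <= a * (k%:R - N%:R * x) ^+ 2 + e / 2.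
  have E : a * (k%:R - N%:R * x) ^+ 2 = K * (k%:R / N%:R - x) ^+ 2.
    by rewrite /a; field.
  rewrite E; have [kx|kx] := ltP `|x - k%:R / N%:R| dl.
    have := H (k%:R / N%:R) kx; rewrite distrC => /ltW h.
    by apply: (le_trans h); rewrite lerDr mulr_ge0// sqr_ge0.
  apply: (@le_trans _ _ (2 * M)).
    have h1 := phiM (k%:R / N%:R); have h2 := phiM x.
    by apply: (le_trans (ler_normB _ _)); lra.
  apply: (@le_trans _ _ (K * (k%:R / N%:R - x) ^+ 2)); last by rewrite lerDl ltW.
  rewrite /K -[leLHS](divfK (_ : dl ^+ 2 != 0)) ?gt_eqF ?exprn_gt0//.
  apply: ler_wpM2l; first exact: K0.
  by rewrite -[leRHS]real_normK ?num_real// distrC ler_pXn2r// ?nnegrE ltW.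
set f := fun k : nat => phi (k%:R / N%:R).
have up : (bernstein N f).[x] - phi x <= a * (N%:R * x * (1 - x)) + e / 2.
  have := bernstein_affine N f 1 (- phi x) x; rewrite mul1r => <-.
  have := bernstein_affine N (fun k => (k%:R - N%:R * x) ^+ 2) a (e / 2) x.
  rewrite bernstein_sqr subrr expr0n addr0 => <-.
  by apply: le_bernstein => // k; have := B k; rewrite ler_norml mul1r => /andP[].
have dn : phi x - (bernstein N f).[x] <= a * (N%:R * x * (1 - x)) + e / 2.
  rewrite [leLHS]addrC -[X in X + _ <= _]mulN1r -bernstein_affine.
  have := bernstein_affine N (fun k => (k%:R - N%:R * x) ^+ 2) a (e / 2) x.
  rewrite bernstein_sqr subrr expr0n addr0 => <-.
  apply: le_bernstein => // k; have := B k; rewrite ler_norml => /andP[+ _].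
  by rewrite -/(f k); lra.
have small : a * (N%:R * x * (1 - x)) <= e / 2.
  have -> : a * (N%:R * x * (1 - x)) = K * (x * (1 - x)) / N%:R.
    by rewrite /a; field.
  rewrite ler_pdivrMr//; apply: (@le_trans _ _ K).
    by rewrite ler_piMr//; nra.
  rewrite -ler_pdivrMl//.
  apply: (@le_trans _ _ n%:R); last by rewrite ler_nat.
  by near: n; exact: nbhs_infty_ger.
rewrite ler_norml; apply/andP; split; lra.
Unshelve. all: by end_near. Qed.

End Bernstein.

Section LaplaceTransform.
Variable R : realType.
Implicit Types nu : probability (measurableTypeR R) R.

Lemma L1_bounded nu (f : R -> R) (M : R) : measurable_fun setT f ->
  (forall x, `|f x| <= M) -> L1 nu f.
Proof.
move=> mf fM; apply: (@L1_le _ _ _ nu f (fun=> M)) => //.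
by apply: finite_measure_integrable_cst; rewrite ?fin_num_fun_lty.
Qed.

(** Clamping f to [-M, M] gives an everywhere bounded function that agrees with f almost
    everywhere. *)
Lemma ae_bounded_L1 nu (f : R -> R) (M : R) : measurable_fun setT f ->
  (\forall x \ae nu, `|f x| <= M) -> L1 nu f.
Proof.
move=> mf fM; pose g (x : R) := Num.max (- M) (Num.min M (f x)).
have mg : measurable_fun setT g.
  by apply: measurable_maxr => //; exact: measurable_minr.
apply: (@ae_eq_L1 _ _ _ nu g) => //.
  apply: (ae_imp _ fM) => x; rewrite ler_norml => /andP[h1 h2].
  by rewrite /g (min_idPr h2) (max_idPr h1).
apply: (@L1_bounded nu g (`|M|)) => // x; rewrite /g.
have := ler_norm M; have := ler_norm (- M); rewrite normrN => h1 h2.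
rewrite ler_norml; apply/andP; split.
  by rewrite le_max; apply/orP; left; lra.
by rewrite ge_max; apply/andP; split; [lra|rewrite ge_min h2].
Qed.

Lemma measurable_expRN : measurable_fun setT (fun v : R => expR (- v)).
Proof. by apply: measurableT_comp => //; exact: measurable_expR. Qed.

Lemma expRN_itv01 (v : R) : 0 <= v -> 0 <= expR (- v) <= 1.
Proof. by move=> v0; rewrite expR_ge0 expR_le1 oppr_le0. Qed.

(** The Laplace transform at n, which is also the n-th moment of exp(-v). For a law on the half line
    that variable lives in [0, 1]. *)
Definition laplace_nat nu (n : nat) : R := Int nu (fun v => expR (- v) ^+ n).

Lemma measurable_horner (p : {poly R}) : measurable_fun setT (horner p).
Proof. by apply: continuous_measurable_fun => x; exact: continuous_horner. Qed.

Lemma L1_laplace_nat nu n : (\forall v \ae nu, 0 <= v) ->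
  L1 nu (fun v => expR (- v) ^+ n).
Proof.
move=> nu0; apply: (@ae_bounded_L1 nu _ 1).
  by apply: measurable_funX; exact: measurable_expRN.
apply: (ae_imp _ nu0) => v /expRN_itv01/andP[h0 h1].
by rewrite ger0_norm ?exprn_ge0// exprn_ile1.
Qed.

Lemma Int_horner_expRN nu (p : {poly R}) : (\forall v \ae nu, 0 <= v) ->
  Int nu (fun v => p.[expR (- v)]) = \sum_(i < size p) p`_i * laplace_nat nu i.
Proof.
move=> nu0; under eq_fun do rewrite horner_coef.
rewrite Int_sum => [|i]; last by apply: L1Z; exact: L1_laplace_nat.
by apply: eq_bigr => i _; rewrite IntZ//; exact: L1_laplace_nat.
Qed.

Lemma cvg_Int_bernstein nu (phi : R -> R) (M : R) : (\forall v \ae nu, 0 <= v) ->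
  continuous phi -> (forall y, `|phi y| <= M) ->
  Int nu (fun v => (bernstein n.+1 (fun k => phi (k%:R / n.+1%:R))).[expR (- v)])
    @[n --> \oo] --> Int nu (fun v => phi (expR (- v))).
Proof.
move=> nu0 cphi phiM.
have [|||||_ //] := @cvg_Int_dominated_ae _ _ _ nu
  (fun n v => (bernstein n.+1 (fun k => phi (k%:R / n.+1%:R))).[expR (- v)])
  (fun v => phi (expR (- v))) (fun=> M).
- by move=> n; apply: (measurableT_comp (measurable_horner _)); exact: measurable_expRN.
- apply: (@measurableT_comp _ _ _ _ _ _ phi); last exact: measurable_expRN.
  exact: continuous_measurable_fun.
- by apply: (@L1_bounded nu _ `|M|).
- apply: (ae_imp _ nu0) => v /expRN_itv01 h n.
  by apply: normr_bernstein_le.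
- apply: (ae_imp _ nu0) => v /expRN_itv01 h.
  by apply: (@cvg_bernstein _ phi M); [|exact: cphi|].
Qed.

Lemma eq_laplace_nat_Int nu1 nu2 (phi : R -> R) (M : R) :
  (\forall v \ae nu1, 0 <= v) -> (\forall v \ae nu2, 0 <= v) ->
  (forall n, laplace_nat nu1 n = laplace_nat nu2 n) ->
  continuous phi -> (forall y, `|phi y| <= M) ->
  Int nu1 (fun v => phi (expR (- v))) = Int nu2 (fun v => phi (expR (- v))).
Proof.
move=> n1 n2 E cphi phiM.
have c1 := cvg_Int_bernstein n1 cphi phiM.
have c2 := cvg_Int_bernstein n2 cphi phiM.
set u1 := (X in X @ _ --> _) in c1; set u2 := (X in X @ _ --> _) in c2.
have E12 : u1 = u2.
  apply/funext => n; rewrite /u1 /u2 !Int_horner_expRN//.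
  by apply: eq_bigr => i _; rewrite E.
by rewrite E12 in c1; exact: (cvg_unique _ c1 c2).
Qed.

(** Continuous functions, equal to 1 from a on, that tend pointwise to the indicator of x >= a. *)
Definition ramp (a : R) (n : nat) (x : R) : R :=
  Num.max 0 (Num.min 1 (1 + n%:R * (x - a))).

Lemma ramp_bound a n x : `|ramp a n x| <= 1.
Proof.
rewrite /ramp ger0_norm; last by rewrite le_max lexx.
by rewrite ge_max ler01 ge_min lexx.
Qed.

Lemma cont_max (f g : R -> R) :
  continuous f -> continuous g -> continuous (fun x : R => Num.max (f x) (g x)).
Proof. by move=> cf cg x; apply: (@continuous_max R R f g x); [exact: cf|exact: cg]. Qed.

Lemma cont_min (f g : R -> R) :
  continuous f -> continuous g -> continuous (fun x : R => Num.min (f x) (g x)).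
Proof. by move=> cf cg x; apply: (@continuous_min R R f g x); [exact: cf|exact: cg]. Qed.

Lemma continuous_ramp a n : continuous (ramp a n).
Proof.
apply: cont_max; first exact: cont_cst.
apply: cont_min; first exact: cont_cst.
apply: cont_add; first exact: cont_cst.
apply: cont_mul; first exact: cont_cst.
by apply: cont_sub; [exact: cont_id|exact: cont_cst].
Qed.

Lemma cvg_ramp a x : ramp a n x @[n --> \oo] --> ((a <= x)%R%:R : R).
Proof.
apply: cvg_near_cst; have [ax|xa] := leP a x.
  apply: nearW => n; rewrite /ramp (min_idPl _) ?(max_idPr _)//.
  by rewrite lerDl mulr_ge0// subr_ge0.
near=> n; rewrite /ramp; apply/max_idPl; rewrite ge_min; apply/orP; right.
have : (a - x)^-1 <= n%:R by near: n; exact: nbhs_infty_ger.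
have ax : 0 < a - x by rewrite subr_gt0.
by rewrite -[(_)^-1]mul1r ler_pdivrMr//; nra.
Unshelve. all: by end_near. Qed.

Lemma Int_indicE nu (A : set R) : measurable A -> (Int nu (\1_A))%:E = nu A.
Proof.
move=> mA; rewrite -L1_integral ?integral_indic ?setIT//.
by apply: integrable_indic => //; rewrite fin_num_fun_lty.
Qed.

(** Equal moments give equal integrals of continuous bounded functions of exp(-v), by Bernstein
    approximation. Ramps turn these into the mass of v <= a, read as exp(-a) <= exp(-v); half-open
    intervals then determine the measure. *)
Lemma laplace_nat_inj nu1 nu2 :
  (\forall v \ae nu1, 0 <= v) -> (\forall v \ae nu2, 0 <= v) ->
  (forall n, laplace_nat nu1 n = laplace_nat nu2 n) ->
  forall A, measurable A -> nu1 A = nu2 A.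
Proof.
move=> n1 n2 E.
have ray a : nu1 `]-oo, a]%classic = nu2 `]-oo, a]%classic.
  have ind nu : (\forall v \ae nu, 0 <= v) ->
      Int nu (fun v => ramp (expR (- a)) n (expR (- v))) @[n --> \oo] -->
      Int nu (\1_(`]-oo, a]%classic)).
    move=> nu0; have [|||||_ //] := @cvg_Int_dominated _ _ _ nu
      (fun n v => ramp (expR (- a)) n (expR (- v))) (\1_(`]-oo, a]%classic)) (fun=> 1).
    - move=> n; apply: (@measurableT_comp _ _ _ _ _ _ (ramp _ n)); last exact: measurable_expRN.
      by apply: continuous_measurable_fun; exact: continuous_ramp.
    - exact: measurable_indic.
    - by apply: (@L1_bounded nu _ 1) => // x; rewrite normr1.
    - by move=> n v; exact: ramp_bound.
    - move=> v; rewrite indicE mem_setE in_itv /= -lerN2 -ler_expR.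
      exact: cvg_ramp.
  rewrite -!Int_indicE//; congr (_%:E).
  have c1 := ind _ n1; have c2 := ind _ n2.
  set u1 := (X in X @ _ --> _) in c1; set u2 := (X in X @ _ --> _) in c2.
  have E12 : u1 = u2.
    apply/funext => n; apply: (eq_laplace_nat_Int (M := 1)) => //.
      exact: continuous_ramp.
    exact: ramp_bound.
  by rewrite E12 in c1; exact: (cvg_unique _ c1 c2).
move=> A; apply: (@measure_unique _ _ (measurableTypeR R) (@ocitv R)
    (fun k => `](- k%:R), k%:R]%classic)) => //.
- exact: ocitvI.
- by move=> k; exact: is_ocitv.
- rewrite -subTset => x _; exists (Num.truncn `|x|).+1 => //=.
  rewrite in_itv/=; have := truncnS_gt `|x|; rewrite ltr_norml => /andP[-> /ltW ->//].
- move=> _ [[a b] _ <-] /=.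
  have -> : `]a, b]%classic = `]-oo, b] `\` `]-oo, a].
    by rewrite -[RHS]setCK setCD setCitvl setUC -[LHS]setCK setCitv.
  have [ab|ba] := leP a b; last first.
    rewrite (_ : _ `\` _ = set0) ?measure0//; apply/seteqP; split => // x [] /=.
    by rewrite !in_itv/= => xb /negP; rewrite -ltNge => ax; have := lt_le_trans ax (le_trans xb (ltW ba)); rewrite ltxx.
  rewrite !measureD ?setIidr//= ?ray//; try exact: subset_itvl.
  + by rewrite -ge0_fin_numE// fin_num_measure.
  + by rewrite -ge0_fin_numE// fin_num_measure.
- by move=> k; rewrite -ge0_fin_numE// fin_num_measure.
Qed.

End LaplaceTransform.

(** * Orthonormality and completeness of the Laguerre polynomials *)

Section ExponentialLaw.
Variable R : realType.
Local Notation leb := (@lebesgue_measure R).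

Definition exp1 : probability (measurableTypeR R) R.
Proof. by refine (exponential_prob (1 : R)); exact: ltr01. Defined.

Lemma exp1E (A : set (measurableTypeR R)) :
  exp1 A = (\int[leb]_(x in A) (exponential_pdf 1 x)%:E)%E.
Proof. by []. Qed.

Lemma exp1_pdf_ge0 (x : R) : 0 <= exponential_pdf 1 x.
Proof. exact: exponential_pdf_ge0. Qed.

Lemma exp1_pdfE (g : R -> R) :
  (fun v : R => g v * exponential_pdf 1 v) = (fun v : R => g v * expR (- v)) \_ `[0, +oo[.
Proof.
apply/funext => v; rewrite /exponential_pdf !patchE; case: ifPn => _; last by rewrite mulr0.
by rewrite mulN1r mul1r.
Qed.

Lemma L1_exp1 (g : R -> R) : measurable_fun setT g ->
  leb.-integrable `[0, +oo[ (EFin \o (fun v : R => g v * expR (- v))) -> L1 exp1 g.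
Proof.
move=> mg g1; apply: (@L1_density _ _ _ leb exp1 (exponential_pdf 1)) => //.
- exact: measurable_exponential_pdf.
- exact: exp1_pdf_ge0.
rewrite exp1_pdfE; move/integrable_mkcond : g1 => /(_ (measurable_itv _)).
by rewrite /L1 restrict_EFin.
Qed.

Lemma Int_exp1 (g : R -> R) : L1 exp1 g ->
  Int exp1 g = Rintegral leb `[0, +oo[%classic (fun v : R => g v * expR (- v)).
Proof.
move=> g1; rewrite (@Int_density _ _ _ leb exp1 (exponential_pdf 1))//.
- by rewrite exp1_pdfE /Int [RHS]Rintegral_mkcond.
- exact: measurable_exponential_pdf.
- exact: exp1_pdf_ge0.
Qed.

Lemma exp1_ae_gt0 : \forall v \ae exp1, 0 < v.
Proof.
exists `]-oo, 0]%classic; split => //.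
- rewrite exp1E -integral_itv_bndo_bndc; last first.
    by apply/measurable_EFinP/measurable_funTS; exact: measurable_exponential_pdf.
  rewrite integral0_eq// => x; rewrite /= in_itv/= => x0.
  by rewrite lt0_exponential_pdf.
- by move=> x /= /negP; rewrite -leNgt in_itv.
Qed.

Lemma exp1_ae_ge0 : \forall v \ae exp1, 0 <= v.
Proof. by apply: (ae_imp _ exp1_ae_gt0) => v /ltW. Qed.

(** One formula for the moments (s = 0), the Laplace transform (n = 0) and the mixed integrals
    behind the Laguerre coefficients of exp(-s v). *)
Lemma exp1_moment (s : R) n : 0 <= s ->
  L1 exp1 (fun v : R => v ^+ n * expR (- (s * v))) /\
  Int exp1 (fun v : R => v ^+ n * expR (- (s * v))) = n`!%:R / (1 + s) ^+ n.+1.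
Proof.
move=> s0; have c0 : 0 < 1 + s by rewrite ltr_pwDl.
have mg : measurable_fun setT (fun v : R => v ^+ n * expR (- (s * v))).
  apply: measurable_funM; first exact: measurable_funX.
  apply: (measurableT_comp (@measurable_expR R)).
  by apply: measurableT_comp => //; exact: measurable_funM.
have E (v : R) : v ^+ n * expR (- (s * v)) * expR (- v) = v ^+ n * expR (- ((1 + s) * v)).
  by rewrite -mulrA -expRD; congr (_ * expR _); ring.
have H := integral_gamma c0 n.
have g1 : leb.-integrable `[0, +oo[ (EFin \o (fun v : R => v ^+ n * expR (- (s * v)) * expR (- v))).
  apply/integrableP; split.
    apply/measurable_EFinP/measurable_funTS; apply: measurable_funM => //.
    exact: measurable_expRN.
  rewrite [ltLHS](_ : _ = (n`!%:R / (1 + s) ^+ n.+1)%:E) ?ltry// -H.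
  apply: eq_integral => v; rewrite inE/= in_itv/= andbT => v0.
  by rewrite E ger0_norm// mulr_ge0 ?expR_ge0// exprn_ge0.
have e1 := L1_exp1 mg g1; split => //.
rewrite Int_exp1// /Rintegral; under eq_integral do rewrite E.
by rewrite H.
Qed.

Lemma exp1_pow n : L1 exp1 (fun v : R => v ^+ n) /\ Int exp1 (fun v : R => v ^+ n) = n`!%:R.
Proof.
have [h1 h2] := exp1_moment n (lexx 0).
have E : (fun v : R => v ^+ n * expR (- (0 * v))) = (fun v : R => v ^+ n).
  by apply/funext => v; rewrite mul0r oppr0 expR0 mulr1.
by rewrite E in h1 h2; rewrite h2 addr0 expr1n divr1.
Qed.

Lemma exp1_laplace_nat n : laplace_nat exp1 n = (1 + n%:R)^-1.
Proof.
have [_] := exp1_moment 0 (ler0n R n); rewrite fact0 expr1 mul1r => <-.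
by congr Int; apply/funext => v; rewrite expr0 mul1r -mulrN -expRM_natl.
Qed.

Lemma L2_exp1_pow n : L2 exp1 (fun v : R => v ^+ n).
Proof.
split; first exact: measurable_funX.
by under eq_fun do rewrite -exprM; exact: (exp1_pow _).1.
Qed.

Lemma L2_laguerre k : L2 exp1 (@laguerre R k).
Proof.
rewrite (_ : laguerre k = fun u => \sum_(j < k.+1) (-1) ^+ j * 'C(k, j)%:R / j`!%:R * u ^+ j).
  by apply: L2_sum => j; apply: L2Z; exact: L2_exp1_pow.
by apply/funext => u; exact: laguerreE.
Qed.

(** Pascal's rule: an alternating binomial sum of order k + 1 is one of order k applied to the
    differences of g. *)
Lemma sum_bin_difference (k : nat) (g : nat -> R) :
  \sum_(j < k.+2) (-1) ^+ j * 'C(k.+1, j)%:R * g j =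
  \sum_(j < k.+1) (-1) ^+ j * 'C(k, j)%:R * (g j - g j.+1).
Proof.
have E : \sum_(j < k.+2) (-1) ^+ j * 'C(k, j)%:R * g j =
    \sum_(j < k.+1) (-1) ^+ j * 'C(k, j)%:R * g j.
  by rewrite big_ord_recr /= bin_small// mulr0 mul0r addr0.
under [RHS]eq_bigr do rewrite mulrBr.
rewrite big_split /= -E big_ord_recl [X in _ = X + _]big_ord_recl /= !bin0 -addrA.
congr (_ + _).
rewrite -big_split /=; apply: eq_bigr => j _.
by rewrite /bump /= add1n binS natrD exprS; ring.
Qed.

(** The quotient is the rising product (j+a+1)...(j+a+m), of degree m in j, and the sum is a k-th
    finite difference. Each difference lowers the degree by one, shifts a by one and multiplies by
    minus the degree, so a nonzero value remains only for m = k. *)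
Lemma sum_bin_rising (k m a : nat) : (m <= k)%N ->
  \sum_(j < k.+1) (-1) ^+ j * 'C(k, j)%:R * ((j + a + m)`!%:R / (j + a)`!%:R) =
  (if m == k then (-1) ^+ k * k`!%:R else 0) :> R.
Proof.
have factN0 (r : nat) : r`!%:R != 0 :> R by rewrite pnatr_eq0 -lt0n fact_gt0.
elim: k m a => [|k IH] m a.
  rewrite leqn0 => /eqP ->; rewrite big_ord_recl big_ord0 addr0 /= addn0.
  by rewrite divff// !mul1r.
case: m => [_|m mk].
  rewrite (sum_bin_difference k (fun j => (j + a + 0)`!%:R / (j + a)`!%:R)).
  by rewrite big1// => j _; rewrite !addn0 !divff// subrr mulr0.
rewrite (sum_bin_difference k (fun j => (j + a + m.+1)`!%:R / (j + a)`!%:R)).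
transitivity (- m.+1%:R * \sum_(j < k.+1) (-1) ^+ j * 'C(k, j)%:R *
    ((j + a.+1 + m)`!%:R / (j + a.+1)`!%:R) : R).
  rewrite mulr_sumr; apply: eq_bigr => j _; rewrite [RHS]mulrCA; congr (_ * _).
  rewrite !addnS !addSn !factS !natrM.
  have -> : (j + a + m).+2%:R = (j + a).+1%:R + m.+1%:R :> R.
    by rewrite -natrD; congr (_%:R); lia.
  field.
  by rewrite factN0 -natrD addrC natr1 pnatr_eq0.
rewrite IH// eqSS; case: eqP => [->|_]; last by rewrite mulr0.
by rewrite exprS factS natrM; ring.
Qed.

(** The moment of order j + m is (j + m)!, so the integral is the alternating sum of rising products
    with a = 0. *)
Lemma Int_pow_laguerre k m : (m <= k)%N ->
  Int exp1 (fun v : R => v ^+ m * laguerre k v) =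
  if m == k then (-1) ^+ k * k`!%:R else 0.
Proof.
move=> mk; rewrite -(sum_bin_rising 0 mk).
transitivity (Int exp1 (fun v : R => \sum_(j < k.+1)
    (-1) ^+ j * 'C(k, j)%:R / j`!%:R * v ^+ (j + m))).
  congr Int; apply/funext => v; rewrite laguerreE mulr_sumr.
  by apply: eq_bigr => j _; rewrite exprD; ring.
rewrite Int_sum => [|j]; last by apply: L1Z; exact: (exp1_pow _).1.
apply: eq_bigr => j _; rewrite IntZ; last exact: (exp1_pow _).1.
by rewrite (exp1_pow _).2 addn0; ring.
Qed.

(** Expanding the polynomial of smaller degree m, all powers below the degree of the other integrate
    to 0. For equal degrees the leading coefficient (-1)^m/m! meets (-1)^m m!. *)
Lemma laguerre_orthonormal j k :
  Int exp1 (fun v : R => laguerre j v * laguerre k v) = (j == k)%:R.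
Proof.
have H m n : (m <= n)%N -> Int exp1 (fun v : R => laguerre m v * laguerre n v) = (m == n)%:R.
  move=> mn; transitivity (Int exp1 (fun v : R => \sum_(i < m.+1)
      (-1) ^+ i * 'C(m, i)%:R / i`!%:R * (v ^+ i * laguerre n v))).
    congr Int; apply/funext => v; rewrite laguerreE mulr_suml.
    by apply: eq_bigr => i _; ring.
  have l1 i : L1 exp1 (fun v : R => v ^+ i * laguerre n v).
    by apply: L2M; [exact: L2_exp1_pow|exact: L2_laguerre].
  rewrite Int_sum => [|i]; last exact: L1Z.
  rewrite big_ord_recr /= big1 ?add0r => [|i _]; last first.
    have im : (i < n)%N by apply: leq_trans mn.
    by rewrite IntZ// Int_pow_laguerre ?(ltn_eqF im) ?mulr0// ltnW.
  rewrite IntZ// Int_pow_laguerre//; case: eqP => [->|]; last by rewrite mulr0.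
  rewrite binn mulr1 mulrACA -exprMn mulrNN mulr1 expr1n mul1r mulVf//.
have [jk|/ltnW kj] := leqP j k; first exact: H.
rewrite eq_sym -H//; congr Int; apply/funext => v; exact: mulrC.
Qed.

Let lag_cvg := @fcvg _ _ _ exp1 (@laguerre R).

(** After integration the sum is the binomial expansion of (1 - 1/(1+n))^k divided by 1 + n. *)
Lemma fcoef_laguerre_expR n k : fcoef exp1 (@laguerre R) (fun v : R => expR (- v) ^+ n) k =
  n%:R ^+ k / (1 + n%:R) ^+ k.+1.
Proof.
have n0 : 0 <= n%:R :> R by exact: ler0n.
have c0 : 1 + n%:R != 0 :> R by rewrite gt_eqF// ltr_pwDl.
have factN0 (r : nat) : r`!%:R != 0 :> R by rewrite pnatr_eq0 -lt0n fact_gt0.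
transitivity (Int exp1 (fun v : R => \sum_(i < k.+1)
    (-1) ^+ i * 'C(k, i)%:R / i`!%:R * (v ^+ i * expR (- (n%:R * v))))).
  congr Int; apply/funext => v; rewrite laguerreE mulr_sumr.
  by apply: eq_bigr => i _; rewrite -mulrN expRM_natl; ring.
rewrite Int_sum => [|i]; last by apply: L1Z; exact: (exp1_moment _ n0).1.
transitivity ((1 + n%:R)^-1 * (1 - (1 + n%:R)^-1) ^+ k : R); last first.
  have -> : 1 - (1 + n%:R)^-1 = n%:R / (1 + n%:R) :> R by field.
  by rewrite exprMn exprVn exprS; field; rewrite expf_neq0.
rewrite exprBn mulr_sumr; apply: eq_bigr => i _.
rewrite IntZ; last exact: (exp1_moment _ n0).1.
rewrite (exp1_moment _ n0).2 expr1n mulr1 exprVn exprS -mulr_natr.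
by field; rewrite c0 expf_neq0// factN0.
Qed.

(** The squared norm is 1/(1+2n) and the squared coefficients form a geometric series of ratio q^2,
    q = n/(1+n). As (1+n)^2 - (1+2n) = n^2, each one removes exactly the fraction 1 - q^2 of the
    remaining error, which therefore tends to 0. *)
Lemma fcvg_laguerre_expR n : lag_cvg (fun v : R => expR (- v) ^+ n).
Proof.
have l2 : L2 exp1 (fun v : R => expR (- v) ^+ n).
  split; first by apply: measurable_funX; exact: measurable_expRN.
  by under eq_fun do rewrite -exprM; apply: L1_laplace_nat; exact: exp1_ae_ge0.
split => //.
pose q : R := n%:R / (1 + n%:R).
have n0 : 0 <= n%:R :> R by exact: ler0n.
have c0 : 0 < 1 + n%:R :> R by rewrite ltr_pwDl.
have c0' : 1 + n%:R != 0 :> R by rewrite gt_eqF.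
have E k : ferr exp1 (@laguerre R) (fun v : R => expR (- v) ^+ n) k =
    (1 + 2 * n%:R)^-1 * (q ^+ 2) ^+ k.
  have d0 : 1 + 2 * n%:R != 0 :> R by rewrite gt_eqF// ltr_pwDl// mulr_ge0.
  rewrite (ferrE L2_laguerre laguerre_orthonormal)//.
  under eq_fun do rewrite -exprM.
  rewrite -/(laplace_nat _ _) exp1_laplace_nat natrM mulrC.
  elim: k => [|k IH]; first by rewrite big_ord0 subr0 expr0 mulr1.
  rewrite big_ord_recr /= opprD addrA IH fcoef_laguerre_expR [in RHS]exprSr.
  have -> : (q ^+ 2) ^+ k = (q ^+ k) ^+ 2 by rewrite -!exprM mulnC.
  set N : R := n%:R.
  have -> : (N ^+ k / (1 + N) ^+ k.+1) ^+ 2 = (q ^+ k) ^+ 2 / (1 + N) ^+ 2.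
    have -> : q ^+ k = N ^+ k / (1 + N) ^+ k by rewrite /q exprMn exprVn.
    by rewrite (exprSr (1 + N) k); field; rewrite c0' expf_neq0.
  by move: (q ^+ k) => z; rewrite /q; field; rewrite c0' d0.
rewrite (_ : (fun k => _) = (fun k => (1 + 2 * n%:R)^-1 * (q ^+ 2) ^+ k)); last exact/funext.
apply: cvg0Z; apply: cvg_expr; rewrite ger0_norm ?sqr_ge0//.
have q1 : q < 1 by rewrite /q ltr_pdivrMr// mul1r ltrDr.
have q0 : 0 <= q by rewrite /q divr_ge0// ltW.
nra.
Qed.

Lemma fcvg_laguerre_horner (p : {poly R}) : lag_cvg (fun v : R => p.[expR (- v)]).
Proof.
under eq_fun do rewrite horner_coef.
apply: (fcvg_sum L2_laguerre laguerre_orthonormal) => i.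
by apply: (fcvgZ L2_laguerre laguerre_orthonormal); exact: fcvg_laguerre_expR.
Qed.

(** Bernstein polynomials in exp(-v) converge pointwise and boundedly, hence in mean square, and the
    expandable functions form a closed set. *)
Lemma fcvg_laguerre_cont (phi : R -> R) (M : R) : continuous phi ->
  (forall y, `|phi y| <= M) -> lag_cvg (fun v : R => phi (expR (- v))).
Proof.
move=> cphi phiM; pose f (v : R) := phi (expR (- v)).
pose B n (v : R) := (bernstein n.+1 (fun k => phi (k%:R / n.+1%:R))).[expR (- v)].
have mf : measurable_fun setT f.
  apply: (measurableT_comp (continuous_measurable_fun cphi)).
  exact: measurable_expRN.
have mB n : measurable_fun setT (B n).
  by apply: (measurableT_comp (measurable_horner _)); exact: measurable_expRN.
have f2 : L2 exp1 f.
  split => //; apply: (@L1_bounded _ _ _ (M ^+ 2)); first exact: measurable_funX.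
  move=> x; rewrite normrX lerXn2r ?nnegrE ?phiM//.
  by apply: le_trans (phiM 0).
apply: (fcvg_closed L2_laguerre laguerre_orthonormal f2) => eps eps0.
have [|||||_] := @cvg_Int_dominated_ae _ _ _ exp1 (fun n v => (f v - B n v) ^+ 2)
  (fun=> 0) (fun=> (2 * M) ^+ 2).
- by move=> n; apply: measurable_funX; exact: (measurable_funB mf (mB n)).
- exact: measurable_cst.
- by apply: (@L1_bounded _ _ _ ((2 * M) ^+ 2)) => // x; rewrite ger0_norm// sqr_ge0.
- apply: (ae_imp _ exp1_ae_ge0) => v /expRN_itv01 h n.
  rewrite normrX lerXn2r ?nnegrE//.
    by rewrite mulr_ge0// (le_trans _ (phiM 0)).
  have h1 := phiM (expR (- v)).
  have h2 : `|B n v| <= M by apply: normr_bernstein_le.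
  by apply: (le_trans (ler_normB _ _)); rewrite /f; lra.
- apply: (ae_imp _ exp1_ae_ge0) => v /expRN_itv01 h.
  have c := @cvg_bernstein _ phi M _ phiM (cphi _) h.
  rewrite [X in _ --> X](_ : 0 = (f v - f v) * (f v - f v)); last by rewrite subrr mulr0.
  by apply: cvgM; (apply: cvgB; [exact: cvg_cst|exact: c]).
rewrite Int0 => /cvgrPdist_lt/(_ _ eps0)[n _ /(_ n (leqnn _))] /=.
rewrite sub0r normrN => h; exists (B n); first exact: fcvg_laguerre_horner.
exact: (le_lt_trans (ler_norm _) h).
Qed.

(** The function g may be unbounded at 0 and at infinity, so its argument is truncated. Monotonicity
    supplies the dominating function: the truncated argument lies between v and 1, which bounds the
    value by |g v| + |g 1|. *)
Lemma fcvg_laguerre_nondecreasing (g : R -> R) : L2 exp1 g ->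
  (forall v, 0 < v -> {for v, continuous g}) ->
  (forall v w, 0 < v -> v <= w -> g v <= g w) -> lag_cvg g.
Proof.
move=> g2 cg ndg.
have mg := L2_measurable g2.
(* truncation of v to [1/(n+1), n+1], as a continuous function of exp(-v) *)
pose lo n : R := expR (- n.+1%:R); pose hi n : R := expR (- n.+1%:R^-1).
pose clip n (x : R) := Num.max (lo n) (Num.min (hi n) x).
pose phi n (x : R) := g (- ln (clip n x)).
have lohi n : lo n <= hi n.
  rewrite ler_expR lerN2 (@le_trans _ _ 1)// ?ler1n// invf_le1 ?ltr0n// ler1n//.
have clip_lo n x : lo n <= clip n x by rewrite le_max lexx.
have clip_hi n x : clip n x <= hi n by rewrite ge_max lohi ge_min lexx.
have clip0 n x : 0 < clip n x by apply: lt_le_trans (clip_lo n x); exact: expR_gt0.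
have lnlo n x : - ln (clip n x) <= n.+1%:R.
  by rewrite lerNl -(expRK (- n.+1%:R)) ler_ln ?posrE ?expR_gt0 ?clip0//; exact: clip_lo.
have lnhi n x : n.+1%:R^-1 <= - ln (clip n x).
  by rewrite lerNr -(expRK (- n.+1%:R^-1)) ler_ln ?posrE ?expR_gt0 ?clip0//; exact: clip_hi.
have ln0 n x : 0 < - ln (clip n x) by apply: lt_le_trans (lnhi n x); rewrite invr_gt0.
have inv0 n : 0 < n.+1%:R^-1 :> R by rewrite invr_gt0.
have cphi n : continuous (phi n).
  move=> x; apply: (@continuous_comp _ _ _ (fun x => - ln (clip n x)) g).
    apply: (@continuousN R R R (fun x => ln (clip n x)) x).
    apply: (@continuous_comp _ _ _ (clip n) (@ln R)).
      apply: cont_max; first exact: cont_cst.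
      by apply: cont_min; [exact: cont_cst|exact: cont_id].
    exact: continuous_ln.
  exact: cg.
have phiM n y : `|phi n y| <= `|g n.+1%:R^-1| + `|g n.+1%:R|.
  have h1 := ndg _ _ (inv0 n) (lnhi n y).
  have h2 := ndg _ _ (ln0 n y) (lnlo n y).
  have := ler_norm (- g n.+1%:R^-1); have := ler_norm (g n.+1%:R); rewrite normrN.
  have := normr_ge0 (g n.+1%:R^-1); have := normr_ge0 (g n.+1%:R).
  by rewrite /phi ler_norml => *; apply/andP; split; lra.
apply: (fcvg_closed L2_laguerre laguerre_orthonormal g2) => eps eps0.
have [|||||_] := @cvg_Int_dominated_ae _ _ _ exp1
  (fun n v => (g v - phi n (expR (- v))) ^+ 2)
  (* From (2 |g v| + |g 1|)^2 <= 8 (g v)^2 + 2 (g 1)^2. *)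
  (fun=> 0) (fun v : R => 8 * g v ^+ 2 + 2 * g 1 ^+ 2).
- move=> n; apply: measurable_funX; apply: measurable_funB => //.
  apply: (measurableT_comp (continuous_measurable_fun (cphi n))).
  exact: measurable_expRN.
- exact: measurable_cst.
- apply: L1D; first by apply: L1Z; exact: L2_sqr.
  by apply: (@L1_bounded _ _ _ `|2 * g 1 ^+ 2|).
- apply: (ae_imp _ exp1_ae_gt0) => v v0 n.
  rewrite ger0_norm ?sqr_ge0//.
  suff : `|phi n (expR (- v))| <= `|g v| + `|g 1|.
    move=> h; have : `|g v - phi n (expR (- v))| <= 2 * `|g v| + `|g 1|.
      by apply: (le_trans (ler_normB _ _)); lra.
    move=> H; rewrite -(real_normK (num_real (g v - _))) -(real_normK (num_real (g v))).
    rewrite -(real_normK (num_real (g 1))).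
    have := normr_ge0 (g v - phi n (expR (- v))); have := sqr_ge0 (2 * `|g v| - `|g 1|).
    by nra.
  set w := - ln (clip n (expR (- v))).
  (* The point 1 belongs to every truncation interval, so truncation moves v towards 1 and never
     past it. *)
  have wv : (v <= w <= 1) || (1 <= w <= v).
    have e1 : lo n <= expR (- 1) by rewrite ler_expR lerN2 ler1n.
    have e2 : expR (- 1) <= hi n by rewrite ler_expR lerN2 invf_le1 ?ltr0n// ler1n.
    have cl x : x <= expR (- 1) -> x <= clip n x <= expR (- 1).
      move=> x1; rewrite /clip le_max ge_max e1 /= (min_idPr (le_trans x1 e2)) lexx x1.
      by rewrite orbT.
    have ch x : expR (- 1) <= x -> expR (- 1) <= clip n x <= x.
      move=> x1; rewrite /clip le_max ge_max (le_trans e1 x1) /= le_min e2 x1 orbT.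
      by rewrite ge_min lexx orbT.
    have tr x y : 0 < x -> (x <= expR (- y)) = (y <= - ln x).
      by move=> x0; rewrite lerNr -[in RHS](expRK (- y)) ler_ln ?posrE ?expR_gt0.
    have tr' x y : 0 < x -> (expR (- y) <= x) = (- ln x <= y).
      by move=> x0; rewrite lerNl -[in RHS](expRK (- y)) ler_ln ?posrE ?expR_gt0.
    have [v1|/ltW v1] := leP v 1; apply/orP; [left|right].
      have /ch/andP[] : expR (- 1) <= expR (- v) by rewrite ler_expR lerN2.
      by rewrite tr' ?clip0// tr ?clip0// -/w => -> ->.
    have /cl/andP[] : expR (- v) <= expR (- 1) by rewrite ler_expR lerN2.
    by rewrite tr' ?clip0// tr ?clip0// -/w => -> ->.
  have := ler_norm (- g v); have := ler_norm (g v).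
  have := ler_norm (- g 1); have := ler_norm (g 1); rewrite !normrN /phi -/w ler_norml.
  have := normr_ge0 (g v); have := normr_ge0 (g 1).
  case/orP : wv => /andP[a1 a2] *; have := ndg _ _ _ a1; have := ndg _ _ _ a2.
    by move=> /(_ (lt_le_trans v0 a1)) ? /(_ v0) ?; apply/andP; split; lra.
  by move=> /(_ (lt_le_trans ltr01 a1)) ? /(_ ltr01) ?; apply/andP; split; lra.
- apply: (ae_imp _ exp1_ae_gt0) => v v0; apply: cvg_near_cst; near=> n.
  suff E : - ln (clip n (expR (- v))) = v by rewrite /phi E subrr expr0n.
  suff -> : clip n (expR (- v)) = expR (- v) by rewrite expRK opprK.
  rewrite /clip (min_idPr _) ?(max_idPr _)// ler_expR lerN2.
    apply: (@le_trans _ _ n%:R); last by rewrite ler_nat.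
    by near: n; exact: nbhs_infty_ger.
  rewrite -[leRHS]invrK lef_pV2 ?posrE ?invr_gt0//.
  apply: (@le_trans _ _ n%:R); last by rewrite ler_nat.
  by near: n; exact: nbhs_infty_ger.
rewrite Int0 => /cvgrPdist_lt/(_ _ eps0)[n _ /(_ n (leqnn _))] /=.
rewrite sub0r normrN => h; exists (fun v : R => phi n (expR (- v))).
  exact: (fcvg_laguerre_cont (cphi n) (phiM n)).
exact: (le_lt_trans (ler_norm _) h).
Unshelve. all: by end_near. Qed.

End ExponentialLaw.

(** * Square integrability of powers and of the logarithm *)

Section SquareIntegrability.
Variable R : realType.
Local Notation leb := (@lebesgue_measure R).

(** The primitive v (ln(v)^2 - 2 ln v + 2) equals 2 at 1 and is nonnegative at e, its bracket being
    (ln e - 1)^2 + 1. *)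
Lemma integral_sqr_ln (e : R) : 0 < e -> e < 1 ->
  (\int[leb]_(v in `[e, 1%R]) (ln v ^+ 2)%:E <= 2%:E)%E.
Proof.
move=> e0 e1.
pose F (v : R) := v * (ln v ^+ 2 - 2 * ln v + 2).
have dF (v : R) : 0 < v -> is_derive v (1 : R) F (ln v ^+ 2).
  move=> v0; have H := is_derive1_ln v0.
  apply: is_derive_eq; rewrite !regular_scaleE.
  by field; rewrite gt_eqF.
have cF (v : R) : 0 < v -> {for v, continuous F}.
  move=> v0; apply/differentiable_continuous/derivable1_diffP.
  by have H := dF _ v0; exact: ex_derive.
rewrite (@continuous_FTC2 _ (fun v : R => ln v ^+ 2) F)//.
- rewrite -EFinB lee_fin /F ln1 expr0n mulr0 subr0 add0r mul1r gerBl.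
  rewrite mulr_ge0 ?(ltW e0)//.
  have -> : ln e ^+ 2 - 2 * ln e + 2 = (ln e - 1) ^+ 2 + 1 by ring.
  by rewrite addr_ge0 ?sqr_ge0.
- apply: continuous_in_subspaceT => v; rewrite inE/= in_itv/= => /andP[ev _].
  have v0 : 0 < v by exact: lt_le_trans ev.
  apply: (@continuousM R R (@ln R) (@ln R) v); exact: continuous_ln.
- split.
  + move=> v; rewrite in_itv/= => /andP[ev _].
    by have H := dF _ (lt_trans e0 ev); exact: ex_derive.
  + by apply: cvg_at_right_filter; exact: cF.
  + by apply: cvg_at_left_filter; exact: cF.
- move=> v; rewrite in_itv/= => /andP[ev _]; rewrite derive1E.
  by have H := dF _ (lt_trans e0 ev); exact: derive_val.
Qed.

Lemma L1_sqr_ln : L1 leb ((fun v : R => ln v ^+ 2) \_ `]0, 1]).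
Proof.
have mln : measurable_fun setT (fun v : R => ln v ^+ 2).
  by apply: measurable_funX; exact: measurable_ln.
have mr : measurable_fun setT ((fun v : R => ln v ^+ 2) \_ `]0, 1]).
  apply: (measurable_restrictT _ (measurable_itv `]0, 1])).1.
  exact: measurable_funTS.
apply: L1_ge0 => //.
  by move=> v; rewrite patchE; case: ifPn => // _; exact: sqr_ge0.
have -> : (\int[leb]_v (((fun v : R => ln v ^+ 2) \_ `]0, 1]) v)%:E =
    \int[leb]_(v in `]0%R, 1%R]%classic) (ln v ^+ 2)%:E)%E.
  by rewrite [RHS]integral_mkcond restrict_EFin.
(* Starting at 1/2 keeps the left end strictly below 1, as [integral_sqr_ln] requires. *)
pose F (n : nat) : set R := `[n.+2%:R^-1, 1]%classic.
have UF : \bigcup_n F n = `]0, 1]%classic.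
  apply/seteqP; split => [v [n _]|v] /=.
    rewrite /F /= !in_itv/= => /andP[nv ->]; rewrite andbT.
    by apply: lt_le_trans nv; rewrite invr_gt0.
  rewrite in_itv/= => /andP[v0 v1]; exists (Num.truncn v^-1) => //=.
  rewrite /F /= in_itv/= v1 andbT -[leRHS]invrK lef_pV2 ?posrE ?invr_gt0//.
  apply: (le_trans (ltW (truncnS_gt _))).
  by rewrite ler_nat.
have ndF : nondecreasing_seq F.
  move=> a b ab; apply/subsetPset => v; rewrite /F /= !in_itv/= => /andP[av ->].
  by rewrite andbT (le_trans _ av)// lef_pV2 ?posrE ?ler_nat.
have mF n : measurable (F n : set (measurableTypeR R)) by exact: measurable_itv.
have mfF n : measurable_fun (F n) (fun v : R => (ln v ^+ 2)%:E).
  by apply/measurable_EFinP; exact: measurable_funTS.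
have f0 n v : F n v -> (0%E <= (ln v ^+ 2)%:E)%E by rewrite lee_fin sqr_ge0.
have := @ge0_nondecreasing_set_cvg_integral _ (measurableTypeR R) R F
  (fun v : R => (ln v ^+ 2)%:E) leb ndF mF mfF f0.
rewrite UF => H; apply: (@le_lt_trans _ _ 2%:E); last exact: ltry.
rewrite -(cvg_lim _ H)//; apply: lime_le.
  by apply/cvg_ex; eexists; exact: H.
apply: nearW => n; apply: integral_sqr_ln; first by rewrite invr_gt0.
by rewrite invf_lt1// ltr1n.
Qed.

Lemma exp1_pdf_le1 (v : R) : exponential_pdf 1 v <= 1.
Proof.
rewrite /exponential_pdf patchE; case: ifPn => //.
by rewrite inE/= in_itv/= andbT => v0; rewrite mul1r mulN1r expR_le1 oppr_le0.
Qed.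

(** On ]0, 1] the exponential density is at most 1, so Lebesgue integrability suffices; beyond 1, ln
    v <= v and the second moment takes over. For v <= 0 the logarithm has the default value 0. *)
Lemma L1_exp1_sqr_ln : L1 (exp1 R) (fun v : R => ln v ^+ 2).
Proof.
have mln : measurable_fun setT (fun v : R => ln v ^+ 2).
  by apply: measurable_funX; exact: measurable_ln.
pose h := (fun v : R => ln v ^+ 2) \_ `]0, 1].
have h1 : L1 leb h by exact: L1_sqr_ln.
have mh : measurable_fun setT h := L1_measurable h1.
have h0 v : 0 <= h v by rewrite /h patchE; case: ifPn => // _; exact: sqr_ge0.
have h2 : L1 (exp1 R) h.
  apply: (@L1_density _ _ _ leb (exp1 R) (exponential_pdf 1)) => //.
  - exact: measurable_exponential_pdf.
  - exact: exp1_pdf_ge0.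
  apply: (@L1_le _ _ _ leb _ h) => //.
    by apply: measurable_funM => //; exact: measurable_exponential_pdf.
  move=> v; rewrite ger0_norm ?mulr_ge0 ?exp1_pdf_ge0//.
  by rewrite ler_piMr// exp1_pdf_le1.
apply: (@L1_le _ _ _ (exp1 R) _ (fun v : R => h v + v ^+ 2)) => //.
  by apply: L1D => //; exact: (exp1_pow _ _).1.
move=> v; rewrite ger0_norm ?sqr_ge0//.
have [v0|v0] := leP v 0; first by rewrite ln0// expr0n/= addr_ge0// sqr_ge0.
have [v1|v1] := leP v 1.
  by rewrite /h patchE mem_set/= ?in_itv/= ?v0// lerDl sqr_ge0.
apply: (@le_trans _ _ (v ^+ 2)); last by rewrite lerDr.
by rewrite lerXn2r ?nnegrE ?ln_ge0 ?(ltW v0) ?(ltW v1)// ltW// ln_sublinear.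
Qed.

Lemma measurable_sqrt2 : measurable_fun setT (fun v : R => Num.sqrt (2 * v)).
Proof.
apply: (measurableT_comp (continuous_measurable_fun (@sqrt_continuous R))).
exact: measurable_funM.
Qed.

Lemma continuous_sqrt2 : continuous (fun v : R => Num.sqrt (2 * v)).
Proof.
apply: (@cont_comp R (fun v => 2 * v) Num.sqrt); last exact: sqrt_continuous.
by apply: cont_mul; [exact: cont_cst|exact: cont_id].
Qed.

Lemma L2_exp1_ln : L2 (exp1 R) (fun v : R => ln (Num.sqrt (2 * v))).
Proof.
have mln := @measurable_ln R.
have l2 : L2 (exp1 R) (fun v : R => ln v) by split => //; exact: L1_exp1_sqr_ln.
have c2 : L2 (exp1 R) (fun=> `|ln 2| : R).
  by split => //; apply: (@L1_bounded _ _ _ `|(`|ln 2| ^+ 2)|).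
have a2 : L2 (exp1 R) (fun v : R => `|ln v|).
  split; first exact: measurableT_comp.
  by under eq_fun do rewrite real_normK ?num_real//; exact: L1_exp1_sqr_ln.
apply: (L2_le _ (L2D c2 a2)).
  exact: (measurableT_comp mln measurable_sqrt2).
move=> v; have [v0|v0] := leP v 0.
  have v2 : 2 * v <= 0 by rewrite pmulr_rle0.
  by rewrite (ler0_sqrtr v2) ln0// normr0.
rewrite [leRHS]ger0_norm ?addr_ge0//.
have v2 : 0 < 2 * v by rewrite mulr_gt0.
have E : ln (2 * v) = ln (Num.sqrt (2 * v)) *+ 2.
  by rewrite -lnXn ?sqrtr_gt0// sqr_sqrtr// ltW.
rewrite lnM ?posrE// in E.
have -> : ln (Num.sqrt (2 * v)) = (ln 2 + ln v) / 2.
  by rewrite E -(mulr_natr (ln _) 2) mulfK.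
rewrite normrM (ger0_norm (_ : 0 <= 2^-1))//.
have := ler_normD (ln 2) (ln v); have := normr_ge0 (ln 2 : R); have := normr_ge0 (ln v).
by lra.
Qed.

(** Where r = sqrt(2 v) is at most 1 the power is at most 1. Elsewhere it is at most r^m for an
    integer m above [nu], and r^(2m) = (2 v)^m is integrable. *)
Lemma L2_exp1_powR (nu : R) : 0 < nu ->
  L2 (exp1 R) (fun v : R => Num.sqrt (2 * v) `^ nu).
Proof.
move=> nu0; have mp : measurable_fun setT (fun v : R => Num.sqrt (2 * v) `^ nu).
  exact: (measurableT_comp (measurable_powR nu) measurable_sqrt2).
split => //; pose m := (Num.truncn nu).+1.
have num : nu <= m%:R by rewrite ltW// truncnS_gt.
have i1 : L1 (exp1 R) (fun v : R => `|2 ^+ m * v ^+ m|).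
  by apply: L1_norm; apply: L1Z; exact: (exp1_pow _ _).1.
apply: (@L1_le _ _ _ (exp1 R) _ (fun v : R => 1 + `|2 ^+ m * v ^+ m|)).
- exact: measurable_funX.
- by apply: L1D => //; apply: (@L1_bounded _ _ _ 1) => // x; rewrite normr1.
move=> v; rewrite ger0_norm ?sqr_ge0//; set r := Num.sqrt _.
have r0 : 0 <= r by exact: sqrtr_ge0.
have [r1|/ltW r1] := leP r 1.
  have p1 : r `^ nu <= 1.
    by rewrite -[leRHS](powRr0 r) -[leRHS]/(r `^ 0); have := ge0_ler_powR (ltW nu0);
      move=> /(_ r 1); rewrite !nnegrE powR1 powRr0 => ->.
  apply: (@le_trans _ _ 1); last by rewrite lerDl.
  by rewrite expr_le1// powR_ge0.
have v0 : 0 <= 2 * v.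
  rewrite leNgt; apply/negP => v0; move: r1.
  by rewrite /r ler0_sqrtr ?(ltW v0)// ler10.
have pm : r `^ nu <= r ^+ m by rewrite -powR_mulrn// ler_powR.
apply: (@le_trans _ _ (r ^+ m ^+ 2)).
  by rewrite lerXn2r ?nnegrE ?powR_ge0// exprn_ge0.
rewrite -exprM mulnC exprM sqr_sqrtr// exprMn.
by apply: (le_trans (ler_norm _)); rewrite lerDr.
Qed.

Lemma continuous_powR (nu v : R) : 0 < v -> {for v, continuous (@powR R ^~ nu)}.
Proof.
move=> v0; apply/differentiable_continuous/derivable1_diffP.
by apply: derivable_powR; rewrite in_itv/= andbT.
Qed.

Lemma fcvg_laguerre_powR (nu : R) : 0 < nu ->
  fcvg (exp1 R) (@laguerre R) (fun v : R => Num.sqrt (2 * v) `^ nu).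
Proof.
move=> nu0; apply: fcvg_laguerre_nondecreasing; first exact: L2_exp1_powR.
- move=> v v0; apply: (@continuous_comp _ _ _ (fun v : R => Num.sqrt (2 * v)) (@powR R ^~ nu)).
    exact: continuous_sqrt2.
  by apply: continuous_powR; rewrite sqrtr_gt0 mulr_gt0.
- move=> v w v0 vw; apply: ge0_ler_powR; rewrite ?nnegrE ?sqrtr_ge0 ?(ltW nu0)//.
  by rewrite ler_wsqrtr// ler_pM2l.
Qed.

Lemma fcvg_laguerre_ln :
  fcvg (exp1 R) (@laguerre R) (fun v : R => ln (Num.sqrt (2 * v))).
Proof.
apply: fcvg_laguerre_nondecreasing; first exact: L2_exp1_ln.
- move=> v v0; apply: (@continuous_comp _ _ _ (fun v : R => Num.sqrt (2 * v)) (@ln R)).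
    exact: continuous_sqrt2.
  by apply: continuous_ln; rewrite sqrtr_gt0 mulr_gt0.
- move=> v w v0 vw; rewrite ler_ln ?posrE ?sqrtr_gt0 ?mulr_gt0//.
    by rewrite ler_wsqrtr// ler_pM2l.
  exact: lt_le_trans vw.
Qed.

End SquareIntegrability.

(** * Stochastic integrals as an isometry *)

Section ComplexArithmetic.
Variable R : realType.
Implicit Types z w : R[i].

Lemma normc_sqr z : Normc.normc z ^+ 2 = complex.Re z ^+ 2 + complex.Im z ^+ 2.
Proof. by case: z => a b; rewrite /Normc.normc sqr_sqrtr// addr_ge0 ?sqr_ge0. Qed.

Lemma ReM z w : complex.Re (z * w) =
  complex.Re z * complex.Re w - complex.Im z * complex.Im w.
Proof. by case: z; case: w. Qed.

Lemma ImM z w : complex.Im (z * w) =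
  complex.Re z * complex.Im w + complex.Im z * complex.Re w.
Proof. by case: z => a b; case: w => c e. Qed.

Lemma ReD z w : complex.Re (z + w) = complex.Re z + complex.Re w.
Proof. by case: z; case: w. Qed.

Lemma ImD z w : complex.Im (z + w) = complex.Im z + complex.Im w.
Proof. by case: z; case: w. Qed.

Lemma ReN z : complex.Re (- z) = - complex.Re z.
Proof. by case: z. Qed.

Lemma ImN z : complex.Im (- z) = - complex.Im z.
Proof. by case: z. Qed.

Lemma Re_conjc z : complex.Re (conjc z) = complex.Re z.
Proof. by case: z. Qed.

Lemma Im_conjc z : complex.Im (conjc z) = - complex.Im z.
Proof. by case: z. Qed.

Lemma Re_sum I (s : seq I) (p : pred I) (F : I -> R[i]) :
  complex.Re (\sum_(i <- s | p i) F i) = \sum_(i <- s | p i) complex.Re (F i).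
Proof. by apply: (big_morph _ ReD). Qed.

Lemma Im_sum I (s : seq I) (p : pred I) (F : I -> R[i]) :
  complex.Im (\sum_(i <- s | p i) F i) = \sum_(i <- s | p i) complex.Im (F i).
Proof. by apply: (big_morph _ ImD). Qed.

Lemma complexE z w : complex.Re z = complex.Re w -> complex.Im z = complex.Im w ->
  z = w.
Proof. by case: z; case: w => a b c e /= -> ->. Qed.

End ComplexArithmetic.

Section ComplexL2.
Context d (T : measurableType d) (R : realType).
Variable mu : {measure set T -> \bar R}.
Implicit Types (f g h : T -> R[i]) (k : R[i]) (r : R).

Definition C2 f := L2 mu (fun x => complex.Re (f x)) /\
  L2 mu (fun x => complex.Im (f x)).

(** The real part of the Hermitian inner product. Complex coefficients on the test functions will
    recover the imaginary part. *)
Definition cip f g : R := Int mu (fun x =>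
  complex.Re (f x) * complex.Re (g x) + complex.Im (f x) * complex.Im (g x)).

Lemma C2P f : cLp mu 2 f <-> C2 f.
Proof. by split=> -[/L2P f1 /L2P f2]; split => //; exact/L2P. Qed.

Lemma C2_real (f : T -> R) : L2 mu f -> C2 (fun x => (f x)%:C).
Proof. by move=> f2; split => //; exact: L2_0. Qed.

Lemma C2D f g : C2 f -> C2 g -> C2 (fun x => f x + g x).
Proof.
move=> [f1 f2] [g1 g2]; split.
  by under eq_fun do rewrite ReD; exact: L2D.
by under eq_fun do rewrite ImD; exact: L2D.
Qed.

Lemma C2Z k f : C2 f -> C2 (fun x => k * f x).
Proof.
move=> [f1 f2]; split.
  by under eq_fun do rewrite ReM; apply: L2B; exact: L2Z.
by under eq_fun do rewrite ImM; apply: L2D; exact: L2Z.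
Qed.

Lemma C2B f g : C2 f -> C2 g -> C2 (fun x => f x - g x).
Proof.
by move=> f2 g2; apply: C2D => //; under eq_fun do rewrite -mulN1r; exact: C2Z.
Qed.

Lemma C2_0 : C2 (fun=> 0).
Proof. by split; exact: L2_0. Qed.

Lemma C2_sum I (s : seq I) (p : pred I) (F : I -> T -> R[i]) :
  (forall i, p i -> C2 (F i)) -> C2 (fun x => \sum_(i <- s | p i) F i x).
Proof.
move=> F1; elim: s => [|i s IH].
  by under eq_fun do rewrite big_nil; exact: C2_0.
case pi: (p i); last by under eq_fun do rewrite big_cons pi.
by under eq_fun do rewrite big_cons pi; apply: C2D => //; exact: F1.
Qed.

Lemma L1_cip f g : C2 f -> C2 g -> L1 mu (fun x =>
  complex.Re (f x) * complex.Re (g x) + complex.Im (f x) * complex.Im (g x)).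
Proof. by move=> [f1 f2] [g1 g2]; apply: L1D; exact: L2M. Qed.

Lemma cipC f g : cip f g = cip g f.
Proof. by congr (Int _ _); apply/funext => x; ring. Qed.

Lemma cipDr h f g : C2 h -> C2 f -> C2 g ->
  cip h (fun x => f x + g x) = cip h f + cip h g.
Proof.
move=> h2 f2 g2; rewrite /cip -IntD ?L1_cip//.
by congr (Int _ _); apply/funext => x; rewrite ReD ImD; ring.
Qed.

Lemma cipZr f r g : C2 f -> C2 g -> cip f (fun x => r%:C * g x) = r * cip f g.
Proof.
move=> f2 g2; rewrite /cip -IntZ ?L1_cip//.
by congr (Int _ _); apply/funext => x; rewrite !(ReM, ImM)/=; ring.
Qed.

Lemma cipZl f r g : C2 f -> C2 g -> cip (fun x => r%:C * f x) g = r * cip f g.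
Proof. by move=> f2 g2; rewrite cipC cipZr// cipC. Qed.

Lemma cipNr f g : C2 f -> C2 g -> cip f (fun x => - g x) = - cip f g.
Proof.
move=> f2 g2; rewrite -mulN1r -cipZr//; congr (cip _ _); apply/funext => x.
by apply: complexE; rewrite ?(ReM, ImM, ReN, ImN)/=; ring.
Qed.

Lemma C2N f : C2 f -> C2 (fun x => - f x).
Proof. by move=> f2; under eq_fun do rewrite -mulN1r; exact: C2Z. Qed.

Lemma cipBr h f g : C2 h -> C2 f -> C2 g ->
  cip h (fun x => f x - g x) = cip h f - cip h g.
Proof. by move=> h2 f2 g2; rewrite cipDr ?cipNr//; exact: C2N. Qed.

Lemma cipDl h f g : C2 h -> C2 f -> C2 g ->
  cip (fun x => f x + g x) h = cip f h + cip g h.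
Proof. by move=> h2 f2 g2; rewrite cipC cipDr// !(cipC h). Qed.

Lemma cipBl h f g : C2 h -> C2 f -> C2 g ->
  cip (fun x => f x - g x) h = cip f h - cip g h.
Proof. by move=> h2 f2 g2; rewrite cipC cipBr// !(cipC h). Qed.

Lemma cip0r f : cip f (fun=> 0) = 0.
Proof.
by rewrite /cip -[RHS](Int0 mu); congr (Int _ _); apply/funext => x /=; rewrite !mulr0 addr0.
Qed.

Lemma cip_sumr h I (s : seq I) (p : pred I) (F : I -> T -> R[i]) : C2 h ->
  (forall i, p i -> C2 (F i)) ->
  cip h (fun x => \sum_(i <- s | p i) F i x) = \sum_(i <- s | p i) cip h (F i).
Proof.
move=> h2 F2; elim: s => [|i s IH].
  by under eq_fun do rewrite big_nil; rewrite big_nil cip0r.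
case pi: (p i); under eq_fun do rewrite big_cons pi; rewrite big_cons pi//.
by rewrite cipDr ?IH//; [exact: F2|exact: C2_sum].
Qed.

Lemma cip_ge0 f : 0 <= cip f f.
Proof. by apply: Int_ge0 => x; rewrite -!expr2 addr_ge0 ?sqr_ge0. Qed.

Lemma cip_sqrB f g : C2 f -> C2 g ->
  cip (fun x => f x - g x) (fun x => f x - g x) = cip f f - 2 * cip f g + cip g g.
Proof.
move=> f2 g2; have fg := C2B f2 g2.
by rewrite cipBr// !cipBl// (cipC g f); ring.
Qed.

Lemma cip_sqrD_le f g : C2 f -> C2 g ->
  cip (fun x => f x + g x) (fun x => f x + g x) <= 2 * cip f f + 2 * cip g g.
Proof.
move=> f2 g2; have := cip_ge0 (fun x => f x - g x).
by rewrite cip_sqrB// cipDr ?cipDl//; try exact: C2D; rewrite (cipC g f); lra.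
Qed.

Lemma cip_CauchySchwarz f g : C2 f -> C2 g -> cip f g ^+ 2 <= cip f f * cip g g.
Proof.
move=> f2 g2; set a := cip f f; set b := cip f g; set c := cip g g.
have a0 : 0 <= a by exact: cip_ge0.
have c0 : 0 <= c by exact: cip_ge0.
have H r : 0 <= a - 2 * (r * b) + r * (r * c).
  have := cip_ge0 (fun x => f x - r%:C * g x).
  have h2 := C2Z r%:C g2.
  by rewrite cip_sqrB// !(cipZr, cipZl).
have [c00|cn0] := eqVneq c 0.
  have [->|b0] := eqVneq b 0; first by rewrite expr0n/= mulr_ge0.
  have := H ((a + 1) / (2 * b)); rewrite c00.
  have -> : a - 2 * ((a + 1) / (2 * b) * b) + (a + 1) / (2 * b) * ((a + 1) / (2 * b) * 0)
    = -1 by field; rewrite b0.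
  by rewrite lerNr oppr0 ler10.
have cp : 0 < c by rewrite lt_def cn0.
have := H (b / c).
have -> : a - 2 * (b / c * b) + b / c * (b / c * c) = (a * c - b ^+ 2) / c.
  by field.
by rewrite pmulr_lge0 ?invr_gt0// subr_ge0.
Qed.

Lemma cip_small f g (e : R) : C2 f -> C2 g -> cip f f < e ^+ 2 -> 0 <= e ->
  `|cip f g| <= e * Num.sqrt (cip g g).
Proof.
move=> f2 g2 fe e0; have g0 := cip_ge0 g.
rewrite -[leLHS]sqrtr_sqr -(ger0_norm e0) -sqrtr_sqr -sqrtrM ?sqr_ge0// ler_wsqrtr//.
apply: (le_trans (cip_CauchySchwarz f2 g2)).
by rewrite ler_wpM2r// ltW.
Qed.

Lemma sqdistE f g : C2 f -> C2 g ->
  sqdist mu f g = (cip (fun x => f x - g x) (fun x => f x - g x))%:E.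
Proof.
move=> f2 g2; have h2 := C2B f2 g2.
rewrite /sqdist /cip -L1_integral; last exact: L1_cip.
by apply: eq_integral => x _; rewrite normc_sqr !expr2.
Qed.

End ComplexL2.

(** * Mean-square approximation by step functions *)

Section IndicatorApproximation.
Context d (T : measurableType d) (R : realType).

Lemma measurable_indic_approx (f : T -> R) :
  measurable_fun setT f -> (forall x, 0 <= f x) ->
  exists (N : nat -> nat) (r : nat -> nat -> R) (D : nat -> nat -> set T),
    [/\ forall n k, measurable (D n k), forall n k, 0 <= r n k,
        forall n x, \sum_(k < N n) r n k * \1_(D n k) x <= f x
      & forall x, \sum_(k < N n) r n k * \1_(D n k) x @[n --> \oo] --> f x].
Proof.
move=> mf f0.
have mEf : measurable_fun setT (EFin \o f) by exact/measurable_EFinP.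
have f0' : forall x, setT x -> (0 <= (EFin \o f) x)%E by move=> x _; rewrite /= lee_fin.
(* Indices below n 2^n are the dyadic slices of f below level n; the last one stands for the set
   where f >= n. *)
pose r n k : R := if (k < n * 2 ^ n)%N then k%:R * 2 ^- n else n%:R.
pose D n k := if (k < n * 2 ^ n)%N then dyadic_approx setT (EFin \o f) n k
  else integer_approx setT (EFin \o f) n.
have E n x : \sum_(k < (n * 2 ^ n).+1) r n k * \1_(D n k) x =
    approx setT (EFin \o f) n x.
  rewrite big_ord_recr /= /r /D ltnn; congr (_ + _).
  by apply: eq_bigr => k _; rewrite ltn_ord.
exists (fun n => (n * 2 ^ n).+1), r, D; split.
- move=> n k; rewrite /D /dyadic_approx /integer_approx; case: ifPn => kn; rewrite ?kn.
    rewrite -preimage_comp; apply: mEf => //.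
    by apply/measurable_image_EFin; exact: measurable_itv.
  rewrite setTI; have := mEf measurableT _ (emeasurable_itv `[n%:R%:E, +oo[).
  by rewrite setTI; congr measurable; apply/seteqP; split => x /=; rewrite in_itv/= andbT.
- by move=> n k; rewrite /r; case: ifPn => // _; rewrite mulr_ge0// invr_ge0 exprn_ge0.
- by move=> n x; rewrite E -lee_fin; exact: (le_approx n f0').
- move=> x; under eq_fun do rewrite E.
  by apply: (cvg_approx f0') => //; rewrite /= ltry.
Qed.

End IndicatorApproximation.

Section SimpleApproximation.
Variable R : realType.
Local Notation leb := (@lebesgue_measure R).
Implicit Types f g : R -> R[i].

Definition simple n (c : 'I_n -> R[i]) (D : 'I_n -> set R) (x : R) : R[i] :=
  \sum_(k < n) c k * (\1_(D k) x : R)%:C.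

Lemma L2_indic (D : set R) : gauss_dom D -> L2 leb (\1_D : R -> R).
Proof.
move=> [mD fD]; split; first exact: measurable_indic.
apply: L1_ge0.
- by apply: measurable_funX; exact: measurable_indic.
- by move=> x; exact: sqr_ge0.
have -> : (\int[leb]_x ((\1_D x : R) ^+ 2)%:E = \int[leb]_x (\1_D x : R)%:E)%E.
  by apply: eq_integral => x _; rewrite indicE; case: (_ \in _); rewrite ?expr1n ?expr0n.
by rewrite integral_indic// setIT.
Qed.

Lemma C2_indic k (D : set R) : gauss_dom D -> C2 leb (fun x : R => k * (\1_D x : R)%:C).
Proof. by move=> gD; apply: C2Z; apply: C2_real; exact: L2_indic. Qed.

Lemma C2_simple n (c : 'I_n -> R[i]) (D : 'I_n -> set R) :
  (forall k, gauss_dom (D k)) -> C2 leb (simple c D).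
Proof. by move=> gD; apply: C2_sum => k _; exact: C2_indic. Qed.

(** The closure of the step functions carried by sets of finite measure; it is shown to be a closed
    complex subspace and then all of L2. *)
Definition approximable f := C2 leb f /\
  forall e : R, 0 < e -> exists n (c : 'I_n -> R[i]) (D : 'I_n -> set R),
    (forall k, gauss_dom (D k)) /\
    cip leb (fun x : R => f x - simple c D x) (fun x : R => f x - simple c D x) < e.

Lemma approximable_indic k (D : set R) : gauss_dom D ->
  approximable (fun x : R => k * (\1_D x : R)%:C).
Proof.
move=> gD; split; first exact: C2_indic.
move=> e e0; exists 1%N, (fun=> k), (fun=> D); split => //.
rewrite (_ : (fun x : R => _) = fun=> 0) ?cip0r//.
by apply/funext => x; rewrite /simple big_ord1 subrr.
Qed.

Lemma approximable0 : approximable (fun=> 0).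
Proof.
have g0 : gauss_dom (set0 : set R) by split; rewrite ?measure0.
have := approximable_indic 0 g0.
by under eq_fun do rewrite mul0r.
Qed.

Lemma approximableD f g : approximable f -> approximable g ->
  approximable (fun x : R => f x + g x).
Proof.
move=> [f2 fa] [g2 ga]; split; first exact: C2D.
move=> e e0; have e4 : 0 < e / 4 by rewrite divr_gt0.
have [n [c [D [gD nD]]]] := fa _ e4; have [m [c' [D' [gD' mD']]]] := ga _ e4.
pose glue A (a : 'I_n -> A) (b : 'I_m -> A) (k : 'I_(n + m)) :=
  match fintype.split k with inl i => a i | inr j => b j end.
exists (n + m)%N, (glue _ c c'), (glue _ D D'); split.
  by move=> k; rewrite /glue; case: fintype.split.
have -> : (fun x : R => f x + g x - simple (glue _ c c') (glue _ D D') x) =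
    (fun x : R => (f x - simple c D x) + (g x - simple c' D' x)).
  apply/funext => x; rewrite /simple big_split_ord/=.
  under eq_bigr do rewrite /glue (unsplitK (inl _)).
  under [X in _ - (_ + X)]eq_bigr do rewrite /glue (unsplitK (inr _)).
  by rewrite opprD addrACA.
have h1 := C2B f2 (C2_simple c gD); have h2 := C2B g2 (C2_simple c' gD').
by apply: (le_lt_trans (cip_sqrD_le h1 h2)); lra.
Qed.

Lemma approximable_sum I (s : seq I) (p : pred I) (F : I -> R -> R[i]) :
  (forall i, p i -> approximable (F i)) ->
  approximable (fun x : R => \sum_(i <- s | p i) F i x).
Proof.
move=> F1; elim: s => [|i s IH].
  by under eq_fun do rewrite big_nil; exact: approximable0.
case pi: (p i); last by under eq_fun do rewrite big_cons pi.
by under eq_fun do rewrite big_cons pi; apply: approximableD => //; exact: F1.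
Qed.

Lemma approximableZ k f : approximable f -> approximable (fun x : R => k * f x).
Proof.
move=> [f2 fa]; split; first exact: C2Z.
move=> e e0; pose M := Normc.normc k ^+ 2 + 1.
have M0 : 0 < M by rewrite ltr_wpDl// sqr_ge0.
have [n [c [D [gD nD]]]] := fa _ (divr_gt0 e0 M0).
exists n, (fun i => k * c i), D; split => //.
have h1 := C2B f2 (C2_simple c gD).
have -> : (fun x : R => k * f x - simple (fun i => k * c i) D x) =
    (fun x : R => k * (f x - simple c D x)).
  apply/funext => x; rewrite mulrBr /simple mulr_sumr; congr (_ - _).
  by apply: eq_bigr => i _; rewrite mulrA.
rewrite ltr_pdivlMr// in nD; apply: le_lt_trans nD.
set h := (fun x : R => f x - simple c D x).
have -> : cip leb (fun x : R => k * h x) (fun x : R => k * h x) =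
    Normc.normc k ^+ 2 * cip leb h h.
  rewrite /cip -IntZ; last exact: L1_cip.
  by congr (Int _ _); apply/funext => x; rewrite !(ReM, ImM) normc_sqr; ring.
by rewrite mulrC ler_wpM2l ?cip_ge0// lerDl.
Qed.

Lemma approximable_closed f : C2 leb f ->
  (forall e : R, 0 < e -> exists2 g : R -> R[i], approximable g &
     cip leb (fun x : R => f x - g x) (fun x : R => f x - g x) < e) ->
  approximable f.
Proof.
move=> f2 H; split => // e e0; have e4 : 0 < e / 4 by rewrite divr_gt0.
have [g [g2 ga] fg] := H _ e4; have [n [c [D [gD nD]]]] := ga _ e4.
exists n, c, D; split => //.
have -> : (fun x : R => f x - simple c D x) =
    (fun x : R => (f x - g x) + (g x - simple c D x)).
  by apply/funext => x; rewrite addrA subrK.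
have h1 := C2B f2 g2; have h2 := C2B g2 (C2_simple c gD).
by apply: (le_lt_trans (cip_sqrD_le h1 h2)); lra.
Qed.

(** Square integrability with r nonzero forces D to have finite measure, so D is an admissible set
    for [W]. *)
Lemma approximable_scaled_indic (r : R) (D : set R) :
  measurable (D : set (measurableTypeR R)) ->
  L2 leb (fun x : R => r * \1_D x) ->
  approximable (fun x : R => (r * \1_D x)%:C).
Proof.
move=> mD [_ i2]; have [->|r0] := eqVneq r 0.
  by under eq_fun do rewrite mul0r; exact: approximable0.
have gD : gauss_dom D.
  split => //; have := integrable_lty measurableT (L1Z (r ^- 2) i2).
  rewrite (_ : (\int[leb]_x _)%E = leb D)//.
  have E := @integral_indic _ _ _ leb setT measurableT D mD.
  rewrite setIT in E; rewrite -E; apply: eq_integral => x _ /=.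
  rewrite exprMn mulKf ?expf_neq0// indicE.
  by case: (_ \in _); rewrite ?expr1n ?expr0n.
have := approximable_indic r%:C gD; congr approximable; apply/funext => x.
by rewrite -rmorphM.
Qed.

Lemma approximable_ge0 (f : R -> R) : (forall x, 0 <= f x) -> L2 leb f ->
  approximable (fun x : R => (f x)%:C).
Proof.
move=> f0 f2; have mf := L2_measurable f2.
have [N [r [D [mD r0 sf cf]]]] := measurable_indic_approx mf f0.
have t2 n k : (k < N n)%N -> L2 leb (fun x : R => r n k * \1_(D n k) x).
  move=> kN; apply: (L2_le _ f2).
    by apply: measurable_funM => //; exact: measurable_indic.
  move=> x; rewrite !ger0_norm ?mulr_ge0//; apply: le_trans (sf n x).
  rewrite (bigD1 (Ordinal kN))//= lerDl sumr_ge0// => i _.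
  by rewrite mulr_ge0.
pose a n x : R := \sum_(k < N n) r n k * \1_(D n k) x.
have a0 n x : 0 <= a n x by apply: sumr_ge0 => i _; rewrite mulr_ge0.
have aa n : approximable (fun x : R => (a n x)%:C).
  have -> : (fun x : R => (a n x)%:C) =
      (fun x : R => \sum_(k < N n) (r n k * \1_(D n k) x)%:C).
    by apply/funext => x; rewrite rmorph_sum.
  by apply: approximable_sum => i _; apply: approximable_scaled_indic; [exact: mD|exact: t2].
have ma n : measurable_fun setT (a n : measurableTypeR R -> R).
  by apply: measurable_sum => k; apply: measurable_funM => //; exact: measurable_indic.
apply: approximable_closed; first exact: C2_real.
move=> e e0.
have [|||||_] := @cvg_Int_dominated _ _ _ leb (fun n (x : R) => (f x - a n x) ^+ 2) (fun=> 0)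
   (fun x : R => f x ^+ 2).
- by move=> n; apply: measurable_funX; exact: measurable_funB.
- exact: measurable_cst.
- exact: L2_sqr.
- move=> n x; rewrite ger0_norm ?sqr_ge0// lerXn2r ?nnegrE ?subr_ge0//; first exact: sf.
  by rewrite gerBl.
- move=> x; rewrite -[0](mulr0 0) -[X in X * _](subrr (f x)) -[X in _ * X](subrr (f x)).
  under eq_fun do rewrite expr2.
  have c : f x - a n x @[n --> \oo] --> f x - f x.
    by apply: cvgB; [exact: cvg_cst|exact: cf].
  exact: (cvgM c c).
rewrite Int0 => H.
have [n _ Hn] := (@cvgrPdist_lt _ R^o _ _ _ _ _).1 H e e0.
exists (fun x => (a n x)%:C) => //.
have := Hn n (leqnn n); rewrite sub0r normrN; apply: le_lt_trans.
apply: le_trans (ler_norm _); rewrite le_eqVlt; apply/orP; left; apply/eqP.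
congr (Int _ _); apply/funext => x.
by rewrite !(ReD, ImD, ReN, ImN)/=; ring.
Qed.

Lemma approximable_real (f : R -> R) : L2 leb f ->
  approximable (fun x : R => (f x)%:C).
Proof.
move=> f2; have mf := L2_measurable f2.
have p2 : L2 leb (fun x : R => Num.max (f x) 0).
  apply: (L2_le _ f2); first exact: measurable_maxr.
  move=> x; rewrite ger0_norm ?le_max ?lexx ?orbT// ge_max normr_ge0 andbT.
  exact: ler_norm.
have n2 : L2 leb (fun x : R => Num.max (- f x) 0).
  apply: (L2_le _ f2); first by apply: measurable_maxr => //; exact: measurableT_comp.
  move=> x; rewrite ger0_norm ?le_max ?lexx ?orbT// ge_max normr_ge0 andbT.
  by rewrite -normrN; exact: ler_norm.
have := approximableD (approximable_ge0 _ p2) (approximableZ (-1) (approximable_ge0 _ n2)).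
have -> : (fun x : R => (Num.max (f x) 0)%:C + -1 * (Num.max (- f x) 0)%:C) =
    (fun x : R => (f x)%:C).
  apply/funext => x; rewrite mulN1r -rmorphB; congr (_%:C).
  have [h|/ltW h] := lerP 0 (f x).
    have -> : Num.max (- f x) 0 = 0 by apply/max_idPr; rewrite oppr_le0.
    by rewrite subr0.
  have -> : Num.max (- f x) 0 = - f x by apply/max_idPl; rewrite oppr_ge0.
  by rewrite sub0r opprK.
by apply => x; rewrite le_max lexx orbT.
Qed.

Lemma C2_approximable f : C2 leb f -> approximable f.
Proof.
move=> [f1 f2].
have := approximableD (approximable_real f1) (approximableZ 'i (approximable_real f2)).
congr approximable; apply/funext => x.
by apply: complexE; rewrite !(ReD, ImD, ReM, ImM)/=; ring.
Qed.

End SimpleApproximation.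

(** * Stochastic integrals characterised by inner products *)

Section StochasticIntegral.
Context d (T : measurableType d) (R : realType) (P : probability T R).
Local Notation leb := (@lebesgue_measure R).
Variable W : set R -> T -> R[i].
Hypothesis hW : gaussian_random_measure P W.
Implicit Types (f h : R -> R[i]) (Z : T -> R[i]) (D : set R).

Definition wsum n (c : 'I_n -> R[i]) (D : 'I_n -> set R) (w : T) : R[i] :=
  \sum_(k < n) c k * W (D k) w.

Lemma C2_W D : gauss_dom D -> C2 P (W D).
Proof. by move=> gD; case: hW => H *; apply/C2P; exact: H. Qed.

Lemma C2_wsum n (c : 'I_n -> R[i]) (D : 'I_n -> set R) :
  (forall k, gauss_dom (D k)) -> C2 P (wsum c D).
Proof. by move=> gD; apply: C2_sum => k _; apply: C2Z; exact: C2_W. Qed.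

Lemma cip_indic k k' D D' : gauss_dom D -> gauss_dom D' ->
  cip leb (fun x : R => k * (\1_D x : R)%:C) (fun x : R => k' * (\1_D' x : R)%:C) =
  complex.Re (k * conjc k') * fine (leb (D `&` D')).
Proof.
move=> gD gD'.
have E : (\int[leb]_x (\1_(D `&` D') x : R)%:E = (fine (leb (D `&` D')))%:E)%E.
  case: gD => mD fD; case: gD' => mD' _.
  have mI : measurable (D `&` D' : set (measurableTypeR R)) by exact: measurableI.
  rewrite integral_indic// setIT fineK// ge0_fin_numE//.
  by apply: le_lt_trans fD; apply: le_measure; rewrite ?inE//; exact: subIsetl.
have L : L1 leb (\1_(D `&` D') : R -> R).
  apply: L1_ge0 => //; last by rewrite E ltry.
  by apply: measurable_indic; apply: measurableI; [case: gD|case: gD'].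
rewrite /cip -(IntE E) -IntZ//; congr (Int _ _); apply/funext => x.
by rewrite indicI /= !(ReM, ImM) Re_conjc Im_conjc /=; ring.
Qed.

(** The covariance of [W] is real, so only the real part of k conj k' is seen. Agreement with
    [cip_indic] is the isometry on indicators. *)
Lemma cip_W k k' D D' : gauss_dom D -> gauss_dom D' ->
  cip P (fun w => k * W D w) (fun w => k' * W D' w) =
  complex.Re (k * conjc k') * fine (leb (D `&` D')).
Proof.
move=> gD gD'; have [a1 a2] := C2_W gD; have [b1 b2] := C2_W gD'.
case: hW => _ _ _ /(_ D D' gD gD') H _.
pose V w := W D w * conjc (W D' w).
have v1 : L1 P (fun w => complex.Re (V w)).
  rewrite (_ : (fun w => _) = fun w => complex.Re (W D w) * complex.Re (W D' w) +
    complex.Im (W D w) * complex.Im (W D' w)); first by apply: L1_cip; exact: C2_W.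
  by apply/funext => w; rewrite /V ReM Re_conjc Im_conjc mulrN opprK.
have v2 : L1 P (fun w => complex.Im (V w)).
  rewrite (_ : (fun w => _) = fun w => complex.Im (W D w) * complex.Re (W D' w) -
    complex.Re (W D w) * complex.Im (W D' w)); first by apply: L1B; exact: L2M.
  by apply/funext => w; rewrite /V ImM Re_conjc Im_conjc mulrN addrC.
have e1 : Int P (fun w => complex.Re (V w)) = fine (leb (D `&` D')).
  by have := congr1 (@complex.Re R) H.
have e2 : Int P (fun w => complex.Im (V w)) = 0.
  by have := congr1 (@complex.Im R) H.
transitivity (Int P (fun w => complex.Re (k * conjc k') * complex.Re (V w) -
    complex.Im (k * conjc k') * complex.Im (V w))).
  congr (Int _ _); apply/funext => w.
  by rewrite /V !(ReM, ImM) !(Re_conjc, Im_conjc); ring.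
by rewrite IntB ?IntZ ?e1 ?e2 ?mulr0 ?subr0//; exact: L1Z.
Qed.

(* Together with cip h h = cip Z Z this characterizes Z = \int h dW. *)
Definition compatible h Z := forall k D, gauss_dom D ->
  cip leb h (fun x : R => k * (\1_D x : R)%:C) = cip P Z (fun w => k * W D w).

Lemma compatible_indic k D : gauss_dom D ->
  compatible (fun x : R => k * (\1_D x : R)%:C) (fun w => k * W D w).
Proof. by move=> gD k' D' gD'; rewrite cip_indic// cip_W. Qed.

Lemma compatible_sum h Z n (c : 'I_n -> R[i]) (D : 'I_n -> set R) :
  C2 leb h -> C2 P Z -> compatible h Z -> (forall k, gauss_dom (D k)) ->
  cip leb h (simple c D) = cip P Z (wsum c D).
Proof.
move=> h2 Z2 hZ gD; rewrite /simple /wsum !cip_sumr//.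
- by apply: eq_bigr => k _; exact: hZ.
- by move=> k _; apply: C2Z; exact: C2_W.
- by move=> k _; exact: C2_indic.
Qed.

Lemma compatible_simple n (c : 'I_n -> R[i]) (D : 'I_n -> set R) :
  (forall k, gauss_dom (D k)) -> compatible (simple c D) (wsum c D).
Proof.
move=> gD k D' gD'; rewrite cipC [RHS]cipC; apply: compatible_sum => //.
- exact: C2_indic.
- by apply: C2Z; exact: C2_W.
- exact: compatible_indic.
Qed.

Lemma cip_wsum n (c : 'I_n -> R[i]) (D : 'I_n -> set R) :
  (forall k, gauss_dom (D k)) ->
  cip P (wsum c D) (wsum c D) = cip leb (simple c D) (simple c D).
Proof.
move=> gD; symmetry; apply: compatible_sum => //.
- exact: C2_simple.
- exact: C2_wsum.
- exact: compatible_simple.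
Qed.

Lemma stoch_intP f Z : is_stoch_int P W f Z <->
  [/\ C2 leb f, C2 P Z & forall e : R, 0 < e ->
    exists n (c : 'I_n -> R[i]) (D : 'I_n -> set R),
    [/\ forall k, gauss_dom (D k),
        cip leb (fun x : R => f x - simple c D x) (fun x : R => f x - simple c D x) < e
      & cip P (fun w => Z w - wsum c D w) (fun w => Z w - wsum c D w) < e]].
Proof.
split=> [[/C2P f2 /C2P Z2 H]|[f2 Z2 H]]; split=> //; try exact/C2P.
  move=> e e0; have [n [c [D [gD fe Ze]]]] := H e e0.
  exists n, c, D; split => //.
    by rewrite -lte_fin -sqdistE//; exact: C2_simple.
  by rewrite -lte_fin -sqdistE//; exact: C2_wsum.
move=> e e0; have [n [c [D [gD fe Ze]]]] := H e e0.
exists n, c, D; split => //.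
  by rewrite (sqdistE f2 (C2_simple c gD)) lte_fin.
by rewrite (sqdistE Z2 (C2_wsum c gD)) lte_fin.
Qed.

(** Compatibility passes from indicators to step functions by linearity and then to the limit: the
    same step functions approximate f and Z', and Cauchy-Schwarz bounds both errors, with [K]
    collecting the two norms. *)
Lemma stoch_int_cip h Z f Z' : C2 leb h -> C2 P Z -> compatible h Z ->
  is_stoch_int P W f Z' -> cip leb h f = cip P Z Z'.
Proof.
move=> h2 Z2 hZ /stoch_intP[f2 Z'2 H].
pose K := Num.sqrt (cip leb h h) + Num.sqrt (cip P Z Z) + 1.
have K0 : 0 < K by rewrite ltr_wpDl// addr_ge0 ?sqrtr_ge0.
apply/eqP; rewrite -subr_eq0 -normr_le0; apply/ler_addgt0Pr => e e0; rewrite add0r.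
pose a := e / K; have a0 : 0 < a by rewrite divr_gt0.
have [n [c [D [gD fa Za]]]] := H _ (exprn_gt0 2 a0).
have s2 := C2_simple c gD; have w2 := C2_wsum c gD.
have h1 := cip_small (C2B f2 s2) h2 fa (ltW a0).
have h3 := cip_small (C2B Z'2 w2) Z2 Za (ltW a0).
have E := compatible_sum c h2 Z2 hZ gD.
rewrite cipC cipBr// E in h1; rewrite cipC cipBr// in h3.
have -> : cip leb h f - cip P Z Z' = (cip leb h f - cip P Z (wsum c D)) -
  (cip P Z Z' - cip P Z (wsum c D)) by ring.
apply: (le_trans (ler_normB _ _)); apply: (le_trans (lerD h1 h3)).
by rewrite -mulrDr -mulrA -ler_pdivlMl// mulVf ?gt_eqF// ler_pdivrMl// mulr1 lerDl.
Qed.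

Lemma stoch_int_compatible f Z : is_stoch_int P W f Z -> compatible f Z.
Proof.
move=> fZ k D gD; rewrite cipC [RHS]cipC; apply: stoch_int_cip => //.
- exact: C2_indic.
- by apply: C2Z; exact: C2_W.
- exact: compatible_indic.
Qed.

Lemma stoch_int_isometry f Z f' Z' : is_stoch_int P W f Z ->
  is_stoch_int P W f' Z' -> cip leb f f' = cip P Z Z'.
Proof.
move=> fZ fZ'; have /stoch_intP[f2 Z2 _] := fZ.
exact: (stoch_int_cip f2 Z2 (stoch_int_compatible fZ) fZ').
Qed.

(** Expanding squares, the distance from Z to [wsum c D] equals the distance from h to [simple c D]:
    the cross terms agree by compatibility, the square terms by equality of norms. Any step
    approximation of h thus serves for Z too. *)
Lemma compatible_stoch_int h Z : C2 leb h -> C2 P Z -> compatible h Z ->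
  cip leb h h = cip P Z Z -> is_stoch_int P W h Z.
Proof.
move=> h2 Z2 hZ E; apply/stoch_intP; split => // e e0.
have [_ /(_ e e0)[n [c [D [gD nD]]]]] := C2_approximable h2.
exists n, c, D; split => //; have s2 := C2_simple c gD; have w2 := C2_wsum c gD.
by rewrite cip_sqrB// -E cip_wsum// -(compatible_sum c h2 Z2 hZ gD) -cip_sqrB.
Qed.

End StochasticIntegral.

(** * Path integrals of the process *)

Section FubiniReal.
Context d1 d2 (T1 : measurableType d1) (T2 : measurableType d2) (R : realType).
Variable m1 : {sigma_finite_measure set T1 -> \bar R}.
Variable m2 : {sigma_finite_measure set T2 -> \bar R}.
Implicit Types f : T1 * T2 -> R.

(** Sections need not be integrable; writing the integral as that of the positive part minus that of
    the negative part covers every y. *)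
Lemma measurable_Int_section f : measurable_fun setT f ->
  measurable_fun setT (fun y => Int m1 (fun x => f (x, y))).
Proof.
move=> mf; have mEf : measurable_fun setT (EFin \o f) by exact/measurable_EFinP.
apply: (measurableT_comp (fine_measurable measurableT)) => //.
rewrite (_ : (fun y => _) = (fun y => \int[m1]_x ((EFin \o f)^\+ (x, y)) -
   \int[m1]_x ((EFin \o f)^\- (x, y)))%E); last first.
  apply/funext => y; rewrite [LHS]integralE.
  under eq_integral do rewrite (funepos_comp (EFin \o f) (fun x => (x, y)))/=.
  by under [X in (_ - X = _)%E]eq_integral do
    rewrite (funeneg_comp (EFin \o f) (fun x => (x, y)))/=.
apply: emeasurable_funB.
  apply: (measurable_fun_fubini_tonelli_G (m1 := m1) ((EFin \o f)^\+)%E) => //.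
  exact: measurable_funepos.
apply: (measurable_fun_fubini_tonelli_G (m1 := m1) ((EFin \o f)^\-)%E) => //.
exact: measurable_funeneg.
Qed.

Lemma L1_product f (K : T1 -> R) : measurable_fun setT f -> L1 m1 K ->
  (forall x, L1 m2 (fun y => f (x, y))) ->
  (forall x, Int m2 (fun y => `|f (x, y)|) <= K x) -> L1 (m1 \x m2)%E f.
Proof.
move=> mf K1 f1 fK; have mEf : measurable_fun setT (EFin \o f) by exact/measurable_EFinP.
apply/(integrable12ltyP m1 m2 mEf).
apply: (@le_lt_trans _ _ (\int[m1]_x (K x)%:E)%E); last first.
  by rewrite L1_integral// ltry.
apply: ge0_le_integral => //.
- by move=> x _; exact: integral_ge0.
- apply: (measurable_fun_fubini_tonelli_F (m2 := m2) (abse \o (EFin \o f))) => //=.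
  exact: measurableT_comp.
- by apply/measurable_EFinP; exact: L1_measurable K1.
- move=> x _; rewrite (_ : (\int[m2]_y _)%E = (Int m2 (fun y => `|f (x, y)|))%:E) ?lee_fin//.
  by rewrite -L1_integral//; exact: L1_norm.
Qed.

Lemma ae_L1_section f : L1 (m1 \x m2)%E f ->
  \forall y \ae m2, L1 m1 (fun x => f (x, y)).
Proof. by move=> f1; have := ae_integrable2 f1; apply: ae_imp. Qed.

Lemma L1_Int_section f : L1 (m1 \x m2)%E f ->
  L1 m2 (fun y => Int m1 (fun x => f (x, y))).
Proof.
move=> f1; have mf := L1_measurable f1.
have mEf : measurable_fun setT (EFin \o f) by exact/measurable_EFinP.
have mI := measurable_Int_section mf.
apply/integrableP; split; first exact/measurable_EFinP.
apply: le_lt_trans ((integrable21ltyP m1 m2 mEf).1 f1).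
apply: ge0_le_integral => //.
- by apply: measurableT_comp => //; exact/measurable_EFinP.
- apply: (measurable_fun_fubini_tonelli_G (m1 := m1) (abse \o (EFin \o f))) => //=.
  exact: measurableT_comp.
move=> y _; rewrite /Int /Rintegral/=.
apply: (@le_trans _ _ `|\int[m1]_x (f (x, y))%:E|%E).
  by case: (\int[m1]_x _)%E => [r| |]//=; rewrite normr0 leey.
apply: le_abse_integral => //; apply/measurable_EFinP.
exact: (measurableT_comp mf (measurable_pair2 y)).
Qed.

(** Sections in x are integrable only for almost every y. The default values of [Int] on the
    exceptional null set do not affect the outer integral. *)
Lemma Int_fubini f : L1 (m1 \x m2)%E f ->
  (forall x, L1 m2 (fun y => f (x, y))) ->
  Int m2 (fun y => Int m1 (fun x => f (x, y))) =
  Int m1 (fun x => Int m2 (fun y => f (x, y))).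
Proof.
move=> f1 fx; congr fine.
transitivity (\int[m2]_y fubini_G m1 (EFin \o f) y)%E.
  apply: ae_eq_integral => //.
  - by apply/measurable_EFinP; exact: measurable_Int_section (L1_measurable f1).
  - exact: measurable_fubini_G f1.
  apply: ae_imp (ae_L1_section f1) => y y1 _; exact: esym (L1_integral y1).
rewrite integral21_prod_meas1// -integral12_prod_meas1//.
by apply: eq_integral => x _; rewrite -L1_integral.
Qed.

End FubiniReal.

Section L1AlmostEverywhere.
Context d (T : measurableType d) (R : realType).
Variable mu : {measure set T -> \bar R}.

Lemma L1_le_ae (f g : T -> R) : measurable_fun setT f -> L1 mu g ->
  (\forall x \ae mu, `|f x| <= g x) -> L1 mu f.
Proof.
move=> mf g1 fg; apply/integrableP; split; first exact/measurable_EFinP.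
apply: (@le_lt_trans _ _ (\int[mu]_x `|(g x)%:E|)%E); last first.
  by have /integrableP[] := g1.
apply: ae_ge0_le_integral => //.
- by do 2 apply: measurableT_comp => //.
- by apply: measurableT_comp => //; exact/measurable_EFinP/(L1_measurable g1).
apply: ae_imp fg => x fgx _; rewrite /= lee_fin (le_trans fgx)//.
exact: ler_norm.
Qed.

End L1AlmostEverywhere.

Section ProbabilityConstants.
Context d (T : measurableType d) (R : realType) (P : probability T R).

Lemma L2_cst (c : R) : L2 P (fun=> c).
Proof.
split; first exact: measurable_cst.
exact: (finite_measure_integrable_cst P (c ^+ 2)).
Qed.

Lemma Int_cst (c : R) : Int P (fun=> c) = c.
Proof.
apply: IntE; rewrite integral_cst//.
exact: (etrans (congr1 (fun x => c%:E * x)%E (@probability_setT _ _ _ P)) (mule1 _)).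
Qed.

End ProbabilityConstants.

Section PathIntegral.
Context d (T : measurableType d) (R : realType) (P : probability T R).
Local Notation leb := (@lebesgue_measure R).
Variables (X : R -> T -> R) (V : R).
Hypothesis mX : measurable_fun [set: measurableTypeR R * T] (fun p => X p.1 p.2).
Hypothesis X2 : forall s, L2 P (X s).
Hypothesis XV : forall s, Int P (fun w => X s w ^+ 2) <= V.

Definition path_int (a : R -> R) (w : T) : R := Int leb (fun s => X s w * a s).

Lemma measurable_path w : measurable_fun setT (fun s : R => X s w).
Proof. exact: (measurableT_comp mX (measurable_pair2 w)). Qed.

Lemma measurable_comp_fst (f : R -> R) : measurable_fun setT f ->
  measurable_fun [set: measurableTypeR R * T] (fun p => f p.1).
Proof. by move=> mf; exact: (measurableT_comp mf measurable_fst). Qed.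

Lemma measurable_comp_snd (f : T -> R) : measurable_fun setT f ->
  measurable_fun [set: measurableTypeR R * T] (fun p => f p.2).
Proof. by move=> mf; exact: (measurableT_comp mf measurable_snd). Qed.

Variable a : R -> R.
Hypothesis a1 : L1 leb a.

Let ma : measurable_fun setT a := L1_measurable a1.

Lemma measurable_path_int : measurable_fun setT (path_int a).
Proof.
apply: (@measurable_Int_section _ _ _ _ _ leb (fun p => X p.1 p.2 * a p.1)).
by apply: measurable_funM => //; exact: measurable_comp_fst.
Qed.

(** The uniform bound [V] on second moments and |X U| <= X^2 + U^2 give an integrable bound |a s| (V
    + E[U^2]) for the inner integrals. *)
Lemma L1_path_product (U : T -> R) : L2 P U ->
  L1 (leb \x P)%E (fun p => a p.1 * (X p.1 p.2 * U p.2)).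
Proof.
move=> U2.
apply: (@L1_product _ _ _ _ _ leb P _
  (fun s : R => `|a s| * (V + Int P (fun w => U w ^+ 2)))).
- apply: measurable_funM; first exact: measurable_comp_fst.
  by apply: measurable_funM => //; apply: measurable_comp_snd; exact: L2_measurable U2.
- by apply: L1Zr; exact: L1_norm.
- by move=> s /=; apply: L1Z; exact: L2M.
move=> s /=; rewrite (_ : (fun w => _) = fun w => `|a s| * `|X s w * U w|); last first.
  by apply/funext => w; rewrite normrM.
have XU := L1_norm (L2M (X2 s) U2).
rewrite IntZ// ler_wpM2l//.
apply: (@le_trans _ _ (Int P (fun w => X s w ^+ 2 + U w ^+ 2))).
  apply: le_Int => //; first by apply: L1D; [exact: L2_sqr (X2 s)|exact: L2_sqr U2].
  move=> w; rewrite ler_norml.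
  have := sqr_ge0 (X s w + U w); have := sqr_ge0 (X s w - U w).
  have := sqr_ge0 (X s w); have := sqr_ge0 (U w).
  by move=> ? ? ? ?; apply/andP; split; nra.
by rewrite IntD ?lerD2r//; [exact: L2_sqr (X2 s)|exact: L2_sqr U2].
Qed.

Lemma ae_L1_path : \forall w \ae P, L1 leb (fun s : R => X s w * a s).
Proof.
apply: ae_imp (ae_L1_section (L1_path_product (L2_cst P 1))) => w.
by under eq_fun do rewrite /= mulr1 mulrC.
Qed.

Lemma Int_path_int (U : T -> R) : L2 P U ->
  Int P (fun w => path_int a w * U w) =
  Int leb (fun s : R => a s * Int P (fun w => X s w * U w)).
Proof.
move=> U2; have pU := L1_path_product U2.
transitivity (Int P (fun w => Int leb (fun s : R => a s * (X s w * U w)))).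
  apply: ae_eq_Int.
  - by apply: measurable_funM; [exact: measurable_path_int|exact: L2_measurable U2].
  - exact: measurable_Int_section (L1_measurable pU).
  apply: ae_imp ae_L1_path => w w1; rewrite /path_int -IntZr//.
  by congr (Int _ _); apply/funext => s; ring.
rewrite (Int_fubini pU) => [|s /=]; last by apply: L1Z; exact: L2M.
by congr (Int _ _); apply/funext => s /=; rewrite IntZ//; exact: L2M.
Qed.

(** Cauchy-Schwarz for the weight |a(s)| ds on almost every path: the square of the integral is at
    most the integral of |a| times that of |a| X^2, and the latter has finite expectation. *)
Lemma L2_path_int : L2 P (path_int a).
Proof.
split; first exact: measurable_path_int.
have p1 : L1 (leb \x P)%E (fun p => `|a p.1| * X p.1 p.2 ^+ 2).
  apply: (@L1_product _ _ _ _ _ leb P _ (fun s : R => `|a s| * V)).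
  - apply: measurable_funM; last exact: measurable_funX.
    by apply: (measurable_comp_fst (f := fun s => `|a s|)); exact: measurableT_comp.
  - by apply: L1Zr; exact: L1_norm.
  - by move=> s /=; apply: L1Z; exact: L2_sqr (X2 s).
  move=> s /=; rewrite (_ : (fun w => _) = fun w => `|a s| * X s w ^+ 2); last first.
    by apply/funext => w; rewrite ger0_norm// mulr_ge0// sqr_ge0.
  by rewrite IntZ ?ler_wpM2l//; exact: L2_sqr (X2 s).
apply: (L1_le_ae _ (L1Z (Int leb (fun s => `|a s|)) (L1_Int_section p1))).
  by apply: measurable_funX; exact: measurable_path_int.
apply: ae_imp (ae_L1_section p1) => w /= w1; rewrite ger0_norm ?sqr_ge0//.
have mw := measurable_path w.
(* The integrand X a is split as f g, where g is sign(a) sqrt|a|, written as a difference of two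
   square roots so that its measurability is immediate. *)
pose f (s : R) := X s w * Num.sqrt `|a s|.
pose g (s : R) := Num.sqrt (Num.max (a s) 0) - Num.sqrt (Num.max (- a s) 0).
have msqrt := continuous_measurable_fun (@sqrt_continuous R).
have f2 : L2 leb f.
  split; last by under eq_fun do rewrite exprMn sqr_sqrtr// mulrC.
  apply: measurable_funM => //; apply: (measurableT_comp msqrt).
  exact: measurableT_comp.
have gE s : g s ^+ 2 = `|a s| /\ Num.sqrt `|a s| * g s = a s.
  rewrite /g; have [h|/ltW h] := lerP 0 (a s).
    have -> : Num.max (- a s) 0 = 0 by apply/max_idPr; rewrite oppr_le0.
    by rewrite sqrtr0 subr0 (ger0_norm h) -expr2 !sqr_sqrtr.
  have -> : Num.max (- a s) 0 = - a s by apply/max_idPl; rewrite oppr_ge0.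
  by rewrite sqrtr0 sub0r sqrrN mulrN (ler0_norm h) -expr2 !sqr_sqrtr ?oppr_ge0// opprK.
have mg : measurable_fun setT g.
  apply: measurable_funB; apply: (measurableT_comp msqrt); apply: measurable_maxr => //.
  exact: measurableT_comp.
have g2 : L2 leb g.
  by split => //; under eq_fun do rewrite (gE _).1; exact: L1_norm.
have -> : path_int a w = Int leb (fun s => f s * g s).
  congr (Int _ _); apply/funext => s; rewrite /f /g.
  by rewrite -mulrA (gE s).2.
apply: (le_trans (CauchySchwarz f2 g2)).
rewrite mulrC (_ : (fun s => g s ^+ 2) = fun s => `|a s|); last first.
  by apply/funext => s; exact: (gE s).1.
by rewrite (_ : (fun s => f s ^+ 2) = fun s => `|a s| * X s w ^+ 2)//;
  apply/funext => s; rewrite exprMn sqr_sqrtr// mulrC.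
Qed.

End PathIntegral.

(** * The spectral function of a path integral *)

Section SpectralSide.
Variable R : realType.
Local Notation leb := (@lebesgue_measure R).
Variable S : R -> R.
Hypothesis S2 : L2 leb S.

(** The integral over s of a(s) e^(i s lam) S(lam): what the integral of a(s) X(s) should correspond
    to under the spectral representation. *)
Definition spectral_int (a : R -> R) (lam : R) : R[i] := (S lam)%:C *
  (Int leb (fun s : R => a s * cos (s * lam)) +i*
   Int leb (fun s : R => a s * sin (s * lam))).

Let mS : measurable_fun setT S := L2_measurable S2.

Let mprod : measurable_fun [set: measurableTypeR R * measurableTypeR R]
  (fun p => p.1 * p.2).
Proof. by apply: measurable_funM; [exact: measurable_fst|exact: measurable_snd]. Qed.

Variable a : R -> R.
Hypothesis a1 : L1 leb a.

Let ma : measurable_fun setT a := L1_measurable a1.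

Let ma_fst : measurable_fun [set: measurableTypeR R * measurableTypeR R]
  (fun p => a p.1).
Proof. exact: (measurableT_comp ma measurable_fst). Qed.

Lemma L1_mul_bounded (f : R -> R) : measurable_fun setT f ->
  (forall x, `|f x| <= 1) -> L1 leb (fun s : R => a s * f s).
Proof.
move=> mf f1; apply: (@L1_le _ _ _ leb _ (fun s : R => `|a s|)).
- exact: measurable_funM.
- exact: L1_norm.
- by move=> s; rewrite normrM ler_piMr.
Qed.

Lemma L1_cos lam : L1 leb (fun s : R => a s * cos (s * lam)).
Proof.
apply: L1_mul_bounded => [|s]; last exact: normr_cos_le1.
by apply: (measurableT_comp (@measurable_cos R)); exact: measurable_funM.
Qed.

Lemma L1_sin lam : L1 leb (fun s : R => a s * sin (s * lam)).
Proof.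
apply: L1_mul_bounded => [|s]; last exact: normr_sin_le1.
by apply: (measurableT_comp (@measurable_sin R)); exact: measurable_funM.
Qed.

Lemma Int_trig_le (f : R -> R) : L1 leb (fun s : R => a s * f s) ->
  (forall x, `|f x| <= 1) ->
  `|Int leb (fun s : R => a s * f s)| <= Int leb (fun s : R => `|a s|).
Proof.
move=> f1 fb; apply: (le_trans (le_norm_Int f1)); apply: le_Int => //.
- exact: L1_norm.
- exact: L1_norm.
- by move=> s; rewrite normrM ler_piMr.
Qed.

Lemma C2_spectral_int : C2 leb (spectral_int a).
Proof.
have L2_bounded (f : R -> R) (K : R) : measurable_fun setT f ->
    (forall x, `|f x| <= K) -> L2 leb (fun x : R => S x * f x).
  move=> mf fK; apply: (L2_le _ (L2Z K S2)); first exact: measurable_funM.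
  move=> x; rewrite !normrM mulrC ler_wpM2r//.
  exact: le_trans (fK x) (ler_norm _).
split.
  under eq_fun do rewrite /spectral_int ReM/= mul0r subr0.
  apply: (L2_bounded _ (Int leb (fun s : R => `|a s|))).
    have mF : measurable_fun [set: measurableTypeR R * measurableTypeR R]
      (fun p => a p.1 * cos (p.1 * p.2)).
    by apply: measurable_funM => //; exact: (measurableT_comp (@measurable_cos R) mprod).
    exact: (measurable_Int_section leb mF).
  move=> x; apply: Int_trig_le; first exact: L1_cos.
  by move=> s; exact: normr_cos_le1.
under eq_fun do rewrite /spectral_int ImM/= mul0r addr0.
apply: (L2_bounded _ (Int leb (fun s : R => `|a s|))).
  have mF : measurable_fun [set: measurableTypeR R * measurableTypeR R]
      (fun p => a p.1 * sin (p.1 * p.2)).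
  by apply: measurable_funM => //; exact: (measurableT_comp (@measurable_sin R) mprod).
    exact: (measurable_Int_section leb mF).
move=> x; apply: Int_trig_le; first exact: L1_sin.
by move=> s; exact: normr_sin_le1.
Qed.

Lemma C2_expi s : C2 leb (fun lam : R => expi (s * lam) * (S lam)%:C).
Proof.
have ms : measurable_fun setT (fun lam : R => s * lam) by exact: measurable_funM.
split.
  under eq_fun do rewrite ReM/= mulr0 subr0.
  apply: (L2_le _ S2).
    by apply: measurable_funM => //; exact: (measurableT_comp (@measurable_cos R) ms).
  by move=> x; rewrite normrM ler_piMl// normr_cos_le1.
under eq_fun do rewrite ImM/= mulr0 add0r.
apply: (L2_le _ S2).
  by apply: measurable_funM => //; exact: (measurableT_comp (@measurable_sin R) ms).
by move=> x; rewrite normrM ler_piMl// normr_sin_le1.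
Qed.

(** Fubini in s and lam; the product integrand is dominated by |a(s)| (|S Re g| + |S Im g|)(lam),
    since sine and cosine are at most 1 in absolute value. *)
Lemma cip_spectral_int (g : R -> R[i]) : C2 leb g ->
  L1 leb (fun s : R => a s * cip leb (fun lam : R => expi (s * lam) * (S lam)%:C) g) /\
  Int leb (fun s : R => a s * cip leb (fun lam : R => expi (s * lam) * (S lam)%:C) g) =
  cip leb (spectral_int a) g.
Proof.
move=> g2; have [gr gi] := g2.
pose F (p : measurableTypeR R * measurableTypeR R) : R :=
  a p.1 * (cos (p.1 * p.2) * (S p.2 * complex.Re (g p.2)) +
           sin (p.1 * p.2) * (S p.2 * complex.Im (g p.2))).
have E s : (fun lam : R => F (s, lam)) = fun lam : R => a s *
    (complex.Re (expi (s * lam) * (S lam)%:C) * complex.Re (g lam) +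
     complex.Im (expi (s * lam) * (S lam)%:C) * complex.Im (g lam)).
  by apply/funext => lam; rewrite /F !(ReM, ImM)/=; ring.
have Fs s : L1 leb (fun lam : R => F (s, lam)).
  by rewrite E; apply: L1Z; apply: L1_cip => //; exact: C2_expi.
pose B (lam : R) : R := `|S lam * complex.Re (g lam)| + `|S lam * complex.Im (g lam)|.
have B1 : L1 leb B by apply: L1D; apply: L1_norm; exact: L2M.
have FB s : Int leb (fun lam : R => `|F (s, lam)|) <= `|a s| * Int leb B.
  rewrite -IntZ//; apply: le_Int.
  - exact: L1_norm.
  - exact: L1Z.
  move=> lam; rewrite /F normrM ler_wpM2l//.
  apply: (le_trans (ler_normD _ _)); apply: lerD; rewrite normrM ler_piMl//.
    exact: normr_cos_le1.
  exact: normr_sin_le1.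
have F1 : L1 (leb \x leb)%E F.
  apply: (@L1_product _ _ _ _ _ leb leb _ (fun s : R => `|a s| * Int leb B)) => //.
  - apply: measurable_funM => //; apply: measurable_funD.
      apply: measurable_funM; first exact: (measurableT_comp (@measurable_cos R) mprod).
      apply: (measurableT_comp _ measurable_snd (f := fun x : R => S x * complex.Re (g x))).
      by apply: measurable_funM => //; exact: L2_measurable gr.
    apply: measurable_funM; first exact: (measurableT_comp (@measurable_sin R) mprod).
    apply: (measurableT_comp _ measurable_snd (f := fun x : R => S x * complex.Im (g x))).
    by apply: measurable_funM => //; exact: L2_measurable gi.
  - by apply: L1Zr; exact: L1_norm.
have EF : (fun s : R => a s * cip leb (fun lam : R => expi (s * lam) * (S lam)%:C) g)
    = fun s : R => Int leb (fun lam : R => F (s, lam)).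
  apply/funext => s; rewrite E IntZ//; apply: L1_cip => //; exact: C2_expi.
have H := Int_fubini F1 Fs; split.
  rewrite EF; apply: (@L1_le _ _ _ leb _ (fun s : R => `|a s| * Int leb B)).
  - have mF : measurable_fun [set: measurableTypeR R * measurableTypeR R]
        (fun p => F (p.2, p.1)).
      exact: (measurableT_comp (L1_measurable F1) (@measurable_swap _ _ _ _)).
    exact: (measurable_Int_section leb mF).
  - by apply: L1Zr; exact: L1_norm.
  - by move=> s; apply: le_trans (FB s); exact: le_norm_Int.
rewrite EF -H; congr (Int _ _); apply/funext => lam.
transitivity (Int leb (fun s : R =>
   a s * cos (s * lam) * (S lam * complex.Re (g lam)) +
   a s * sin (s * lam) * (S lam * complex.Im (g lam)))).
  by congr (Int _ _); apply/funext => s; rewrite /F/=; ring.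
have c1 := L1_cos lam; have s1 := L1_sin lam.
rewrite (IntD (L1Zr _ c1) (L1Zr _ s1)) (IntZr _ c1) (IntZr _ s1).
by rewrite /spectral_int !(ReM, ImM)/=; ring.
Qed.

End SpectralSide.

Section PathStochasticIntegral.
Context d (T : measurableType d) (R : realType) (P : probability T R).
Local Notation leb := (@lebesgue_measure R).
Variable W : set R -> T -> R[i].
Hypothesis hW : gaussian_random_measure P W.
Variables (X : R -> T -> R) (S : R -> R) (m : R).
Hypothesis mX : measurable_fun [set: measurableTypeR R * T] (fun p => X p.1 p.2).
Hypothesis S2 : L2 leb S.
Hypothesis hX : forall s, is_stoch_int P W (fun lam => expi (s * lam) * (S lam)%:C)
  (fun w => (X s w - m)%:C).

Let X2 s : L2 P (X s).
Proof.
have /stoch_intP[] := hX s => // _ [+ _] _ => X2.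
have := L2D X2 (L2_cst P m); congr (L2 _ _).
by apply/funext => w; rewrite /= subrK.
Qed.

Let V := 2 * Int leb (fun lam => S lam ^+ 2) + 2 * m ^+ 2.

(** By the isometry the second moment of X(s) - m is the integral of |e^(i s lam) S|^2 = S^2, the
    same for all s. *)
Let XV s : Int P (fun w => X s w ^+ 2) <= V.
Proof.
have c2 : L2 P (fun w => X s w - m) by apply: L2B => //; exact: L2_cst.
have -> : (fun w => X s w ^+ 2) = fun w => ((X s w - m) + m) ^+ 2.
  by apply/funext => w; rewrite subrK.
apply: (le_trans (Int_sqrD_le c2 (L2_cst P m))).
rewrite /V lerD//.
  rewrite ler_pM2l// le_eqVlt; apply/orP; left; apply/eqP.
  have := stoch_int_isometry hW (hX s) (hX s); rewrite /cip => E.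
  transitivity (Int P (fun w => complex.Re (X s w - m)%:C * complex.Re (X s w - m)%:C +
    complex.Im (X s w - m)%:C * complex.Im (X s w - m)%:C)).
    by congr (Int _ _); apply/funext => w /=; rewrite mulr0 addr0 expr2.
  rewrite -E; congr (Int _ _); apply/funext => lam.
  rewrite !(ReM, ImM) /=.
  rewrite -[RHS]mul1r -(cos2Dsin2 (s * lam)); ring.
by rewrite Int_cst.
Qed.

(** Fubini reduces the claim to the inner product of X(s) - m with Z at each fixed s, known from
    [stoch_int_cip]. The mean enters as m E[Re Z] times the integral of a, which is zero. *)
Lemma path_cip (a : R -> R) (h : R -> R[i]) (Z : T -> R[i]) :
  L1 leb a -> Int leb a = 0 ->
  C2 leb h -> C2 P Z -> compatible P W h Z ->
  cip P (fun w => (path_int X a w)%:C) Z = cip leb (spectral_int S a) h.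
Proof.
move=> a1 a0 h2 [Zr Zi] hZ.
rewrite -(cip_spectral_int S2 a1 h2).2.
transitivity (Int P (fun w => path_int X a w * complex.Re (Z w))).
  by congr (Int _ _); apply/funext => w /=; rewrite mul0r addr0.
rewrite (Int_path_int mX X2 XV a1 Zr).
pose c := m * Int P (fun w => complex.Re (Z w)).
have Z1 : L1 P (fun w => complex.Re (Z w)).
  have := L2M (L2_cst P 1) Zr; congr (L1 _ _).
  by apply/funext => w; rewrite mul1r.
have E s : Int P (fun w => X s w * complex.Re (Z w)) =
    cip leb (fun lam => expi (s * lam) * (S lam)%:C) h + c.
  rewrite [cip leb _ _]cipC (stoch_int_cip hW h2 (conj Zr Zi) hZ (hX s)).
  have c2 : L2 P (fun w => X s w - m) by apply: L2B => //; exact: L2_cst.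
  transitivity (Int P (fun w => (X s w - m) * complex.Re (Z w) + m * complex.Re (Z w))).
    by congr (Int _ _); apply/funext => w; ring.
  rewrite (IntD (L2M c2 Zr) (L1Z m Z1)) (IntZ m Z1); congr (_ + _).
  by congr (Int _ _); apply/funext => w /=; rewrite mulr0 addr0 mulrC.
transitivity (Int leb (fun s : R =>
   a s * cip leb (fun lam => expi (s * lam) * (S lam)%:C) h + a s * c)).
  by congr (Int _ _); apply/funext => s; rewrite E mulrDr.
by rewrite (IntD (cip_spectral_int S2 a1 h2).1 (L1Zr c a1)) (IntZr c a1) a0 mul0r addr0.
Qed.

(** Compatibility is [path_cip] with Z = k W(D). The equality of norms is [path_cip] again, with Z
    the path integrals themselves, now known to be compatible. *)
Lemma stoch_int_path (a b : R -> R) (r s : R) :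
  L1 leb a -> Int leb a = 0 -> L1 leb b -> Int leb b = 0 ->
  is_stoch_int P W
    (fun lam => r%:C * spectral_int S a lam + s%:C * spectral_int S b lam)
    (fun w => (r * path_int X a w + s * path_int X b w)%:C).
Proof.
move=> a1 a0 b1 b0.
have ha := C2_spectral_int S2 a1; have hb := C2_spectral_int S2 b1.
have Ya : C2 P (fun w => (path_int X a w)%:C).
  by apply: C2_real; exact: L2_path_int X2 XV _ a1.
have Yb : C2 P (fun w => (path_int X b w)%:C).
  by apply: C2_real; exact: L2_path_int X2 XV _ b1.
have -> : (fun w => (r * path_int X a w + s * path_int X b w)%:C) =
    (fun w => r%:C * (path_int X a w)%:C + s%:C * (path_int X b w)%:C).
  by apply/funext => w; rewrite rmorphD !rmorphM.
have ca : compatible P W (spectral_int S a) (fun w => (path_int X a w)%:C).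
  move=> k D gD; symmetry; apply: (path_cip a1 a0 (C2_indic k gD)).
    by apply: C2Z; exact: C2_W hW _ gD.
  exact: compatible_indic.
have cb : compatible P W (spectral_int S b) (fun w => (path_int X b w)%:C).
  move=> k D gD; symmetry; apply: (path_cip b1 b0 (C2_indic k gD)).
    by apply: C2Z; exact: C2_W hW _ gD.
  exact: compatible_indic.
have ha' := C2Z r%:C ha; have hb' := C2Z s%:C hb.
have Ya' := C2Z r%:C Ya; have Yb' := C2Z s%:C Yb.
apply: (compatible_stoch_int hW (C2D ha' hb') (C2D Ya' Yb')).
- move=> k D gD; have i2 := C2_indic k gD; have w2 := C2Z k (C2_W hW gD).
  rewrite (cipDl i2 ha' hb') (cipDl w2 Ya' Yb').
  rewrite (cipZl r ha i2) (cipZl s hb i2) (cipZl r Ya w2) (cipZl s Yb w2).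
  by rewrite ca// cb.
- rewrite (cipDr (C2D ha' hb') ha' hb') (cipDr (C2D Ya' Yb') Ya' Yb').
  rewrite !(cipDl _ ha' hb')// !(cipDl _ Ya' Yb')//.
  rewrite (cipZr r ha' ha) (cipZr r hb' ha) (cipZr s ha' hb) (cipZr s hb' hb).
  rewrite (cipZl r ha ha) (cipZl r ha hb) (cipZl s hb ha) (cipZl s hb hb).
  rewrite (cipZr r Ya' Ya) (cipZr r Yb' Ya) (cipZr s Ya' Yb) (cipZr s Yb' Yb).
  rewrite (cipZl r Ya Ya) (cipZl r Ya Yb) (cipZl s Yb Ya) (cipZl s Yb Yb).
  rewrite (path_cip a1 a0 ha Ya ca) (path_cip a1 a0 hb Yb cb).
  by rewrite (path_cip b1 b0 ha Ya ca) (path_cip b1 b0 hb Yb cb).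
Qed.

End PathStochasticIntegral.

(** * The law of the squared modulus *)

Section ChangeOfLaw.
Context d (T : measurableType d) (R : realType) (mu : {measure set T -> \bar R}).
Variable nu : {measure set (measurableTypeR R) -> \bar R}.
Variable Y : T -> R.
Hypothesis mY : measurable_fun setT (Y : T -> measurableTypeR R).
Hypothesis nuE : forall B : set (measurableTypeR R), measurable B -> nu B = mu (Y @^-1` B).

Lemma ge0_integral_law (g : measurableTypeR R -> \bar R) : measurable_fun setT g ->
  (forall x, (0 <= g x)%E) -> (\int[nu]_x g x = \int[mu]_w g (Y w))%E.
Proof.
move=> mg g0.
have := ge0_integral_pushforward mY mu measurableT mg (fun x _ => g0 x).
rewrite preimage_setT => <-; apply: eq_measure_integral => A mA _.
by rewrite nuE.
Qed.

Lemma integral_law (g : measurableTypeR R -> \bar R) : measurable_fun setT g ->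
  (\int[nu]_x g x = \int[mu]_w g (Y w))%E.
Proof.
move=> mg; rewrite [LHS]integralE [RHS]integralE.
rewrite !ge0_integral_law//; [|exact: measurable_funeneg|exact: measurable_funepos].
by rewrite (funepos_comp g Y) (funeneg_comp g Y).
Qed.

Lemma Int_law (g : R -> R) : measurable_fun setT g ->
  Int mu (fun w => g (Y w)) = Int nu g.
Proof.
move=> mg; congr fine; symmetry.
by apply: (integral_law (g := EFin \o g)); exact/measurable_EFinP.
Qed.

Lemma L1_law (g : R -> R) : measurable_fun setT g ->
  L1 mu (fun w => g (Y w)) <-> L1 nu g.
Proof.
move=> mg; have mEg : measurable_fun setT (EFin \o g) by exact/measurable_EFinP.
have mag : measurable_fun setT (abse \o (EFin \o g)) by exact: measurableT_comp.
have /= E := integral_law mag.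
 split=> /integrableP[_ h]; apply/integrableP; split => //.
- by rewrite [X in (X < _)%E]E.
- by apply/measurable_EFinP; exact: (measurableT_comp mg mY).
- by move: h; rewrite [X in (X < _)%E -> _]E.
Qed.

Lemma L2_law (g : R -> R) : measurable_fun setT g ->
  L2 mu (fun w => g (Y w)) <-> L2 nu g.
Proof.
move=> mg; have mg2 : measurable_fun setT (fun x => g x ^+ 2) by exact: measurable_funX.
split=> -[_ h]; split => //.
- exact: (L1_law mg2).1.
- exact: (measurableT_comp mg mY).
- exact: (L1_law mg2).2 h.
Qed.

End ChangeOfLaw.

(** * Characteristic functions of stochastic integrals *)

Section GaussianCosine.
Context d (T : measurableType d) (R : realType) (P : probability T R).
Local Notation leb := (@lebesgue_measure R).

(** The parameters of the law are read off from the first two moments; a degenerate centred variable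
    is 0 almost surely and both sides are 1. *)
Lemma Int_gaussian_cos (Y : T -> R) : gaussian_rv P Y -> L2 P Y -> Int P Y = 0 ->
  Int P (fun w => cos (Y w)) = expR (- (Int P (fun w => Y w ^+ 2) / 2)).
Proof.
move=> [mY [m [s [[s0 YE]|Ym]]]] Y2 Y0; last first.
  have m0 : m = 0 by rewrite -Y0 (ae_eq_Int (g := fun=> m) mY) ?Int_cst.
  have mY2 : measurable_fun setT (fun w => Y w ^+ 2) by exact: measurable_funX.
  have mcY : measurable_fun setT (fun w => cos (Y w)).
    exact: (measurableT_comp (@measurable_cos R) mY).
  rewrite (ae_eq_Int (g := fun=> 1) mcY)//; last first.
    by apply: ae_imp Ym => w ->; rewrite m0 cos0.
  rewrite (ae_eq_Int (g := fun=> 0) mY2)//; last first.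
    by apply: ae_imp Ym => w ->; rewrite m0 expr0n.
  by rewrite Int0 mul0r oppr0 expR0 Int_cst.
have lawE (B : set (measurableTypeR R)) : measurable B ->
    normal_prob m s B = P (Y @^-1` B) by move=> mB; rewrite YE.
have densE A : measurable A ->
    normal_prob m s A = (\int[leb]_(x in A) (normal_pdf m s x)%:E)%E by [].
have p0 x : 0 <= normal_pdf m s x by exact: normal_pdf_ge0.
have mp : measurable_fun setT (normal_pdf m s) by exact: measurable_normal_pdf.
have E (g : R -> R) : measurable_fun setT g -> L1 P (fun w => g (Y w)) ->
    Int P (fun w => g (Y w)) = Int leb (fun x : R => g x * normal_pdf m s x).
  move=> mg g1; rewrite (Int_law mY lawE mg).
  rewrite (@Int_density _ _ _ leb (normal_prob m s) (normal_pdf m s) mp p0 densE g)//.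
  exact/(L1_law mY lawE mg).
have Y1 : L1 P Y.
  have := L2M (L2_cst P 1) Y2; congr (L1 _ _).
  by apply/funext => w; rewrite mul1r.
have p1 : L1 leb (normal_pdf m s) := L1_normal_pdf m s.
have m0 : m = 0.
  have := E id (@measurable_id _ _ _) Y1; rewrite Y0 => ->.
  transitivity (Int leb (fun x : R => (x - m) * normal_pdf m s x + m * normal_pdf m s x)).
    rewrite (IntD (L1_normal_pdf_id m s0) (L1Z m p1)) (IntZ m p1).
    by rewrite Int_normal_pdf_id// Int_normal_pdf// mulr1 add0r.
  by congr (Int _ _); apply/funext => x; rewrite -mulrDl subrK.
have -> : Int P (fun w => Y w ^+ 2) = s ^+ 2.
  rewrite (E (fun x => x ^+ 2))//; last exact: L2_sqr.
  rewrite -(Int_normal_pdf_sqr m s0); congr (Int _ _); apply/funext => x.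
  by rewrite m0 subr0.
rewrite (E (@cos R)); last 2 first.
- exact: measurable_cos.
- apply: (L1_le _ (L2_sqr (L2_cst P 1))).
    exact: (measurableT_comp (@measurable_cos R) mY).
  by move=> w; rewrite expr1n normr_cos_le1.
have := Int_normal_cos m s0 1; rewrite expr1n mulr1 => <-.
by congr (Int _ _); apply/funext => x; rewrite m0 subr0 mul1r.
Qed.

Lemma cos_lipschitz (x y : R) : `|cos x - cos y| <= `|x - y|.
Proof.
wlog xy : x y / x <= y.
  move=> H; have [|/ltW] := leP x y; first exact: H.
  by move=> /H; rewrite distrC (distrC y).
have [|c _] := @MVT_segment R (@cos R) (fun z => - sin z) x y xy (fun z _ => is_derive_cos z).
  by apply: continuous_subspaceT => z; exact: continuous_cos.
rewrite distrC => ->; rewrite normrM (distrC x) ler_piMl// normrN.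
exact: normr_sin_le1.
Qed.

Lemma expRN_lipschitz (x y : R) : 0 <= x -> 0 <= y ->
  `|expR (- x) - expR (- y)| <= `|x - y|.
Proof.
wlog xy : x y / x <= y.
  move=> H x0 y0; have [h|/ltW h] := leP x y; first exact: H.
  by rewrite distrC (distrC x); exact: H.
move=> x0 y0; rewrite ger0_norm ?subr_ge0 ?ler_expR ?lerN2//.
rewrite (distrC x) (ger0_norm (_ : 0 <= y - x)) ?subr_ge0//.
have -> : expR (- x) - expR (- y) = expR (- x) * (1 - expR (- (y - x))).
  by rewrite mulrBr mulr1 -expRD; congr (_ - expR _); ring.
have e1 : expR (- x) <= 1 by rewrite expR_le1 oppr_le0.
have h := expR_ge1Dx (- (y - x)).
have h2 : expR (- (y - x)) <= 1 by rewrite expR_le1 oppr_le0 subr_ge0.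
apply: (@le_trans _ _ (1 - expR (- (y - x)))); last by lra.
by rewrite ler_piMl// subr_ge0.
Qed.

End GaussianCosine.

Section StochasticIntegralLaw.
Context d (T : measurableType d) (R : realType) (P : probability T R).
Local Notation leb := (@lebesgue_measure R).
Variable W : set R -> T -> R[i].
Hypothesis hW : gaussian_random_measure P W.

Lemma Re_wsum n (c : 'I_n -> R[i]) (D : 'I_n -> set R) w :
  complex.Re (wsum W c D w) = \sum_(k < n)
    (complex.Re (c k) * complex.Re (W (D k) w) + - complex.Im (c k) * complex.Im (W (D k) w)).
Proof. by rewrite /wsum Re_sum; apply: eq_bigr => k _; rewrite ReM mulNr. Qed.

Lemma L2_L1 (f : T -> R) : L2 P f -> L1 P f.
Proof.
move=> f2; have := L2M (L2_cst P 1) f2; congr (L1 _ _).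
by apply/funext => w; rewrite mul1r.
Qed.

Lemma Int_Re_wsum n (c : 'I_n -> R[i]) (D : 'I_n -> set R) :
  (forall k, gauss_dom (D k)) -> Int P (fun w => complex.Re (wsum W c D w)) = 0.
Proof.
move=> gD; under eq_fun do rewrite Re_wsum.
have r1 k : L1 P (fun w => complex.Re (W (D k) w)).
  by apply: L2_L1; case: (C2_W hW (gD k)).
have i1 k : L1 P (fun w => complex.Im (W (D k) w)).
  by apply: L2_L1; case: (C2_W hW (gD k)).
rewrite Int_sum => [|k]; last by apply: L1D; exact: L1Z.
rewrite big1// => k _; rewrite IntD ?IntZ//; [|exact: L1Z|exact: L1Z].
case: hW => _ _ /(_ _ (gD k)) H _ _.
have -> : Int P (fun w => complex.Re (W (D k) w)) = 0 by have := congr1 (@complex.Re R) H.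
have -> : Int P (fun w => complex.Im (W (D k) w)) = 0 by have := congr1 (@complex.Im R) H.
by rewrite !mulr0 addr0.
Qed.

(** The formula holds for finite sums, which are Gaussian by the assumption on [W], and survives
    mean-square limits: cos is 1-Lipschitz, and so is exp(-x) on x >= 0. *)
Lemma Int_stoch_int_cos (f : R -> R[i]) (Z : T -> R) :
  is_stoch_int P W f (fun w => (Z w)%:C) ->
  Int P (fun w => cos (Z w)) = expR (- (cip leb f f / 2)).
Proof.
move=> fZ; have E := stoch_int_isometry hW fZ fZ.
have /(stoch_intP hW)[f2 Z2 H] := fZ; have [Zr _] := Z2; rewrite /= in Zr.
pose q := Int P (fun w => Z w ^+ 2).
have qE : cip leb f f = q.
  by rewrite E; congr (Int _ _); apply/funext => w /=; rewrite mul0r addr0 expr2.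
have q0 : 0 <= q by apply: Int_ge0 => w; exact: sqr_ge0.
rewrite qE; apply/eqP; rewrite -subr_eq0 -normr_le0; apply/ler_addgt0Pr => e e0.
rewrite add0r.
pose K := Num.sqrt q; have K0 : 0 <= K by exact: sqrtr_ge0.
(* The final error is at most a + (2 a K + a^2)/2; as a <= 1, it stays below a (2 + K) <= e. *)
pose a := Num.min 1 (e / (2 + K)).
have K2 : 0 < 2 + K by rewrite ltr_pwDl.
have a0 : 0 < a by rewrite lt_min ltr01 divr_gt0.
have a1 : a <= 1 by rewrite ge_min lexx.
have ae : a * (2 + K) <= e by rewrite -ler_pdivlMr// ge_min lexx orbT.
have [n [c [D [gD _ Za]]]] := H _ (exprn_gt0 2 a0).
(* The sums are complex while Z is real; taking the real part only decreases the distance to Z. *)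
pose V w := complex.Re (wsum W c D w).
have [Vr Vi] := C2_wsum hW c gD.
have ZV : Int P (fun w => (Z w - V w) ^+ 2) <= a ^+ 2.
  apply: le_trans (ltW Za); apply: le_Int.
  - by apply: L2_sqr; exact: L2B.
  - exact: L1_cip (C2B Z2 (C2_wsum hW c gD)) (C2B Z2 (C2_wsum hW c gD)).
  - by move=> w; rewrite ReD ReN /= -!expr2 lerDl sqr_ge0.
have [mV2 mZ] := (L2_sqr Vr, L2_measurable Zr).
have cosE : Int P (fun w => cos (V w)) = expR (- (Int P (fun w => V w ^+ 2) / 2)).
  apply: Int_gaussian_cos => //; last exact: Int_Re_wsum.
  case: hW => _ _ _ _ /(_ n (fun k => complex.Re (c k)) (fun k => - complex.Im (c k)) D gD).
  by congr gaussian_rv; apply/funext => w; rewrite /V Re_wsum.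
set v := Int P (fun w => V w ^+ 2) in cosE.
have v0 : 0 <= v by apply: Int_ge0 => w; exact: sqr_ge0.
have L1cos (Y : T -> R) : measurable_fun setT Y -> L1 P (fun w => cos (Y w)).
  move=> mY; apply: (L1_le _ (L2_sqr (L2_cst P 1))).
    exact: (measurableT_comp (@measurable_cos R) mY).
  by move=> w; rewrite expr1n normr_cos_le1.
have d2 : L2 P (fun w => `|Z w - V w|).
  have [mZV ZV2] := L2B Zr Vr; split; first exact: measurableT_comp.
  by under eq_fun do rewrite real_normK ?num_real//.
have dE : Int P (fun w => `|Z w - V w| ^+ 2) = Int P (fun w => (Z w - V w) ^+ 2).
  by congr (Int _ _); apply/funext => w; rewrite real_normK ?num_real.
have le_a : `|Int P (fun w => (Z w - V w) * Z w)| <= a * K.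
  have Y2 := Zr; rewrite /K /q; set Y := Z in Y2 *.
  have y0 : 0 <= Int P (fun w => Y w ^+ 2) by apply: Int_ge0 => w; exact: sqr_ge0.
  rewrite -sqrtr_sqr -[X in X * _](ger0_norm (ltW a0)) -sqrtr_sqr -sqrtrM ?sqr_ge0//.
  rewrite ler_wsqrtr//; apply: (le_trans (CauchySchwarz (L2B Zr Vr) Y2)).
  by rewrite ler_wpM2r.
have s1 : `|Int P (fun w => cos (Z w)) - Int P (fun w => cos (V w))| <= a.
  have := @le_norm_IntB _ _ _ P _ _ (fun w => `|Z w - V w|) (L1cos _ mZ)
    (L1cos _ (L2_measurable Vr)) (L2_L1 d2) (fun w => cos_lipschitz _ _).
  move=> /le_trans; apply; have := CauchySchwarz d2 (L2_cst P 1).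
  rewrite dE expr1n Int_cst mulr1 => /le_trans /(_ ZV).
  have -> : (fun w => `|Z w - V w| * 1) = fun w => `|Z w - V w|.
    by apply/funext => w; rewrite mulr1.
  by rewrite ler_sqr ?nnegrE ?(ltW a0)// Int_ge0.
have s2 : `|q - v| <= 2 * (a * K) + a ^+ 2.
  have -> : q - v = 2 * Int P (fun w => (Z w - V w) * Z w) - Int P (fun w => (Z w - V w) ^+ 2).
    rewrite -(IntZ _ (L2M (L2B Zr Vr) Zr)).
    rewrite -(IntB (L1Z _ (L2M (L2B Zr Vr) Zr)) (L2_sqr (L2B Zr Vr))).
    rewrite -(IntB (L2_sqr Zr) (L2_sqr Vr)); congr (Int _ _).
    by apply/funext => w; ring.
  apply: (le_trans (ler_normB _ _)); rewrite lerD//.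
    by rewrite normrM ger0_norm// ler_pM2l.
  by rewrite ger0_norm// Int_ge0// => w; exact: sqr_ge0.
have s3 : `|expR (- (q / 2)) - expR (- (v / 2))| <= `|q - v| / 2.
  apply: (le_trans (expRN_lipschitz _ _)); rewrite ?divr_ge0//.
  by rewrite -mulrBl normrM [X in _ * X]ger0_norm.
rewrite cosE in s1.
have -> : Int P (fun w => cos (Z w)) - expR (- (q / 2)) =
  (Int P (fun w => cos (Z w)) - expR (- (v / 2))) - (expR (- (q / 2)) - expR (- (v / 2))) by ring.
apply: (le_trans (ler_normB _ _)); apply: le_trans ae.
have aa : a ^+ 2 <= a by rewrite expr2 ler_piMl// ltW.
by lra.
Qed.

End StochasticIntegralLaw.

(** * The Laplace transform of the squared modulus *)

Section QuadraticLaplace.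
Context d (T : measurableType d) (R : realType) (P : probability T R).
Local Notation leb := (@lebesgue_measure R).
Local Notation gamma := (normal_prob 0 1 : probability (measurableTypeR R) R).

Lemma Int_gamma (g : R -> R) : measurable_fun setT g -> (forall x, `|g x| <= 1) ->
  L1 gamma g /\ Int gamma g = Int leb (fun x : R => g x * normal_pdf 0 1 x).
Proof.
move=> mg g1.
have i1 : L1 gamma g by exact: L1_bounded mg g1.
split=> //; rewrite (@Int_density _ _ _ leb gamma (normal_pdf 0 1))//.
- exact: measurable_normal_pdf.
- by move=> x; exact: normal_pdf_ge0.
Qed.

Lemma Int_gamma_cos (r : R) : Int gamma (fun x : R => cos (r * x)) = expR (- (r ^+ 2 / 2)).
Proof.
rewrite (Int_gamma _ _).2 => [||x]; last exact: normr_cos_le1.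
  have := Int_normal_cos 0 ltr01 r; rewrite expr1n mul1r => <-.
  by congr (Int _ _); apply/funext => x; rewrite subr0.
by apply: (measurableT_comp (@measurable_cos R)); exact: measurable_funM.
Qed.

(** The integrand times the standard density is s times the normal density of variance s^2 =
    1/(1+n), and that density has integral 1. *)
Lemma Int_gamma_expR (n : R) : 0 <= n ->
  Int gamma (fun x : R => expR (- (n * x ^+ 2 / 2))) = (Num.sqrt (1 + n))^-1.
Proof.
move=> n0; have n1 : 0 < 1 + n by rewrite ltr_pwDl.
have mx : measurable_fun setT (fun x : R => expR (- (n * x ^+ 2 / 2))).
  apply: (measurableT_comp (@measurable_expR R)); apply: measurableT_comp => //.
  by apply: measurable_funM => //; apply: measurable_funM => //; exact: measurable_funX.
have ex x : `|expR (- (n * x ^+ 2 / 2)) : R| <= 1.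
  rewrite ger0_norm ?expR_ge0// expR_le1 oppr_le0.
  by rewrite divr_ge0// mulr_ge0// sqr_ge0.
rewrite (Int_gamma mx ex).2.
pose s : R := (Num.sqrt (1 + n))^-1.
have s0 : 0 < s by rewrite invr_gt0 sqrtr_gt0.
have s2 : s ^+ 2 = (1 + n)^-1 by rewrite exprVn sqr_sqrtr// ltW.
have peak : normal_peak 1 = s * normal_peak s :> R.
  rewrite /normal_peak expr1n mul1r -mulrnAr sqrtrM ?sqr_ge0// sqrtr_sqr.
  by rewrite (ger0_norm (ltW s0)) invfM mulVKf// gt_eqF.
transitivity (Int leb (fun x : R => s * normal_pdf 0 s x)).
  congr (Int _ _); apply/funext => x.
  rewrite !normal_pdf_expR// peak expr1n s2 !subr0 mulrCA !mulrA -(mulrA _ (expR _)) -expRD.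
  by congr (_ * expR _); field; rewrite gt_eqF.
by rewrite IntZ ?Int_normal_pdf ?mulr1//; exact: L1_normal_pdf.
Qed.

Variable x : T -> R.
Hypothesis mx : measurable_fun setT x.

(* exp(- n x^2 / 2) is the characteristic function of a standard normal variable
   at sqrt n * x. *)
Lemma Int_expR_sqr (B : T -> R) (n : R) : measurable_fun setT B ->
  (forall w, `|B w| <= 1) -> 0 <= n ->
  Int P (fun w => B w * expR (- (n * x w ^+ 2 / 2))) =
  Int gamma (fun g : R => Int P (fun w => B w * cos (Num.sqrt n * g * x w))).
Proof.
move=> mB B1 n0.
pose F (p : measurableTypeR R * T) : R := B p.2 * cos (Num.sqrt n * p.1 * x p.2).
have mF : measurable_fun setT F.
  apply: measurable_funM; first exact: (measurableT_comp mB measurable_snd).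
  apply: (measurableT_comp (@measurable_cos R)); apply: measurable_funM.
    by apply: measurable_funM => //; exact: measurable_fst.
  exact: (measurableT_comp mx measurable_snd).
have F1 p : `|F p| <= 1.
  by rewrite normrM mulr_ile1// normr_cos_le1.
have Fs g : L1 P (fun w => F (g, w)).
  apply: (L1_le _ (L2_sqr (L2_cst P 1))).
    exact: (measurableT_comp mF (measurable_pair1 g)).
  by move=> w; rewrite expr1n.
have FL : L1 (gamma \x P)%E F.
  apply: (@L1_product _ _ _ _ _ gamma P F (fun=> 1)) => //.
    by have := L2_sqr (L2_cst gamma 1); rewrite expr1n.
  move=> g; rewrite -[leRHS](Int_cst P); apply: le_Int => //.
    exact: L1_norm.
  by have := L2_sqr (L2_cst P 1); rewrite expr1n.
rewrite -[RHS](Int_fubini FL Fs); congr (Int _ _); apply/funext => w.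
transitivity (Int gamma (fun g : R => B w * cos (Num.sqrt n * x w * g))).
  rewrite IntZ.
    by rewrite Int_gamma_cos exprMn sqr_sqrtr.
  apply: (Int_gamma _ _).1 => [|g]; last exact: normr_cos_le1.
  by apply: (measurableT_comp (@measurable_cos R)); exact: measurable_funM.
by congr (Int _ _); apply/funext => g; rewrite /F/= mulrAC.
Qed.

End QuadraticLaplace.

Section SquaredModulusLaw.
Context d (T : measurableType d) (R : realType) (P : probability T R).
Variables x y : T -> R.
Hypotheses (mx : measurable_fun setT x) (my : measurable_fun setT y).
Hypothesis xyE : forall r s : R,
  Int P (fun w => cos (r * x w + s * y w)) = expR (- ((r ^+ 2 + s ^+ 2) / 2)).

Let L1cos (Y : T -> R) : measurable_fun setT Y -> L1 P (fun w => cos (Y w)).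
Proof.
move=> mY; apply: (L1_le _ (L2_sqr (L2_cst P 1))).
  exact: (measurableT_comp (@measurable_cos R) mY).
by move=> w; rewrite expr1n normr_cos_le1.
Qed.

(** The product-to-sum formula and the characteristic function at (r, s) and (r, -s). This
    factorization takes the place of independence. *)
Lemma Int_cos_cos (r s : R) : Int P (fun w => cos (r * x w) * cos (s * y w)) =
  expR (- (r ^+ 2 / 2)) * expR (- (s ^+ 2 / 2)).
Proof.
have mlin (r' s' : R) : measurable_fun setT (fun w => r' * x w + s' * y w).
  by apply: measurable_funD; exact: measurable_funM.
transitivity (Int P (fun w => 2^-1 *
    (cos (r * x w + s * y w) + cos (r * x w + - s * y w)))).
  congr (Int _ _); apply/funext => w.
  rewrite mulNr !cosD cosN sinN.
  by field.
have h1 := L1cos (mlin r s); have h2 := L1cos (mlin r (- s)).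
rewrite (IntZ _ (L1D h1 h2)) (IntD h1 h2) !xyE sqrrN.
rewrite -expRD (_ : - (r ^+ 2 / 2) + - (s ^+ 2 / 2) = - ((r ^+ 2 + s ^+ 2) / 2)).
  by field.
by ring.
Qed.

Local Notation gamma := (normal_prob 0 1 : probability (measurableTypeR R) R).

(** The exponential splits into a factor in x and one in y. Each is in turn replaced by a Gaussian
    average of cosines and contributes (1+n)^(-1/2). *)
Lemma Int_expR_quadratic (n : nat) :
  Int P (fun w => expR (- ((x w ^+ 2 + y w ^+ 2) / 2)) ^+ n) = (1 + n%:R)^-1.
Proof.
have n0 : 0 <= n%:R :> R by [].
have mex (z : T -> R) : measurable_fun setT z ->
    measurable_fun setT (fun w => expR (- (n%:R * z w ^+ 2 / 2))).
  move=> mz; apply: (measurableT_comp (@measurable_expR R)); apply: measurableT_comp => //.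
  by apply: measurable_funM => //; apply: measurable_funM => //; exact: measurable_funX.
have ex (z : T -> R) w : `|expR (- (n%:R * z w ^+ 2 / 2)) : R| <= 1.
  rewrite ger0_norm ?expR_ge0// expR_le1 oppr_le0.
  by rewrite divr_ge0// mulr_ge0// sqr_ge0.
have s1 s : Int P (fun w => cos (s * y w) * expR (- (n%:R * x w ^+ 2 / 2))) =
    (Num.sqrt (1 + n%:R))^-1 * expR (- (s ^+ 2 / 2)).
  rewrite Int_expR_sqr//.
  - rewrite -Int_gamma_expR// -IntZr.
      congr (Int _ _); apply/funext => g.
      under eq_fun do rewrite mulrC.
      by rewrite Int_cos_cos exprMn sqr_sqrtr.
    apply: (Int_gamma _ _).1.
      apply: (measurableT_comp (@measurable_expR R)); apply: measurableT_comp => //.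
      by apply: measurable_funM => //; apply: measurable_funM => //; exact: measurable_funX.
    move=> g; rewrite ger0_norm ?expR_ge0// expR_le1 oppr_le0.
    by rewrite divr_ge0// mulr_ge0// sqr_ge0.
  - by apply: (measurableT_comp (@measurable_cos R)); exact: measurable_funM.
  - by move=> w; exact: normr_cos_le1.
transitivity (Int P (fun w => expR (- (n%:R * x w ^+ 2 / 2)) *
    expR (- (n%:R * y w ^+ 2 / 2)))).
  congr (Int _ _); apply/funext => w; rewrite -expRD -expRM_natl.
  by congr expR; rewrite -mulr_natl; field.
rewrite Int_expR_sqr//; last exact: mex.
transitivity (Int gamma (fun g : R => (Num.sqrt (1 + n%:R))^-1 *
    expR (- (n%:R * g ^+ 2 / 2)))).
  congr (Int _ _); apply/funext => g.
  under eq_fun do rewrite mulrC.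
  by rewrite s1 exprMn sqr_sqrtr.
rewrite IntZ.
  by rewrite Int_gamma_expR// -expr2 exprVn sqr_sqrtr// addr_ge0.
apply: (Int_gamma _ _).1.
  apply: (measurableT_comp (@measurable_expR R)); apply: measurableT_comp => //.
  by apply: measurable_funM => //; apply: measurable_funM => //; exact: measurable_funX.
move=> g; rewrite ger0_norm ?expR_ge0// expR_le1 oppr_le0.
by rewrite divr_ge0// mulr_ge0// sqr_ge0.
Qed.

Lemma exp1_quadratic (B : set (measurableTypeR R)) : measurable B ->
  exp1 R B = P ((fun w => (x w ^+ 2 + y w ^+ 2) / 2) @^-1` B).
Proof.
move=> mB; pose u (w : T) : measurableTypeR R := (x w ^+ 2 + y w ^+ 2) / 2.
have mu : measurable_fun setT u.
  by apply: measurable_funM => //; apply: measurable_funD; exact: measurable_funX.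
pose U : {mfun T >-> measurableTypeR R} := mfun_Sub (mem_set mu).
pose nu : probability (measurableTypeR R) R := distribution P U.
have nuE (C : set (measurableTypeR R)) : measurable C -> nu C = P (u @^-1` C) by [].
rewrite -[RHS]nuE//; apply: laplace_nat_inj => //.
- exact: exp1_ae_ge0.
- exists (`]-oo, 0[%classic : set (measurableTypeR R)); split.
  + exact: measurable_itv.
  + rewrite nuE; last exact: measurable_itv.
    rewrite (_ : u @^-1` _ = set0) ?measure0//; apply/seteqP; split => // w.
    by rewrite /u /= in_itv/= ltNge divr_ge0// addr_ge0// sqr_ge0.
  + by move=> v /= /negP; rewrite -ltNge in_itv.
move=> n; rewrite exp1_laplace_nat /laplace_nat -(Int_law mu nuE).
  by rewrite Int_expR_quadratic.
by apply: measurable_funX; exact: measurable_expRN.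
Qed.

End SquaredModulusLaw.

(** * The chaos expansion *)

Section AffineChangeOfVariable.
Variable R : realType.
Local Notation leb := (@lebesgue_measure R).
Variables (k t : R).
Hypothesis k0 : 0 < k.

Let phi (s : measurableTypeR R) : measurableTypeR R := k * (t - s).

Let mphi : measurable_fun setT phi.
Proof. by apply: measurable_funM => //; exact: measurable_funB. Qed.

Let knng : {nonneg R} := NngNum (ltW k0).

Let nu : {measure set (measurableTypeR R) -> \bar R} := mscale knng leb.

(** By uniqueness of Lebesgue measure it suffices to check []a, b]]. Its preimage is reversed to a
    left-closed interval of length (b - a)/k, and the factor k in [nu] restores the length. *)
Let lebE (B : set (measurableTypeR R)) : measurable B -> leb B = nu (phi @^-1` B).
Proof.
move=> mB.
pose m : {measure set (measurableTypeR R) -> \bar R} :=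
  measure_function_pushforward__canonical__measure_function_Measure nu mphi.
rewrite (@lebesgue_measure_unique _ m)// => X [[a b] /= _ <-].
rewrite /m /= /pushforward /nu /= /mscale /=.
have -> : phi @^-1` `]a, b]%classic = `[t - b / k, t - a / k[%classic.
  apply/seteqP; split => s /=; rewrite /phi !in_itv/= => /andP[h1 h2].
    by rewrite lerBlDr -lerBlDl ler_pdivlMr// ltrBrDr -ltrBrDl ltr_pdivrMr// !(mulrC _ k) h1 h2.
  rewrite mulrC -ltr_pdivrMr// -ler_pdivlMr//.
  by rewrite ltrBrDr -ltrBrDl h2 /= lerBlDr -lerBlDl in h1 *.
rewrite !lebesgue_measure_itv /= !lte_fin ltrD2l ltrN2 ltr_pM2r ?invr_gt0//.
case: ifP => _; last by rewrite mule0.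
by rewrite -!EFinD -EFinM; congr (_%:E); field; rewrite gt_eqF.
Qed.

Let nu_density A : measurable A -> nu A = (\int[leb]_(x in A) (k%:E))%E.
Proof. by move=> mA; rewrite integral_cst. Qed.

Lemma Int_affine (f : R -> R) : L1 leb f ->
  L1 leb (fun s : R => k * f (k * (t - s))) /\
  Int leb (fun s : R => k * f (k * (t - s))) = Int leb f.
Proof.
move=> f1; have mf := L1_measurable f1.
have n1 : L1 nu (fun s => f (phi s)) by apply/(L1_law mphi lebE mf).
have k0' (x : measurableTypeR R) : 0 <= k by exact: ltW.
have mk : measurable_fun setT (fun _ : measurableTypeR R => k) by exact: measurable_cst.
have h1 := L1_densityV mk k0' nu_density n1.
have h2 := Int_density mk k0' nu_density n1.
have E : (fun s : R => k * f (k * (t - s))) = (fun s : R => f (phi s) * k).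
  by apply/funext => s; rewrite mulrC.
by rewrite !E; split => //; rewrite -h2 (Int_law mphi lebE mf).
Qed.

End AffineChangeOfVariable.

(** * The spectral function of a wavelet coefficient *)

Section WaveletSpectrum.
Variable R : realType.
Local Notation leb := (@lebesgue_measure R).
Variables (j : int) (t : R).
Implicit Types f : R -> R.

Definition dilateR f (s : R) : R := (2 : R) ^ (- j) * f ((2 : R) ^ (- j) * (t - s)).

Let k := (2 : R) ^ (- j).

Let k0 : 0 < k. Proof. by rewrite exprz_gt0. Qed.

Lemma L1_dilateR f : L1 leb f -> L1 leb (dilateR f).
Proof. by move=> f1; have [] := Int_affine t k0 f1. Qed.

Lemma Int_dilateR f : L1 leb f -> Int leb (dilateR f) = Int leb f.
Proof. by move=> f1; have [] := Int_affine t k0 f1. Qed.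

Lemma fourierR_trig f lam : L1 leb f -> fourierR f lam =
  Int leb (fun v : R => f v * cos (v * lam)) +i* - Int leb (fun v : R => f v * sin (v * lam)).
Proof.
move=> f1; rewrite -(IntN (L1_sin f1 lam)).
apply: complexE => /=; congr (Rintegral _ _ _); apply/funext => v.
  by rewrite cosN mulr0 subr0 mulrC.
by rewrite sinN mulr0 add0r mulNr mulrC.
Qed.

Lemma fourierRN f lam : L1 leb f -> fourierR f (- lam) = conjc (fourierR f lam).
Proof.
move=> f1; rewrite !fourierR_trig//; congr (_ +i* _).
  by congr (Int _ _); apply/funext => v; rewrite mulrN cosN.
rewrite -(IntN (L1_sin f1 (- lam))) -[in RHS](IntN (L1_sin f1 lam)) -(IntN (L1N (L1_sin f1 lam))).
by congr (Int _ _); apply/funext => v; rewrite mulrN sinN mulrN.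
Qed.

(** Substituting v = 2^(-j) (t - s) turns s lam into t lam - v 2^j lam: the first term gives the
    phase, the second the Fourier transform at 2^j lam. *)
Lemma spectral_int_dilateR (S : R -> R) f lam : L1 leb f ->
  spectral_int S (dilateR f) lam =
  expi (t * lam) * fourierR f ((2 : R) ^ j * lam) * (S lam)%:C.
Proof.
move=> f1; pose l := (2 : R) ^ j * lam.
have kl : k * l = lam.
  by rewrite /l /k mulrA -expfzDr ?pnatr_eq0// addNr expr0z mul1r.
have c1 := L1_cos f1 l; have s1 := L1_sin f1 l.
have cE : Int leb (fun s : R => dilateR f s * cos (s * lam)) =
    cos (t * lam) * Int leb (fun v : R => f v * cos (v * l)) +
    sin (t * lam) * Int leb (fun v : R => f v * sin (v * l)).
  rewrite -(IntZ _ c1) -(IntZ _ s1) -(IntD (L1Z _ c1) (L1Z _ s1)).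
  rewrite -(Int_affine t k0 (L1D (L1Z _ c1) (L1Z _ s1))).2.
  congr (Int _ _); apply/funext => s.
  rewrite /dilateR -/k -[X in _ * X = _]mulr1.
  have -> : s * lam = t * lam - k * (t - s) * l by rewrite mulrAC kl; ring.
  by rewrite cosB; ring.
have sE : Int leb (fun s : R => dilateR f s * sin (s * lam)) =
    sin (t * lam) * Int leb (fun v : R => f v * cos (v * l)) -
    cos (t * lam) * Int leb (fun v : R => f v * sin (v * l)).
  rewrite -(IntZ _ c1) -(IntZ _ s1) -(IntB (L1Z _ c1) (L1Z _ s1)).
  rewrite -(Int_affine t k0 (L1B (L1Z _ c1) (L1Z _ s1))).2.
  congr (Int _ _); apply/funext => s.
  rewrite /dilateR -/k -[X in _ * X = _]mulr1.
  have -> : s * lam = t * lam - k * (t - s) * l by rewrite mulrAC kl; ring.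
  by rewrite sinB; ring.
rewrite /spectral_int cE sE fourierR_trig// -/l.
by apply: complexE; rewrite !(ReM, ImM)/=; ring.
Qed.

End WaveletSpectrum.

(** * Averages of tensor powers over rotations *)

Section RotatedTensorPowers.
Variable R : realType.
Variables (h : R -> R[i]) (sigma : R).
Hypotheses (h0 : h 0 = 0) (sigma0 : 0 < sigma).

(* The spectral counterpart of cos theta * x - sin theta * y when x and y are
   the integrals of h / sigma and of -i sgn h / sigma. *)
Definition rotated (theta lam : R) : R[i] :=
  expi (theta * Num.sg lam) * h lam * (sigma^-1)%:C.

(** The kernel Q without its constant c, once the phase, the wavelet and the spectral density are
    gathered in [h]. *)
Definition balanced_power (m : nat) (v : m.-tuple R) : R[i] :=
  (sigma ^- m)%:C * \prod_(i < m) h (tnth v i) *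
  (count (fun x : R => x < 0) v == m./2)%:R.

Lemma tensor_power_rotated m (theta : R) (v : m.-tuple R) :
  tensor_power (rotated theta) v =
  expi (theta * (\sum_(i < m) sgz (tnth v i))%:~R) *
  ((sigma ^- m)%:C * \prod_(i < m) h (tnth v i)).
Proof.
rewrite /tensor_power /rotated !big_split /= prodr_const card_ord mulrAC -mulrA.
rewrite -(rmorphXn (@real_complex R)) exprVn; congr (_ * (_ * _)).
rewrite (rmorph_sum (intr : int -> R)) mulr_sumr.
rewrite (big_morph (@expi R) (@expiD R) (@expi0 R)).
by apply: eq_bigr => i _; rewrite sgrEz.
Qed.

Lemma count_neg m (v : m.-tuple R) : (forall i, tnth v i != 0) ->
  \sum_(i < m) sgz (tnth v i) = m%:Z - (count (fun x : R => x < 0) v)%:Z *+ 2.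
Proof.
move=> v0; have -> : count (fun x : R => x < 0) v = (\sum_(i < m) (tnth v i < 0)%R)%N.
  by rewrite -sum1_count big_mkcond big_tuple.
rewrite -(mulr_natr _ 2) (big_morph Posz PoszD (erefl 0%:Z)) mulr_suml.
have -> : m%:Z = \sum_(i < m) 1%:Z by rewrite sumr_const card_ord -mulr_natr mul1r natz.
rewrite -sumrB; apply: eq_bigr => i _.
have := v0 i; rewrite neq_lt => /orP[n0|p0].
  by rewrite (ltr0_sgz n0) n0.
by rewrite (gtr0_sgz p0) ltNge (ltW p0).
Qed.

(** The angle enters only through the phase theta times the sum of the signs. That sum lies between
    -2k and 2k, so 2k+1 angles suffice to separate 0 from the other values. *)
Lemma sum_tensor_power_rotated k (v : k.*2.-tuple R) :
  \sum_(q < k.*2.+1) tensor_power (rotated (2 * pi * q%:R / k.*2.+1%:R)) v =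
  k.*2.+1%:R * balanced_power v.
Proof.
under eq_bigr do rewrite tensor_power_rotated.
rewrite -mulr_suml /balanced_power.
(* A zero coordinate spoils the link between signs and the count of negatives, but then both sides
   vanish because h(0) = 0. *)
have [[i /eqP vi]|v0] := pselect (exists i, tnth v i == 0).
  have -> : \prod_(i0 < k.*2) h (tnth v i0) = 0 by rewrite (bigD1 i)//= vi h0 mul0r.
  by rewrite !(mulr0, mul0r).
have vn0 i : tnth v i != 0 by apply/negP => vi; apply: v0; exists i.
rewrite sum_expi; last first.
  rewrite ltnS; apply: (@leq_trans (\sum_(i < k.*2) 1)%N); last by rewrite sum1_card card_ord.
  elim/big_ind2 : _ => // [a1 b1 a2 b2 H1 H2|i _].
    by lia.
  by case: sgzP.
rewrite count_neg// mulrC mulrCA; congr (_ * _).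
have -> : (k.*2%:Z - (count (fun x : R => x < 0) v)%:Z *+ 2 == 0) =
   (count (fun x : R => x < 0) v == k.*2./2).
  by rewrite doubleK; lia.
by case: eqP; rewrite ?mulr1 ?mulr0.
Qed.

Lemma balanced_powerE k (v : k.*2.-tuple R) :
  balanced_power v = \sum_(q < k.*2.+1) (k.*2.+1%:R^-1)%:C *
    tensor_power (rotated (2 * pi * q%:R / k.*2.+1%:R)) v.
Proof.
rewrite -mulr_sumr sum_tensor_power_rotated mulrA.
rewrite -(rmorph_nat (@real_complex R)) -(rmorphM (@real_complex R)) mulVf ?pnatr_eq0//.
by rewrite rmorph1 mul1r.
Qed.

End RotatedTensorPowers.

Section IteratedIntegrals.
Variable R : realType.
Local Notation leb := (@lebesgue_measure R).

(* No measurability is needed, since the integral of a nonnegative function is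
   a supremum over simple functions below it. *)
Lemma ge0_le_integral_sup d (T : measurableType d) (mu : {measure set T -> \bar R})
  (f g : T -> \bar R) : (forall x, (0 <= f x)%E) -> (forall x, (f x <= g x)%E) ->
  (\int[mu]_x f x <= \int[mu]_x g x)%E.
Proof.
move=> f0 fg; rewrite ge0_integralTE// ge0_integralTE => [|x]; last exact: le_trans (fg x).
by apply: le_ereal_sup => _ [s sf <-]; exists s => // x; exact: le_trans (fg x).
Qed.

Lemma integralRn_ge0 m (F : m.-tuple R -> \bar R) : (forall v, (0 <= F v)%E) ->
  (0 <= integralRn F)%E.
Proof.
elim: m F => [|m IH] F F0 /=; first exact: F0.
by apply: integral_ge0 => x _; exact: IH.
Qed.

Lemma le_integralRn m (F G : m.-tuple R -> \bar R) : (forall v, (0 <= F v)%E) ->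
  (forall v, (F v <= G v)%E) -> (integralRn F <= integralRn G)%E.
Proof.
elim: m F G => [|m IH] F G F0 FG /=; first exact: FG.
apply: ge0_le_integral_sup => x; last exact: IH.
exact: integralRn_ge0.
Qed.

Lemma integralRn0 m : integralRn (fun _ : m.-tuple R => 0%E) = 0%E.
Proof. by elim: m => [|m IH] //=; under eq_integral do rewrite IH; rewrite integral0. Qed.

(** The factor K is arbitrary so that, in the induction, it can absorb the value of p at the outer
    variable. *)
Lemma integralRn_prod m (p : R -> R) (K : R) : L1 leb p -> Int leb p = 1 ->
  integralRn (fun v : m.-tuple R => (K * \prod_(i < m) p (tnth v i))%:E) = K%:E.
Proof.
move=> p1 pE; elim: m K => [|m IH] K /=; first by rewrite big_ord0 mulr1.
transitivity (\int[leb]_x (K * p x)%:E)%E.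
  apply: eq_integral => x _; rewrite -IH; congr integralRn; apply/funext => v.
  rewrite big_ord_recl mulrA tnth0; congr (_ * _)%:E.
  by apply: eq_bigr => i _; rewrite tnthS.
by rewrite L1_integral ?IntZ ?pE ?mulr1//; exact: L1Z.
Qed.

End IteratedIntegrals.

Section RotatedIsHermitian.
Variable R : realType.
Local Notation leb := (@lebesgue_measure R).
Variables (h : R -> R[i]) (sigma : R).
Hypotheses (h2 : C2 leb h) (h0 : h 0 = 0) (sigma0 : 0 < sigma).
Hypothesis hN : forall lam, h (- lam) = conjc (h lam).
Hypothesis h_sigma : cip leb h h = sigma ^+ 2.

Lemma measurable_sgr : measurable_fun setT (@Num.sg R).
Proof.
rewrite (_ : Num.sg = (fun x : R => \1_(`]0, +oo[%classic : set R) x - \1_(`]-oo, 0[%classic : set R) x)).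
  by apply: measurable_funB; exact: measurable_indic.
apply/funext => x; rewrite !indicE !mem_setE !in_itv/= andbT.
by have [x0|x0|->] := ltgtP x 0;
  rewrite ?(ltr0_sg x0) ?(gtr0_sg x0) ?sgr0 ?subr0 ?sub0r.
Qed.

Lemma C2_rotated theta : C2 leb (rotated h sigma theta).
Proof.
have [hr hi] := h2.
have mc : measurable_fun setT (fun x : R => cos (theta * Num.sg x)).
  by apply: (measurableT_comp (@measurable_cos R)); apply: measurable_funM => //; exact: measurable_sgr.
have ms : measurable_fun setT (fun x : R => sin (theta * Num.sg x)).
  by apply: (measurableT_comp (@measurable_sin R)); apply: measurable_funM => //; exact: measurable_sgr.
have L2c (f : R -> R) : L2 leb f -> L2 leb (fun x : R => cos (theta * Num.sg x) * f x).
  move=> f2; apply: (L2_le _ f2); first by apply: measurable_funM => //; exact: L2_measurable f2.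
  by move=> x; rewrite normrM ler_piMl// normr_cos_le1.
have L2s (f : R -> R) : L2 leb f -> L2 leb (fun x : R => sin (theta * Num.sg x) * f x).
  move=> f2; apply: (L2_le _ f2); first by apply: measurable_funM => //; exact: L2_measurable f2.
  by move=> x; rewrite normrM ler_piMl// normr_sin_le1.
split.
  under eq_fun do rewrite /rotated !(ReM, ImM)/= mulr0 subr0.
  by apply: L2Zr; apply: L2B; [exact: L2c|exact: L2s].
under eq_fun do rewrite /rotated !(ReM, ImM)/= mulr0 add0r.
by apply: L2Zr; apply: L2D; [exact: L2c|exact: L2s].
Qed.

Lemma rotatedN theta lam :
  rotated h sigma theta (- lam) = conjc (rotated h sigma theta lam).
Proof.
rewrite /rotated hN sgrN mulrN; apply: complexE;
  by rewrite !(ReM, ImM, Re_conjc, Im_conjc)/= cosN sinN; ring.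
Qed.

Lemma normc_sqr_rotated theta lam : Normc.normc (rotated h sigma theta lam) ^+ 2 =
  sigma ^- 2 * Normc.normc (h lam) ^+ 2.
Proof.
rewrite !normc_sqr /rotated !(ReM, ImM)/= -exprVn.
transitivity ((cos (theta * Num.sg lam) ^+ 2 + sin (theta * Num.sg lam) ^+ 2) *
  (sigma^-1 ^+ 2 * (complex.Re (h lam) ^+ 2 + complex.Im (h lam) ^+ 2))); first by ring.
by rewrite cos2Dsin2 mul1r.
Qed.

Let p (lam : R) : R := sigma ^- 2 * Normc.normc (h lam) ^+ 2.

Let pL1 : L1 leb p.
Proof.
apply: L1Z; have := L1_cip h2 h2; congr (L1 _ _); apply/funext => x.
by rewrite normc_sqr !expr2.
Qed.

Let p_Int : Int leb p = 1.
Proof.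
have hL : L1 leb (fun lam : R => Normc.normc (h lam) ^+ 2).
  have := L1_cip h2 h2; congr (L1 _ _); apply/funext => x.
  by rewrite normc_sqr !expr2.
rewrite IntZ// (_ : Int leb _ = sigma ^+ 2).
  by rewrite mulVf// expf_neq0// gt_eqF.
rewrite -h_sigma; congr (Int _ _); apply/funext => x.
by rewrite normc_sqr !expr2.
Qed.

Lemma Hbar1_rotated theta : Hbar1 (rotated h sigma theta).
Proof.
split; [by apply/C2P; exact: C2_rotated| |exact: rotatedN].
under eq_integral do rewrite normc_sqr_rotated.
by rewrite (L1_integral pL1) p_Int.
Qed.

Lemma normc_prod_sqr I (s : seq I) (F : I -> R[i]) :
  Normc.normc (\prod_(i <- s) F i) ^+ 2 = \prod_(i <- s) Normc.normc (F i) ^+ 2.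
Proof.
elim: s => [|i s IH]; first by rewrite !big_nil normc_sqr/= expr1n expr0n addr0.
by rewrite !big_cons Normc.normcM exprMn IH.
Qed.

Lemma cmeasurableM d (T : measurableType d) (f g : T -> R[i]) :
  cmeasurable f -> cmeasurable g -> cmeasurable (fun x => f x * g x).
Proof.
move=> [f1 f2] [g1 g2]; split.
  by under eq_fun do rewrite ReM; apply: measurable_funB; exact: measurable_funM.
by under eq_fun do rewrite ImM; apply: measurable_funD; exact: measurable_funM.
Qed.

Lemma cmeasurable_prod d (T : measurableType d) I (s : seq I) (F : I -> T -> R[i]) :
  (forall i, cmeasurable (F i)) -> cmeasurable (fun x => \prod_(i <- s) F i x).
Proof.
move=> mF; elim: s => [|i s IH].
  by under eq_fun do rewrite big_nil; split; exact: measurable_cst.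
by under eq_fun do rewrite big_cons; exact: cmeasurableM.
Qed.

Lemma cmeasurable_sum d (T : measurableType d) I (s : seq I) (F : I -> T -> R[i]) :
  (forall i, cmeasurable (F i)) -> cmeasurable (fun x => \sum_(i <- s) F i x).
Proof.
move=> mF; split.
  by under eq_fun do rewrite Re_sum; apply: measurable_sum => i; case: (mF i).
by under eq_fun do rewrite Im_sum; apply: measurable_sum => i; case: (mF i).
Qed.

Lemma cmeasurable_tensor_power m (g : R -> R[i]) : C2 leb g ->
  cmeasurable (tensor_power g : m.-tuple (measurableTypeR R) -> R[i]).
Proof.
move=> [gr gi]; apply: cmeasurable_prod => i; split.
  exact: (measurableT_comp (L2_measurable gr) (measurable_tnth i)).
exact: (measurableT_comp (L2_measurable gi) (measurable_tnth i)).
Qed.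

Lemma symmetrize_id m (f : m.-tuple R -> R[i]) :
  (forall (s : 'S_m) v, f [tuple tnth v (s i) | i < m] = f v) -> symmetrize f = f.
Proof.
move=> fs; apply/funext => v; rewrite /symmetrize.
under eq_bigr do rewrite fs.
rewrite sumr_const card_Sn -(mulr_natl (f v)) mulrA mulVf ?mul1r//.
Qed.

Lemma tensor_power_perm m (g : R -> R[i]) (s : 'S_m) (v : m.-tuple R) :
  tensor_power g [tuple tnth v (s i) | i < m] = tensor_power g v.
Proof.
rewrite /tensor_power [RHS](reindex_inj (@perm_inj _ s)) /=.
by apply: eq_bigr => i _; rewrite tnth_mktuple.
Qed.

Lemma tensor_powerN m theta (v : m.-tuple R) :
  tensor_power (rotated h sigma theta) (map_tuple -%R v) =
  conjc (tensor_power (rotated h sigma theta) v).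
Proof.
rewrite /tensor_power rmorph_prod; apply: eq_bigr => i _.
by rewrite tnth_map rotatedN.
Qed.

(** Measurability, symmetry and the Hermitian property are inherited from the tensor powers whose
    average it is. The squared modulus is at most c^2 times a product of the probability densities
    [p]. *)
Lemma Hbar_balanced_power k (c : R) :
  Hbar (fun v : k.*2.-tuple R => c%:C * balanced_power h sigma v) /\
  symmetrize (fun v : k.*2.-tuple R => c%:C * balanced_power h sigma v) =
  (fun v : k.*2.-tuple R => c%:C * balanced_power h sigma v).
Proof.
split; last first.
  apply: symmetrize_id => s v; rewrite !balanced_powerE//; congr (_ * _).
  by apply: eq_bigr => q _; rewrite tensor_power_perm.
split.
- apply: cmeasurableM; first by split; exact: measurable_cst.
  have -> : @balanced_power _ h sigma k.*2 = fun v => \sum_(q < k.*2.+1)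
      (k.*2.+1%:R^-1)%:C * tensor_power (rotated h sigma (2 * pi * q%:R / k.*2.+1%:R)) v.
    by apply/funext => v; exact: balanced_powerE.
  apply: cmeasurable_sum => q; apply: cmeasurableM; first by split; exact: measurable_cst.
  by apply: cmeasurable_tensor_power; exact: C2_rotated.
- apply: (@le_lt_trans _ _ (integralRn (fun v : k.*2.-tuple R =>
    (c ^+ 2 * \prod_(i < k.*2) p (tnth v i))%:E))); last first.
    by rewrite integralRn_prod// ltry.
  apply: le_integralRn => v; first by rewrite lee_fin sqr_ge0.
  rewrite lee_fin /balanced_power !Normc.normcM !exprMn normc_prod_sqr.
  have -> : \prod_(i < k.*2) p (tnth v i) =
      (sigma ^- 2) ^+ k.*2 * \prod_(i < k.*2) Normc.normc (h (tnth v i)) ^+ 2.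
    by rewrite big_split /= prodr_const card_ord.
  rewrite !(normc_sqr _%:C) /= !expr0n !addr0 -exprVn.
  have -> : (sigma ^- 2) ^+ k.*2 = sigma^-1 ^+ k.*2 ^+ 2.
    by rewrite -exprVn -!exprM mulnC.
  rewrite ler_wpM2l ?sqr_ge0// ler_piMr//.
    by rewrite mulr_ge0 ?exprn_ge0 ?invr_ge0 ?(ltW sigma0)// prodr_ge0// => i _; exact: sqr_ge0.
  by case: (_ == _); rewrite normc_sqr/= ?expr1n ?expr0n ?addr0.
move=> v; rewrite !balanced_powerE// rmorphM rmorph_sum; congr (_ * _).
  by apply: complexE; rewrite ?(Re_conjc, Im_conjc)//= oppr0.
apply: eq_bigr => q _; rewrite tensor_powerN rmorphM; congr (_ * _).
by apply: complexE; rewrite ?(Re_conjc, Im_conjc)//= oppr0.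
Qed.

End RotatedIsHermitian.

(** * From the Laguerre series to the chaos expansion *)

Section LaguerreChaos.
Context d (T : measurableType d) (R : realType) (P : probability T R).
Local Notation leb := (@lebesgue_measure R).
Variable W : set R -> T -> R[i].
Variables (h : R -> R[i]) (sigma : R).
Hypotheses (h2 : C2 leb h) (h0 : h 0 = 0) (sigma0 : 0 < sigma).
Hypothesis hN : forall lam, h (- lam) = conjc (h lam).
Hypothesis h_sigma : cip leb h h = sigma ^+ 2.
Variables x y : T -> R.
Hypotheses (mx : measurable_fun setT x) (my : measurable_fun setT y).
Hypothesis xy_int : forall theta, is_stoch_int P W (rotated h sigma theta)
  (fun w => (cos theta * x w - sin theta * y w)%:C).

Let u (w : T) : measurableTypeR R := (x w ^+ 2 + y w ^+ 2) / 2.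

Hypothesis u_law : forall B : set (measurableTypeR R), measurable B ->
  exp1 R B = P (u @^-1` B).

Let mu : measurable_fun setT u.
Proof. by apply: measurable_funM => //; apply: measurable_funD; exact: measurable_funX. Qed.

Let L2_laguerre_u k : L2 P (fun w => laguerre k (u w)).
Proof.
have l2 := L2_laguerre R k.
exact: (L2_law mu u_law (L2_measurable l2)).2 l2.
Qed.

(** The approximation demanded by [is_wiener_ito] is exact, the same for every tolerance: the 2k+1
    rotated functions with equal weights reproduce both the kernel and the random variable. The
    constant in [c_] is the inverse of the one in [sum_hermite_rotation]. *)
Lemma wiener_ito_laguerre (A : R -> R) k : is_wiener_ito P W
  (fun v : k.*2.-tuple R => (c_ A k.*2)%:C * balanced_power h sigma v)
  (fun w => cA A k * laguerre k (u w)).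
Proof.
have [HQ symQ] := Hbar_balanced_power h2 h0 sigma0 hN h_sigma k (c_ A k.*2).
split=> //; first by apply/L2P; exact: L2Z.
move=> e e0; pose theta q : R := 2 * pi * q%:R / k.*2.+1%:R.
exists k.*2.+1, (fun=> c_ A k.*2 / k.*2.+1%:R), (fun q => rotated h sigma (theta q)),
  (fun q w => cos (theta q) * x w - sin (theta q) * y w).
split.
- by move=> q; exact: Hbar1_rotated.
- by move=> q; exact: xy_int.
- rewrite symQ (_ : (fun v => _) = fun=> 0%E) ?integralRn0//.
  apply/funext => v; rewrite balanced_powerE// mulr_sumr -sumrB big1.
    by rewrite normc_sqr /= expr0n addr0.
  move=> q _; rewrite -/(theta q) mulrA.
  by rewrite -(rmorphM (@real_complex R)) subrr.
- rewrite (_ : (fun w => _) = fun=> 0) ?expectation_cst//.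
  apply/funext => w; rewrite -mulr_sumr.
  have := sum_hermite_rotation k (x w) (y w).
  rewrite -/(u w) => /(congr1 (fun z => c_ A k.*2 * z)); rewrite mulrA => ->.
  rewrite /c_ doubleK (mulrA _ _ (laguerre _ _)).
  set a : R := (k.*2)`!%:R; set b : R := k`!%:R; set c : R := (-2) ^+ k.
  have a0 : a != 0 by rewrite pnatr_eq0 -lt0n fact_gt0.
  have b0 : b != 0 by rewrite pnatr_eq0 -lt0n fact_gt0.
  have c0 : c != 0 by rewrite expf_neq0// oppr_eq0 pnatr_eq0.
  have -> : c * b / a * cA A k * (a / (c * b)) = cA A k by field; rewrite a0 b0 c0.
  by rewrite subrr expr0n.
Qed.

Lemma cA_fcoef (A : R -> R) k : L2 (exp1 R) (fun v : R => A (Num.sqrt (2 * v))) ->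
  cA A k = fcoef (exp1 R) (@laguerre R) (fun v : R => A (Num.sqrt (2 * v))) k.
Proof. by move=> g2; rewrite /fcoef Int_exp1//; apply: L2M => //; exact: L2_laguerre. Qed.

Lemma sum_even (F : nat -> R) n :
  \sum_(2 <= l < n | ~~ odd l) F l = \sum_(1 <= k < (n.-1)./2.+1) F k.*2.
Proof.
case: n => [|[|n]]; [by rewrite !big_geq..|].
elim: n => [|n IH]; first by rewrite !big_geq.
rewrite big_mkcond big_nat_recr//= -big_mkcond IH /=.
rewrite uphalf_half; have := odd_double_half n.
case: (odd n) => /= nE; first by rewrite addr0.
rewrite add0n [RHS]big_nat_recr//=; congr (_ + F _).
by rewrite doubleS -[in LHS]nE.
Qed.

Lemma laguerre0 (v : R) : laguerre 0 v = 1 :> R.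
Proof.
rewrite laguerreE big_ord_recl big_ord0 addr0.
by rewrite !expr0 mulr1 mul1r bin0 fact0 divr1.
Qed.

(** Since [u] has the exponential law, the mean-square error on the probability space is s^2 times
    the Laguerre error [ferr]. The term k = 0 is a constant and goes into the expectation. *)
Lemma laguerre_chaos (A : R -> R) (U : T -> R) (e0 s : R) :
  fcvg (exp1 R) (@laguerre R) (fun v : R => A (Num.sqrt (2 * v))) ->
  measurable_fun setT U ->
  (\forall w \ae P, U w = e0 + s * A (Num.sqrt (2 * u w))) ->
  chaos_expansion P W U (e0 + s * cA A 0) s
    (fun l v => (c_ A l)%:C * balanced_power h sigma v).
Proof.
move=> [g2 gcvg] mU UE; set g := (fun v : R => A (Num.sqrt (2 * v))) in g2 gcvg.
have mg := L2_measurable g2.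
have gu2 : L2 P (fun w => g (u w)) by exact: (L2_law mu u_law mg).2 g2.
have V2 : L2 P (fun w => e0 + s * g (u w)) by apply: L2D; [exact: L2_cst|exact: L2Z].
have mV := L2_measurable V2.
have VU : \forall w \ae P, e0 + s * g (u w) = U w by apply: ae_imp UE => w ->.
have U2 : L2 P U.
  split=> //; apply: ae_eq_L1 (L2_sqr V2); [exact: measurable_funX..|].
  by apply: ae_imp VU => w ->.
split; first exact/L2P.
  have U1 := L2_L1 U2.
  rewrite unlock (L1_integral U1) (ae_eq_Int mU mV UE); congr EFin.
  rewrite (IntD (L2_L1 (L2_cst P e0)) (L2_L1 (L2Z s gu2))) (IntZ s (L2_L1 gu2)).
  rewrite Int_cst (Int_law mu u_law mg) cA_fcoef//; congr (_ + _ * _).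
  congr (Int _ _); apply/funext => v; by rewrite laguerre0 mulr1.
exists (fun l w => cA A l./2 * laguerre l./2 (u w)); split.
  move=> l _ lo; have {lo} lE : l = l./2.*2 by rewrite -[LHS]odd_double_half (negbTE lo).
  rewrite lE doubleK; exact: wiener_ito_laguerre.
(* The number of Laguerre terms, including k = 0, that correspond to even indices below n. *)
pose N n := (n.-1)./2.+1.
pose S n w := \sum_(2 <= l < n | ~~ odd l) (cA A l./2 * laguerre l./2 (u w)).
have SE n w : cA A 0 + S n w = fpsum (@laguerre R) (fcoef (exp1 R) (@laguerre R) g) (N n) (u w).
  rewrite /S (sum_even (fun l => cA A l./2 * laguerre l./2 (u w))) /fpsum.
  rewrite -(big_mkord xpredT (fun k => fcoef (exp1 R) (@laguerre R) g k * laguerre k (u w))).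
  rewrite [RHS]big_ltn// laguerre0 mulr1 cA_fcoef//; congr (_ + _).
  by apply: eq_bigr => k _; rewrite doubleK cA_fcoef.
have S2 n : L2 P (S n) by apply: L2_sum => l; exact: L2Z.
have E n : 'E_P[fun w => ((U w - (e0 + s * cA A 0 + s * S n w)) ^+ 2)%R]%E =
    (s ^+ 2 * ferr (exp1 R) (@laguerre R) g (N n))%:E.
  have F2 : L2 P (fun w => U w - (e0 + s * cA A 0 + s * S n w)).
    by apply: L2B => //; apply: L2D; [exact: L2_cst|exact: L2Z].
  rewrite unlock (L1_integral (L2_sqr F2)); congr EFin.
  pose f v := fpsum (@laguerre R) (fcoef (exp1 R) (@laguerre R) g) (N n) v.
  have f2 : L2 (exp1 R) f by apply: L2_fpsum => k; exact: L2_laguerre.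
  have gf2 := L2_sqr (L2B g2 f2).
  have mgf := L1_measurable gf2.
  rewrite /ferr -/f -(Int_law mu u_law mgf).
  have gfu1 : L1 P (fun w => (g (u w) - f (u w)) ^+ 2) by exact: (L1_law mu u_law mgf).2 gf2.
  rewrite -(IntZ _ gfu1); apply: ae_eq_Int.
  - exact: L1_measurable (L2_sqr F2).
  - exact: L1_measurable (L1Z _ gfu1).
  - by apply: ae_imp UE => w ->; rewrite /f -SE /g; ring.
rewrite (_ : (fun n => _) = fun n => (s ^+ 2 * ferr (exp1 R) (@laguerre R) g (N n))%:E); last exact/funext.
apply: cvg_EFin; first exact: nearW.
have Ncvg : N n @[n --> \oo] --> \oo.
  by apply/cvgnyPge => B; exists B.*2.+1 => // n /= Bn; rewrite /N; lia.
have c := cvg_comp N (ferr (exp1 R) (@laguerre R) g) Ncvg gcvg.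
exact: (@cvg0Z R (s ^+ 2) (fun n => ferr (exp1 R) (@laguerre R) g (N n)) c).
Qed.

End LaguerreChaos.

(** * Application to the wavelet modulus *)

Section WaveletChaos.
Context (R : realType) d (T : measurableType d) (P : probability T R).
Local Notation leb := (@lebesgue_measure R).
Variables (psiR psiI : R -> R) (X : R -> {RV P >-> R}) (muX : R) (fX : R -> R).
Variable W : set R -> T -> R[i].
Hypotheses (hpsi : analytic_wavelet psiR psiI) (hW : assumptionW psiR).
Hypotheses (hS : assumptionS X muX fX) (hGRM : gaussian_random_measure P W).
Hypothesis hX : forall t : R,
  is_stoch_int P W (fun lam => expi (t * lam) * (Num.sqrt (fX lam))%:C)
                   (fun w => (X t w - muX)%:C).
Variables (j : int) (t : R).
Local Notation sigma := (sigma_ psiR fX j).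
Hypothesis sigma0 : 0 < sigma.

Let S (lam : R) : R := Num.sqrt (fX lam).

Let fX0 lam : 0 <= fX lam. Proof. by case: hS => -[]. Qed.

Let S2 : L2 leb S.
Proof.
case: hS => -[/L1P f1 _ _ _] *; split; last by under eq_fun do rewrite sqr_sqrtr//.
apply: (measurableT_comp (continuous_measurable_fun (@sqrt_continuous R))).
exact: L1_measurable f1.
Qed.

Let psiR1 : L1 leb psiR. Proof. by case: hpsi => -[/L1P]. Qed.

Let psiI1 : L1 leb psiI. Proof. by case: hpsi => _ [/L1P]. Qed.

(** Positivity of [alpha] enters here. It gives the zero integrals that remove the mean of X, and
    h(0) = 0, which neutralises the frequency where the sign is 0. *)
Let fourierR0 : fourierR psiR 0 = 0.
Proof.
case: hW => _ _ [C [alpha [alpha0 _ _ ->]]].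
by rewrite normr0 powR0 ?mulr0// gt_eqF.
Qed.

Let a := dilateR j t psiR.
Let b := dilateR j t psiI.

Let Int_fourierR0 f : L1 leb f -> Int leb f = complex.Re (fourierR f 0).
Proof.
by move=> f1; rewrite fourierR_trig//=; congr (Int _ _); apply/funext => v; rewrite mulr0 cos0 mulr1.
Qed.

Let a1 : L1 leb a. Proof. exact: L1_dilateR. Qed.

Let b1 : L1 leb b. Proof. exact: L1_dilateR. Qed.

Let a0 : Int leb a = 0.
Proof. by rewrite Int_dilateR// Int_fourierR0// fourierR0. Qed.

Let b0 : Int leb b = 0.
Proof.
rewrite Int_dilateR// Int_fourierR0//; case: hpsi => _ _ ->.
by rewrite fourierR0 mulr0.
Qed.

Let h := spectral_int S a.

Let hE lam : h lam = expi (t * lam) * fourierR psiR ((2 : R) ^ j * lam) * (S lam)%:C.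
Proof. exact: spectral_int_dilateR. Qed.

Let hIE lam : spectral_int S b lam = (0 -i* Num.sg lam) * h lam.
Proof.
rewrite spectral_int_dilateR// hE; case: hpsi => _ _ ->.
by rewrite sgrM gtr0_sg ?exprz_gt0// mul1r -!mulrA (mulrCA (expi _)).
Qed.

Let h2 : C2 leb h. Proof. exact: C2_spectral_int. Qed.

Let h0 : h 0 = 0.
Proof. by rewrite hE !mulr0 fourierR0 mulr0 mul0r. Qed.

Let hN lam : h (- lam) = conjc (h lam).
Proof.
rewrite !hE !mulrN fourierRN// /S; case: hS => -[_ _ -> _] *.
by apply: complexE; rewrite !(ReM, ImM, Re_conjc, Im_conjc)/= cosN sinN; ring.
Qed.

Let normc_sqr_h lam : Normc.normc (h lam) ^+ 2 =
  Normc.normc (fourierR psiR ((2 : R) ^ j * lam)) ^+ 2 * fX lam.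
Proof.
have e1 : Normc.normc (expi (t * lam)) ^+ 2 = 1 by rewrite normc_sqr /= cos2Dsin2.
have s1 : Normc.normc (S lam)%:C ^+ 2 = fX lam.
  by rewrite normc_sqr /= expr0n addr0 sqr_sqrtr.
by rewrite hE !Normc.normcM !exprMn e1 s1 mul1r.
Qed.

Let h_sigma : cip leb h h = sigma ^+ 2.
Proof.
rewrite sqr_sqrtr; last first.
  by apply: Int_ge0 => x; rewrite mulr_ge0// sqr_ge0.
by congr (Int _ _); apply/funext => x; rewrite -normc_sqr_h normc_sqr !expr2.
Qed.

Let Xp s w : R := X s w.

Let mX : measurable_fun [set: measurableTypeR R * T] (fun p => Xp p.1 p.2).
Proof. by case: hS. Qed.

Let x w := sigma^-1 * path_int Xp a w.
Let y w := sigma^-1 * path_int Xp b w.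

Let mx : measurable_fun setT x.
Proof. by apply: measurable_funM => //; exact: measurable_path_int. Qed.

Let my : measurable_fun setT y.
Proof. by apply: measurable_funM => //; exact: measurable_path_int. Qed.

Let xy_stoch_int r s : is_stoch_int P W
  (fun lam => (r%:C + s%:C * (0 -i* Num.sg lam)) * h lam * (sigma^-1)%:C)
  (fun w => (r * x w + s * y w)%:C).
Proof.
have := stoch_int_path hGRM mX S2 hX (r / sigma) (s / sigma) a1 a0 b1 b0.
congr is_stoch_int; apply/funext => z.
  by rewrite hIE !(rmorphM (@real_complex R)) /h; ring.
by rewrite /x /y !mulrA.
Qed.

(** For a sign e = 1 or e = -1, cos theta + i e sin theta = exp(i theta e); at frequency 0 this
    fails, but h vanishes there. *)
Let xy_rotated theta : is_stoch_int P W (rotated h sigma theta)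
  (fun w => (cos theta * x w - sin theta * y w)%:C).
Proof.
have := xy_stoch_int (cos theta) (- sin theta).
congr is_stoch_int; apply/funext => z; last by rewrite mulNr.
have [->|z0] := eqVneq z 0; first by rewrite /rotated h0 !(mulr0, mul0r).
rewrite /rotated; congr (_ * _ * _); apply: complexE; rewrite !(ReD, ImD, ReM, ImM)/=.
  by case: sgrP z0 => //= _ _; rewrite ?mulr1 ?mulrN1 ?cosN; ring.
by case: sgrP z0 => //= _ _; rewrite ?mulr1 ?mulrN1 ?sinN; ring.
Qed.

(** Away from frequency 0, |r - i s sgn|^2 = r^2 + s^2, so the squared norm of the integrand is r^2
    + s^2 after division by sigma^2. *)
Let xy_cos r s : Int P (fun w => cos (r * x w + s * y w)) = expR (- ((r ^+ 2 + s ^+ 2) / 2)).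
Proof.
rewrite (Int_stoch_int_cos hGRM (xy_stoch_int r s)); congr (expR (- (_ / 2))).
transitivity (Int leb (fun lam : R => (r ^+ 2 + s ^+ 2) * sigma ^- 2 *
    (complex.Re (h lam) * complex.Re (h lam) + complex.Im (h lam) * complex.Im (h lam)))).
  congr (Int _ _); apply/funext => z; rewrite -exprVn.
  have hz0 : z = 0 -> h z = 0 by move=> ->.
  move: (h z) hz0 => q hz0.
  have [z0|z0] := eqVneq z 0; first by rewrite (hz0 z0) mulr0 mul0r /=; ring.
  rewrite !(ReD, ImD, ReM, ImM)/=.
  by case: sgrP z0 => //= _ _; ring.
rewrite IntZ; last exact: L1_cip.
by rewrite -/(cip leb h h) h_sigma mulfVK// expf_neq0// gt_eqF.
Qed.

Let u w : measurableTypeR R := (x w ^+ 2 + y w ^+ 2) / 2.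

Let modulusE w : wavelet_modulus X (fun s => psiR s +i* psiI s) j t w = sigma * Num.sqrt (2 * u w).
Proof.
rewrite /wavelet_modulus.
have -> : cint leb (fun s => (X s w)%:C * dilate (fun s => psiR s +i* psiI s) j (t - s)) =
    path_int Xp a w +i* path_int Xp b w.
  rewrite /cint; congr (_ +i* _); congr (Int _ _); apply/funext => s.
    by rewrite !(ReM, ImM)/= !mul0r !subr0.
  by rewrite !(ReM, ImM)/= !mul0r !addr0.
rewrite /Normc.normc -[X in X * _](ger0_norm (ltW sigma0)) -sqrtr_sqr -sqrtrM ?sqr_ge0//.
by congr Num.sqrt; rewrite /u /x /y; field; rewrite gt_eqF.
Qed.

Let mU : measurable_fun setT (fun w => Num.sqrt (2 * u w)).
Proof.
apply: (measurableT_comp (@measurable_sqrt2 R)).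
by apply: measurable_funM => //; apply: measurable_funD; exact: measurable_funX.
Qed.

Let u_law (B : set (measurableTypeR R)) : measurable B -> exp1 R B = P (u @^-1` B).
Proof. exact: (exp1_quadratic mx my xy_cos). Qed.

(** Here B is applied to the modulus and A is expanded; the relation between them moves the scale
    sigma out of the argument, which is how one statement covers powers and the logarithm. *)
Lemma wavelet_chaos (A B : R -> R) (e0 s : R) :
  fcvg (exp1 R) (@laguerre R) (fun v : R => A (Num.sqrt (2 * v))) ->
  measurable_fun setT B -> (forall r, 0 < r -> B (sigma * r) = e0 + s * A r) ->
  chaos_expansion P W (fun w => B (wavelet_modulus X (fun s => psiR s +i* psiI s) j t w))
    (e0 + s * cA A 0) s (Q_ A psiR fX t j).
Proof.
move=> gcvg mB BE.
have -> : @Q_ R A psiR fX t j = fun l v => (c_ A l)%:C * balanced_power h sigma v.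
  apply: functional_extensionality_dep => l; apply/funext => v.
  rewrite /Q_ /balanced_power !mulrA; congr (_ * _ * _).
  by apply: eq_bigr => i _; rewrite hE.
under eq_fun do rewrite modulusE.
apply: (laguerre_chaos h2 h0 sigma0 hN h_sigma mx my xy_rotated u_law gcvg).
  by apply: (measurableT_comp mB); apply: measurable_funM.
have mu : measurable_fun setT u.
  by apply: measurable_funM => //; apply: measurable_funD; exact: measurable_funX.
(* The scaling relation is available for positive arguments. The exceptional null set of the
   exponential law is pulled back through [u], so the modulus is positive almost surely. *)
have [N [mN N0 subN]] := exp1_ae_gt0 R.
exists (u @^-1` N); split.
- by rewrite -[X in measurable X]setTI; exact: mu.
- by rewrite -u_law.
- move=> w /= nw; apply: subN => /= uw; apply: nw.
  by apply: BE; rewrite sqrtr_gt0 mulr_gt0.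
Qed.

End WaveletChaos.

Theorem theorem1 (R : realType) (d : measure_display) (T : measurableType d)
  (P : probability T R)
  (psiR psiI : R -> R)
  (X : R -> {RV P >-> R}) (muX : R) (fX : R -> R)
  (W : set R -> T -> R[i])
  (hpsi : analytic_wavelet psiR psiI)
  (hW : assumptionW psiR)
  (hS : assumptionS X muX fX)
  (hGRM : gaussian_random_measure P W)
  (hX : forall t : R,
     is_stoch_int P W (fun lam => expi (t * lam) * (Num.sqrt (fX lam))%:C)
                      (fun w => (X t w - muX)%:C))
  (j : int) (hsigma : 0 < sigma_ psiR fX j) (t : R) :
  (forall nu : R, 0 < nu ->
     chaos_expansion P W
       (fun w => wavelet_modulus X (fun s => psiR s +i* psiI s) j t w `^ nu)
       (sigma_ psiR fX j `^ nu * cA (fun r => r `^ nu) 0)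
       (sigma_ psiR fX j `^ nu)
       (Q_ (fun r => r `^ nu) psiR fX t j))
  /\
  chaos_expansion P W
    (fun w => ln (wavelet_modulus X (fun s => psiR s +i* psiI s) j t w))
    (cA (@ln R) 0 + ln (sigma_ psiR fX j))
    1
    (Q_ (@ln R) psiR fX t j).
Proof.
have chaos := wavelet_chaos hpsi hW hS hGRM hX t hsigma.
split=> [nu nu0|].
  rewrite -[X in chaos_expansion _ _ _ X]add0r.
  apply: (chaos (fun r => r `^ nu) (fun r => r `^ nu)).
  - exact: fcvg_laguerre_powR.
  - exact: measurable_powR.
  - by move=> r r0; rewrite add0r powRM// ltW.
rewrite addrC -[X in _ + X]mul1r.
apply: (chaos (@ln R) (@ln R)).
- exact: fcvg_laguerre_ln.
- exact: measurable_ln.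
- by move=> r r0; rewrite mul1r lnM.
Qed.
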